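(* Let $E$ be a solid TIBF of bounded type on $\mathbb{R}^d$ and let $\mathcal{W}=(w_n)_{n\in\mathbb{N}}$ be a weight function system on $\mathbb{R}^d$ satisfying $(\mathrm{wM})$: for every $n\in\mathbb{N}$ there exist $m\ge n$ and $C>0$ such that $w_n(x+y)\le C w_m(x)$ for all $x\in\mathbb{R}^d$ and $|y|\le1$. Consider the two assertions (S) for every $n\in\mathbb{N}$ there exists $m\ge n$ such that $w_n^2/w_m\in L^\infty(\mathbb{R}^d)$; (M) $\displaystyle \mathcal{O}_M(\dot{\mathcal{B}}_{\mathcal{W}},E^\infty_{\mathcal{W}})=\Big\{f\in C^\infty(\mathbb{R}^d) : \text{for all }\alpha\in\mathbb{N}^d\text{ there is } n\in\mathbb{N}\text{ such that } \frac{f^{(\alpha)}}{w_n}\in E_{\mathrm{mc}}\Big\}.$ Then (S) implies (M). If moreover $L^\infty(\mathbb{R}^d)\subseteq E_{\mathrm{mc}}$, then conversely (M) implies (S).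
   Context: $\mathbb{N}=\{0,1,2,\dots\}$; $\mathcal{D}'$ is the space of distributions on $\mathbb{R}^d$; $T_xf(t)=f(t-x)$; $1_K$ is the indicator function of $K$. Solid TIBF of bounded type: a Banach space $(E,\|\cdot\|_E)$ is a translation-invariant Banach function space (TIBF) of bounded type on $\mathbb{R}^d$ if $E$ is non-trivial, $E\subseteq L^1_{\mathrm{loc}}(\mathbb{R}^d)$ continuously, and: (A.1) $T_xE\subseteq E$ for all $x\in\mathbb{R}^d$; (A.2) there is $C_0>0$ with $\|T_xf\|_E\le C_0\|f\|_E$ for all $x\in\mathbb{R}^d$, $f\in E$; (A.3) $E$ is a Banach module over $L^1(\mathbb{R}^d)$ under convolution ($\|f*\varphi\|_E\le\|f\|_E\|\varphi\|_{L^1}$). It is solid if $f\in E$, $g\in L^1_{\mathrm{loc}}(\mathbb{R}^d)$ and $|g|\le|f|$ a.e. imply $g\in E$ and $\|g\|_E\le\|f\|_E$. Multiplicative module completion: $E_{\mathrm{mc}}:=\{f\in L^1_{\mathrm{loc}}(\mathbb{R}^d): 1_Kf\in E\text{ for all compact }K\subset\mathbb{R}^d\text{ and }\|f\|_{E_{\mathrm{mc}}}:=\sup_K\|1_Kf\|_E<\infty\}$, the supremum being over compact $K\subset\mathbb{R}^d$. A weight function is a locally bounded measurable function $\mathbb{R}^d\to[1,\infty)$; a weight function system is a sequence $\mathcal{W}=(w_n)_{n\in\mathbb{N}}$ of weight functions with $w_n\le w_{n+1}$ for all $n$. $E^\infty_{\mathcal{W}}:=\{f\in\mathcal{D}': f^{(\alpha)}w_n\in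 E\text{ for all }n\in\mathbb{N},\ |\alpha|\le n\}$ (each distributional derivative $f^{(\alpha)}$ being in $L^1_{\mathrm{loc}}$). $L^0=L^0(\mathbb{R}^d)$ is the space of all $f\in L^\infty(\mathbb{R}^d)$ such that for every $\varepsilon>0$ there is a compact $K$ with $\|(1-1_K)f\|_{L^\infty}<\varepsilon$, with the $L^\infty$-norm; it is a solid TIBF of bounded type, and $\dot{\mathcal{B}}_{\mathcal{W}}:=(L^0)^\infty_{\mathcal{W}}$. Multiplier space: $\mathcal{O}_M(\dot{\mathcal{B}}_{\mathcal{W}},E^\infty_{\mathcal{W}}):=\{f\in\mathcal{D}': f\cdot\varphi\in E^\infty_{\mathcal{W}}\text{ for all }\varphi\in\dot{\mathcal{B}}_{\mathcal{W}}\}$. *)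

(* Defs.v *)
From HB Require Import structures.
From mathcomp Require Import all_boot all_order all_algebra.
From mathcomp Require Import all_classical all_reals all_analysis.
From mathcomp Require Import complex.

Set Implicit Arguments.
Unset Strict Implicit.
Unset Printing Implicit Defensive.

Import Order.TTheory GRing.Theory Num.Theory.
Import numFieldNormedType.Exports.

Local Open Scope classical_set_scope.
Local Open Scope ring_scope.
Local Open Scope complex_scope.

Section row_measurable.
Context (R : realType) (d : nat).

Let coord (i : 'I_d) (x : 'rV[R]_d) : R := x 0 i.

Let row_set0 : g_sigma_preimage coord set0.
Proof. exact: sigma_algebra0. Qed.

Let row_setC A : g_sigma_preimage coord A -> g_sigma_preimage coord (~` A).
Proof. exact: sigma_algebraC. Qed.

Let row_bigcup (F : (set 'rV[R]_d)^nat) :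
  (forall i, g_sigma_preimage coord (F i)) ->
  g_sigma_preimage coord (\bigcup_i (F i)).
Proof. exact: sigma_algebra_bigcup. Qed.

(* The sigma-algebra generated by the coordinates, i.e. the Borel one *)
HB.instance Definition _ := @isMeasurable.Build default_measure_display
  'rV[R]_d (g_sigma_preimage coord) row_set0 row_setC row_bigcup.

End row_measurable.

Section lebesgue_measure_tuple.
Local Open Scope ereal_scope.
Context (R : realType).

Definition tcons n (p : measurableTypeR R * n.-tuple R) : n.+1.-tuple R :=
  [tuple of p.1 :: p.2].

Lemma measurable_tcons n : measurable_fun setT (@tcons n).
Proof. exact: measurable_cons. Qed.

Section step.
Context (n : nat) (m : {sigma_finite_measure set (n.-tuple R) -> \bar R}).

Definition leb_tuple_step : set (n.+1.-tuple R) -> \bar R :=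
  pushforward (lebesgue_measure \x m) (@tcons n).

Let step0 : leb_tuple_step set0 = 0.
Proof. by rewrite /leb_tuple_step /pushforward preimage_set0 measure0. Qed.

Let step_ge0 A : 0 <= leb_tuple_step A.
Proof. by rewrite /leb_tuple_step /pushforward measure_ge0. Qed.

Let step_sigma_additive : semi_sigma_additive leb_tuple_step.
Proof.
pose mu : {measure set _ -> \bar R} := lebesgue_measure \x m.
move=> F mF tF mUF; rewrite /leb_tuple_step /pushforward preimage_bigcup.
have mpre A : measurable A -> measurable (@tcons n @^-1` A).
  by move=> mA; rewrite -[X in measurable X]setTI; exact: measurable_tcons.
apply: (@measure_semi_sigma_additive _ _ _ mu).
- by move=> k; exact: mpre.
- apply/trivIsetP => /= i j _ _ ij; rewrite -preimage_setI.
  by move/trivIsetP : tF => /(_ _ _ _ _ ij) ->//; rewrite preimage_set0.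
- by rewrite -preimage_bigcup; exact: mpre.
Qed.

HB.instance Definition _ := isMeasure.Build _ _ _ leb_tuple_step
  step0 step_ge0 step_sigma_additive.

Let step_sigma_finite : sigma_finite setT leb_tuple_step.
Proof.
have /sigma_finiteP[A [AT ndA fA]] := sigma_finiteT (@lebesgue_measure R).
have /sigma_finiteP[B [BT ndB fB]] := sigma_finiteT m.
pose tl (t : n.+1.-tuple R) : n.-tuple R := [tuple of behead t].
pose G k := [set t : n.+1.-tuple R | A k (thead t) /\ B k (tl t)].
exists G.
  apply/esym/seteqP; split => // t _.
  have [i _ Ai] : (\bigcup_i A i) (thead t) by rewrite -AT.
  have [j _ Bj] : (\bigcup_i B i) (tl t) by rewrite -BT.
  exists (maxn i j) => //; split.
    by move/subsetPset : (ndA _ _ (leq_maxl i j)); apply.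
  by move/subsetPset : (ndB _ _ (leq_maxr i j)); apply.
move=> k; split.
  apply: measurableI.
    rewrite -[X in measurable X]setTI.
    by apply: measurable_tnth => //; exact: (fA k).1.
  rewrite -[X in measurable X]setTI.
  by apply: measurable_behead => //; exact: (fB k).1.
rewrite /leb_tuple_step /pushforward.
have -> : @tcons n @^-1` G k = A k `*` B k.
  apply/seteqP; split => -[x t] /=; rewrite /G /tcons /= theadE.
    rewrite (_ : tl _ = t)//; exact: val_inj.
  by rewrite (_ : tl _ = t)//; exact: val_inj.
rewrite product_measure1E; [|exact: (fA k).1|exact: (fB k).1].
apply: lte_mul_pinfty => //; last exact: (fB k).2.
by rewrite ge0_fin_numE//; exact: (fA k).2.
Qed.

HB.instance Definition _ :=
  Measure_isSigmaFinite.Build _ _ _ leb_tuple_step step_sigma_finite.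

End step.

Fixpoint leb_tuple (n : nat) : {sigma_finite_measure set (n.-tuple R) -> \bar R} :=
  match n return {sigma_finite_measure set (n.-tuple R) -> \bar R} with
  | 0%N => \d_ [tuple]
  | k.+1 => leb_tuple_step (leb_tuple k)
  end.

Lemma leb_tuple_box n (A : 'I_n -> set R) : (forall i, measurable (A i)) ->
  leb_tuple n [set t | forall i, A i (tnth t i)] =
  \prod_(i < n) lebesgue_measure (A i).
Proof.
elim: n A => [|n IH] A mA.
  rewrite big_ord0 /= diracE mem_set//; by case.
have mtl : measurable [set t : n.-tuple R | forall i, A (lift ord0 i) (tnth t i)].
  rewrite (_ : [set _ | _] = \bigcap_(i : 'I_n) ((@tnth n R)^~ i @^-1` A (lift ord0 i))).
    apply: fin_bigcap_measurable => // i _.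
    by rewrite -[X in measurable X]setTI; exact: measurable_tnth.
  by apply/seteqP; split => [t At i _|t At i]; exact: At.
rewrite big_ord_recl -IH; last by move=> i; exact: mA.
rewrite -[RHS]product_measure1E//=; last exact: mA.
rewrite /leb_tuple_step /pushforward.
congr ((lebesgue_measure \x leb_tuple n) _).
apply/seteqP; split => -[x t] /=.
  move=> At; split; first exact: (At ord0).
  by move=> i; have := At (lift ord0 i); rewrite /tcons tnthS.
move=> [Ax At] i; have [->//|] := eqVneq i ord0.
by case: (unliftP ord0 i) => [j ->|->]; rewrite ?eqxx// => _; rewrite /tcons tnthS; exact: At.
Qed.

End lebesgue_measure_tuple.

Section lebesgue_measure_row.
Local Open Scope ereal_scope.
Context (R : realType) (d : nat).

Definition row_of_tuple (t : d.-tuple R) : 'rV[R]_d := \row_i tnth t i.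

Lemma measurable_row_of_tuple : measurable_fun setT row_of_tuple.
Proof.
move=> _ A mA; rewrite setTI.
have : preimage_set_system setT row_of_tuple
    (g_sigma_preimage (fun (i : 'I_d) (x : 'rV[R]_d) => x 0%R i : R))
    (row_of_tuple @^-1` A).
  by exists A => //; rewrite setTI.
rewrite -g_sigma_preimage_comp (_ : (fun i => _ \o _) = fun i t => tnth t i)//.
by apply/funext => i; apply/funext => t /=; rewrite mxE.
Qed.

Definition leb_row : set 'rV[R]_d -> \bar R :=
  pushforward (leb_tuple R d) row_of_tuple.

Let leb_row0 : leb_row set0 = 0.
Proof. by rewrite /leb_row /pushforward preimage_set0 measure0. Qed.

Let leb_row_ge0 A : 0 <= leb_row A.
Proof. by rewrite /leb_row /pushforward measure_ge0. Qed.

Let leb_row_sigma_additive : semi_sigma_additive leb_row.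
Proof.
have mpre A : measurable A -> measurable (row_of_tuple @^-1` A).
  by move=> mA; rewrite -[X in measurable X]setTI; exact: measurable_row_of_tuple.
move=> F mF tF mUF; rewrite /leb_row /pushforward preimage_bigcup.
apply: (@measure_semi_sigma_additive _ _ _ (leb_tuple R d)).
- by move=> k; exact: mpre.
- apply/trivIsetP => /= i j _ _ ij; rewrite -preimage_setI.
  by move/trivIsetP : tF => /(_ _ _ _ _ ij) ->//; rewrite preimage_set0.
- by rewrite -preimage_bigcup; exact: mpre.
Qed.

HB.instance Definition _ := isMeasure.Build _ _ _ leb_row
  leb_row0 leb_row_ge0 leb_row_sigma_additive.

Lemma leb_row_box (A : 'I_d -> set R) : (forall i, measurable (A i)) ->
  leb_row [set x | forall i, A i (x 0%R i)] = \prod_(i < d) lebesgue_measure (A i).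
Proof.
move=> mA; rewrite -leb_tuple_box// /leb_row /pushforward; congr (leb_tuple R d _).
apply/seteqP; split => t /= + i => /(_ i); first by rewrite mxE.
by rewrite /row_of_tuple mxE.
Qed.

End lebesgue_measure_row.

Section measurability.
Context (R : realType) (d : nat).
Local Notation Rd := 'rV[R]_d.
Local Notation mu := (@leb_row R d).

(* Lebesgue measurability: [measurable_fun] refers to Borel sets *)
Definition lmeasurable (h : Rd -> R) : Prop :=
  exists2 g : Rd -> R, measurable_fun setT g & {ae mu, forall x, h x = g x}.

Definition cmeasurable (f : Rd -> R[i]) : Prop :=
  lmeasurable (fun x => complex.Re (f x)) /\
  lmeasurable (fun x => complex.Im (f x)).

Definition cabs (f : Rd -> R[i]) (x : Rd) : R := ComplexField.Normc.normc (f x).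

Definition cintegral (f : Rd -> R[i]) : R[i] :=
  (\int[mu]_x complex.Re (f x)) +i* (\int[mu]_x complex.Im (f x)).

Definition L1loc : set (Rd -> R[i]) :=
  [set f | cmeasurable f /\
    forall K, compact K -> (\int[mu]_(x in K) (cabs f x)%:E < +oo)%E].

Definition Lp_norm (p : \bar R) (f : Rd -> R[i]) : \bar R :=
  Lnorm mu p (fun x => (cabs f x)%:E).

Definition Lp_space (p : \bar R) : set (Rd -> R[i]) :=
  [set f | cmeasurable f /\ (Lp_norm p f < +oo)%E].

Definition cut (K : set Rd) (f : Rd -> R[i]) : Rd -> R[i] :=
  fun x => (\1_K x)%:C * f x.

Definition L0 : set (Rd -> R[i]) :=
  [set f | Lp_space +oo%E f /\ forall e : R, 0 < e ->
    exists2 K, compact K &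
      (Lp_norm +oo%E (fun x => (1 - (\1_K x)%:C) * f x)%R < e%:E)%E].

Definition translate (x : Rd) (f : Rd -> R[i]) : Rd -> R[i] :=
  fun t => f (t - x).

Definition convolution (f g : Rd -> R[i]) : Rd -> R[i] :=
  fun x => cintegral (fun y => f (x - y) * g y).

End measurability.

(* Elements of [tibf_car] are representatives: by [tibf_ae] the space and its
   norm only depend on classes modulo equality almost everywhere. The integral
   in [tibf_module] converges absolutely at almost every point: by
   [tibf_L1loc_cont] and [tibf_bounded], the integral of [cabs f] over the
   translates of a compact set is bounded. *)
Record tibf (R : realType) (d : nat) := Tibf {
  tibf_car :> set ('rV[R]_d -> R[i]) ;
  tibf_norm : ('rV[R]_d -> R[i]) -> R ;
  tibf_ae : forall f g, tibf_car f -> {ae @leb_row R d, forall x, g x = f x} ->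
    tibf_car g /\ tibf_norm g = tibf_norm f ;
  tibf_lin : forall a f g, tibf_car f -> tibf_car g ->
    tibf_car (fun x => a * f x + g x) ;
  tibf_normZ : forall a f, tibf_car f ->
    tibf_norm (fun x => a * f x) = ComplexField.Normc.normc a * tibf_norm f ;
  tibf_normD : forall f g, tibf_car f -> tibf_car g ->
    tibf_norm (fun x => f x + g x) <= tibf_norm f + tibf_norm g ;
  tibf_norm0 : forall f, tibf_car f -> tibf_norm f = 0 ->
    {ae @leb_row R d, forall x, f x = 0} ;
  tibf_complete : forall u : nat -> 'rV[R]_d -> R[i],
    (forall n, tibf_car (u n)) ->
    (forall e, 0 < e -> exists N, forall m n, (N <= m)%N -> (N <= n)%N ->
      tibf_norm (fun x => u m x - u n x) < e) ->
    exists2 f, tibf_car f &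
      (fun n => tibf_norm (fun x => u n x - f x)) @ \oo --> (0 : R) ;
  tibf_nontrivial : exists2 f, tibf_car f &
    ~ {ae @leb_row R d, forall x, f x = 0} ;
  tibf_L1loc : tibf_car `<=` @L1loc R d ;
  tibf_L1loc_cont : forall K, compact K -> exists C : R, forall f, tibf_car f ->
    (\int[@leb_row R d]_(x in K) (cabs f x)%:E <= (C * tibf_norm f)%:E)%E ;
  tibf_translate : forall x f, tibf_car f -> tibf_car (translate x f) ;
  tibf_bounded : exists2 C0 : R, 0 < C0 & forall x f, tibf_car f ->
    tibf_norm (translate x f) <= C0 * tibf_norm f ;
  tibf_module : forall f g, tibf_car f -> Lp_space 1%E g ->
    tibf_car (convolution f g) /\
    tibf_norm (convolution f g) <= tibf_norm f * fine (Lp_norm 1%E g)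
}.

Definition solid (R : realType) (d : nat) (E : tibf R d) : Prop :=
  forall f g, tibf_car E f -> L1loc g ->
    {ae @leb_row R d, forall x, cabs g x <= cabs f x} ->
    tibf_car E g /\ tibf_norm E g <= tibf_norm E f.

Section module_completion.
Context (R : realType) (d : nat) (E : tibf R d).

Definition mc_norm (f : 'rV[R]_d -> R[i]) : \bar R :=
  ereal_sup [set (tibf_norm E (cut K f))%:E | K in @compact 'rV[R]_d].

Definition mc : set ('rV[R]_d -> R[i]) :=
  [set f | [/\ L1loc f, forall K, compact K -> tibf_car E (cut K f) &
    (mc_norm f < +oo)%E]].

End module_completion.

Section weights.
Context (R : realType) (d : nat).
Local Notation Rd := 'rV[R]_d.

Definition weight_function (v : Rd -> R) : Prop :=
  [/\ lmeasurable v, forall x : Rd, exists M, \forall y \near x, v y <= M &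
    forall x, 1 <= v x].

Definition weight_system (w : nat -> Rd -> R) : Prop :=
  (forall n, weight_function (w n)) /\ forall n x, w n x <= w n.+1 x.

(* The norm of ['rV_d] in the library is the maximum norm. *)
Definition enorm (y : Rd) : R := Num.sqrt (\sum_i y 0 i ^+ 2).

Definition weight_wM (w : nat -> Rd -> R) : Prop :=
  forall n, exists m, exists C, [/\ (n <= m)%N, 0 < C &
    forall x y, enorm y <= 1 -> w n (x + y) <= C * w m x].

Definition weight_S (w : nat -> Rd -> R) : Prop :=
  forall n, exists2 m, (n <= m)%N &
    Lp_space +oo%E (fun x => (w n x ^+ 2 / w m x)%:C).

End weights.

Section distributions.
Context (R : realType) (d : nat).
Local Notation Rd := 'rV[R]_d.

Definition multiindex := {ffun 'I_d -> nat}.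

Definition mi_order (a : multiindex) : nat := (\sum_i a i)%N.

Definition partial (i : 'I_d) (f : Rd -> R) : Rd -> R :=
  fun x => 'D_(delta_mx 0 i) f x.

Definition partials (s : seq 'I_d) (f : Rd -> R) : Rd -> R :=
  foldr partial f s.

Definition mi_partials (a : multiindex) : (Rd -> R) -> Rd -> R :=
  partials (flatten [seq nseq (a i) i | i <- enum 'I_d]).

Definition mi_derive (a : multiindex) (f : Rd -> R[i]) : Rd -> R[i] :=
  fun x => mi_partials a (fun t => complex.Re (f t)) x +i*
           mi_partials a (fun t => complex.Im (f t)) x.

Definition smooth_real (f : Rd -> R) : Prop :=
  forall s x, differentiable (partials s f) x.

Definition smooth : set (Rd -> R[i]) :=
  [set f | smooth_real (fun x => complex.Re (f x)) /\
           smooth_real (fun x => complex.Im (f x))].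

Definition test_on (K : set Rd) : set (Rd -> R[i]) :=
  [set phi | smooth phi /\ forall x, ~ K x -> phi x = 0].

Definition test_function : set (Rd -> R[i]) :=
  [set phi | exists2 K, compact K & test_on K phi].

(* A distribution is represented by a functional of which only the values on
   test functions matter; [deq] is equality of distributions. *)
Definition functional := (Rd -> R[i]) -> R[i].

Definition deq (u v : functional) : Prop :=
  forall phi, test_function phi -> u phi = v phi.

Definition distribution : set functional :=
  [set u | (forall a phi psi, test_function phi -> test_function psi ->
      u (fun x => a * phi x + psi x) = a * u phi + u psi) /\
    forall K, compact K -> exists N, exists C : R,
      forall phi, test_on K phi -> forall B,
      (forall a x, (mi_order a <= N)%N -> cabs (mi_derive a phi) x <= B) ->
      ComplexField.Normc.normc (u phi) <= C * B].

Definition regular (f : Rd -> R[i]) : functional :=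
  fun phi => cintegral (fun x => f x * phi x).

Definition dderive (a : multiindex) (u : functional) : functional :=
  fun phi => (-1) ^+ mi_order a * u (mi_derive a phi).

Definition dmul (u : functional) (f : Rd -> R[i]) : functional :=
  fun phi => u (fun x => f x * phi x).

Definition weighted (E : set (Rd -> R[i])) (w : nat -> Rd -> R) :
    set functional :=
  [set u | distribution u /\ forall n a, (mi_order a <= n)%N ->
    exists g, [/\ L1loc g, deq (dderive a u) (regular g) &
      E (fun x => g x * (w n x)%:C)]].

(* The product of a distribution and an element of [X] is taken through the
   smooth function representing the latter. Every element of [dotB w] has
   one: all its distributional derivatives are locally integrable. *)
Definition multipliers (X Y : set functional) : set functional :=
  [set u | distribution u /\
    forall phi, smooth phi -> X (regular phi) -> Y (dmul u phi)].

Definition dotB (w : nat -> Rd -> R) : set functional := weighted (@L0 R d) w.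

Definition weight_M (E : tibf R d) (w : nat -> Rd -> R) : Prop :=
  multipliers (dotB w) (weighted E w) =
  [set u | exists f, [/\ smooth f, deq u (regular f) &
    forall a, exists n,
      mc E (fun x => mi_derive a f x / (w n x)%:C)]].

End distributions.

(* Main.v *)
(* A distribution u all of whose derivatives are represented by locally
   integrable functions is a smooth function: convolve with the mollifiers
   [moll j], chosen so that moll (j+1) - moll j is 2^-(j(d+1)) times a sum of
   derivatives of order d + 1 of bumps of height O(2^(jd)). Moving these
   derivatives onto u, the mollifications converge geometrically, together with
   all their derivatives. Applied to u times cutoff functions, this represents
   a multiplier by a smooth function f.

   By the Leibniz formula and induction on the order of derivation,
   F = f^(alpha) satisfies F phi \in E for every phi in the weighted space
   [dotB w]. If no F / w_n were in E_mc, there would be disjoint shells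
   r_n < |y| <= r_(n+1) on which F / w_(m_n) has norm larger than n 2^n times the
   constant that smoothing loses by (wM); smoothing the profile equal to
   2^-n / w_n on the n-th shell yields an admissible phi for which F phi has
   norm >= n for all n.

   Conversely, when f^(alpha) / w_k \in E_mc, the products f^(alpha) phi^(beta) w_n
   are in E since w_n w_k <= C w_m by (S), and since E_mc times L^0 is in E by
   completeness of E.

   If (M) holds, apply the gliding hump to F = f w_p, where f is a smoothing of
   w_q and hence a multiplier: F / w_m \in E_mc. As w_n(x)^2 / w_m'(x) is
   dominated by F / w_m on a cube around x, and the indicators of the
   translates of this cube have norms bounded below, w_n^2 / w_m' is bounded. *)

Require Import Defs.
From HB Require Import structures.
From mathcomp Require Import all_boot all_order all_algebra.
From mathcomp Require Import all_classical all_reals all_analysis.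
From mathcomp Require Import measurable_realfun ess_sup_inf complex ring lra.

Set Implicit Arguments.
Unset Strict Implicit.
Unset Printing Implicit Defensive.

Import Order.TTheory GRing.Theory Num.Theory.
Import numFieldNormedType.Exports.

Local Open Scope classical_set_scope.
Local Open Scope ring_scope.

(** * Lebesgue measure on row vectors *)

(** The functions of the statement are measurable only up to a null set, while integration theory is
    about Borel functions; [integral_ae] passes between the two, and [lmeasurable], [lintegrable],
    [rL1loc] keep this passage out of the analysis. The gliding hump plays the role of a uniform
    boundedness principle: one explicit phi refutes all indices n at once, so that no topology on
    the multiplier space enters. Both implications use it, hence it is stated for a locally
    integrable F: in the first one F is smooth, in the converse F = f w_p need not be. The shells
    keep a margin of 1 at both ends because smoothing moves values by at most 1, and the profile
    2^-n / w_n serves every derivative at once since derivatives fall on the smoothing kernel. In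
    the converse, the square in (S) arises because f dominates a weight, while membership in the
    weighted space supplies a second one. Only the position of a fixed small cube varies with x,
    whence a bound uniform in x. *)

Section row_borel.
Context (R : realType) (d : nat).
Local Notation Rd := 'rV[R]_d.
Local Notation mu := (@leb_row R d).

Lemma measurable_coord (i : 'I_d) : measurable_fun setT (fun x : Rd => x 0 i : R).
Proof.
move=> _ A mA; rewrite setTI; apply: sub_sigma_algebra.
rewrite (bigD1 i)//=; left; exists A => //; by rewrite setTI.
Qed.

Lemma measurable_row (disp : measure_display) (T : measurableType disp)
    (D : set T) (f : T -> Rd) :
  (forall i, measurable_fun D (fun t => f t 0 i)) -> measurable_fun D f.
Proof.
move=> mf mD; move: (mD); apply: (@measurability _ _ T Rd D f _ erefl).
move=> _ [A + <-]; move: A; elim/big_rec : _ => [A []|i X _ IH A [|]].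
  move=> [B mB <-]; rewrite setTI.
  by apply: (mf i).
exact: IH.
Qed.

Definition obox (a b : 'I_d -> R) : set Rd :=
  [set x | forall i, a i < x 0 i < b i].

Lemma measurable_box (A : 'I_d -> set R) : (forall i, measurable (A i)) ->
  measurable [set x : Rd | forall i, A i (x 0 i)].
Proof.
move=> mA.
rewrite (_ : [set _ | _] = \bigcap_(i : 'I_d) ((fun x : Rd => x 0 i) @^-1` A i)).
  apply: fin_bigcap_measurable => // i _.
  by rewrite -[X in measurable X]setTI; apply: (measurable_coord i).
by apply/seteqP; split => [t At i _|t At i]; exact: At.
Qed.

Lemma oboxE a b : obox a b = [set x : Rd | forall i, `]a i, b i[%classic (x 0 i)].
Proof. by apply/seteqP; split => x /= + i => /(_ i); rewrite in_itv/=. Qed.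

Lemma measurable_obox a b : measurable (obox a b).
Proof. by rewrite oboxE; apply: (@measurable_box (fun i => `]a i, b i[%classic)). Qed.

(** Open boxes are chosen as generators because they are stable under intersection and of finite
    measure, as [row_measure_unique] requires. A half-space x_i > a is the union over k of the boxes
    with sides ]a, k[ in direction i and ]-k, k[ in the others. *)
Lemma row_measurableE :
  @measurable _ Rd = <<s [set A | exists a b, A = obox a b] >>.
Proof.
apply/seteqP; split; last first.
  apply: smallest_sub; first exact: sigma_algebra_measurable.
  by move=> _ [a [b ->]]; exact: measurable_obox.
set G := [set A | _].
apply: smallest_sub; first exact: smallest_sigma_algebra.
elim/big_rec : _ => [A []|i X _ IH A [|]]; last exact: IH.
suff : measurable_fun setT
    (fun x : g_sigma_algebraType G => (x : Rd) 0 i : measurableTypeR R).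
  by move=> + [B mB <-] => /(_ measurableT B mB).
apply: (measurability _ (measurable_realfun.RGenOInfty.measurableE R)).
move=> _ [_ [a ->] <-].
rewrite (_ : _ `&` _ = \bigcup_k obox
    (fun j => if j == i then a else - k%:R) (fun j => k%:R)).
  apply: bigcupT_measurable => k; apply: sub_sigma_algebra.
  by eexists; eexists; reflexivity.
rewrite setTI; apply/seteqP; split => [x /=|x [k _ /(_ i)]]; last first.
  by rewrite eqxx /= in_itv/= andbT => /andP[].
rewrite in_itv/= andbT => ax.
exists (Num.truncn (\sum_j `|x 0 j|)).+1 => // j.
have xj : `|x 0 j| < (Num.truncn (\sum_j `|x 0 j|)).+1%:R.
  apply: le_lt_trans (truncnS_gt _); rewrite (bigD1 j)//= lerDl.
  by apply: sumr_ge0.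
move: xj; rewrite ltr_norml => /andP[x1 x2]; rewrite x2 andbT.
by case: ifPn => // /eqP ->.
Qed.

Lemma leb_row_obox a b : (forall i, a i <= b i) ->
  mu (obox a b) = (\prod_i (b i - a i))%:E.
Proof.
move=> ab; rewrite oboxE (@leb_row_box _ _ (fun i => `]a i, b i[%classic)) //.
rewrite -prodEFin; apply: eq_bigr => i _; rewrite lebesgue_measure_itv/= lte_fin.
case: ltP => // ba; by rewrite (_ : b i = a i) ?subrr//; apply/eqP; rewrite eq_le ba ab.
Qed.

Lemma leb_row_obox_lty a b : (mu (obox a b) < +oo)%E.
Proof.
have [ab|/existsNP[i /negP]] := pselect (forall i, a i <= b i).
  by rewrite leb_row_obox// ltry.
rewrite -ltNge => ba; rewrite (_ : obox a b = set0) ?measure0//.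
apply/seteqP; split => // x /(_ i) /andP[ax xb].
by have := lt_trans ax xb; rewrite ltNge (ltW ba).
Qed.

Lemma obox_setI a b a' b' : obox a b `&` obox a' b' =
  obox (fun i => Num.max (a i) (a' i)) (fun i => Num.min (b i) (b' i)).
Proof.
apply/seteqP; split => x /=.
  move=> [h1 h2] i; rewrite gt_max lt_min.
  by have /andP[-> ->] := h1 i; have /andP[-> ->] := h2 i.
by move=> h; split => i; have := h i; rewrite gt_max lt_min => /andP[/andP[h1 h2] /andP[h3 h4]]; apply/andP.
Qed.

Lemma row_measure_unique (m1 m2 : {measure set Rd -> \bar R}) :
  (forall a b, m1 (obox a b) = m2 (obox a b)) ->
  (forall a b, m1 (obox a b) < +oo)%E ->
  forall A, measurable A -> m1 A = m2 A.
Proof.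
move=> m12 m1oo; apply: (measure_unique [set A | exists a b, A = obox a b]
  (fun k => obox (fun=> - k%:R) (fun=> k%:R))) => //.
- exact: row_measurableE.
- move=> _ _ [a [b ->]] [a' [b' ->]].
  by rewrite obox_setI; eexists; eexists; reflexivity.
- by move=> k; eexists; eexists; reflexivity.
- apply/seteqP; split => // x _.
  exists (Num.truncn (\sum_j `|x 0 j|)).+1 => // j.
  rewrite -ltr_norml.
  apply: le_lt_trans (truncnS_gt _); rewrite (bigD1 j)//= lerDl.
  by apply: sumr_ge0.
- by move=> _ [a [b ->]].
Qed.

End row_borel.

(** * Topology of row vectors and translation invariance of the measure *)

Section row_measure.
Context (R : realType) (d : nat).
Local Notation Rd := 'rV[R]_d.
Local Notation mu := (@leb_row R d).

Lemma row_normP (x : Rd) (e : R) : 0 <= e ->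
  `|x| <= e <-> forall i, `|x 0 i| <= e.
Proof.
move=> e0; rewrite [`|x|]mx_normrE; split => [h i|h].
  exact: le_trans (le_bigmax _ _ (0, i)) h.
by apply/bigmax_leP; split => // -[j i] _ /=; rewrite ord1.
Qed.

Lemma row_norm_ltP (x : Rd) (e : R) : 0 < e ->
  `|x| < e <-> forall i, `|x 0 i| < e.
Proof.
move=> e0; rewrite [`|x|]mx_normrE; split => [h i|h].
  exact: le_lt_trans (le_bigmax _ _ (0, i)) h.
by apply/bigmax_ltP; split => // -[j i] _ /=; rewrite ord1.
Qed.

Lemma coord_le_norm (x : Rd) i : `|x 0 i| <= `|x|.
Proof. by have /row_normP := lexx `|x|; apply. Qed.

Lemma row_ballE (x : Rd) (e : R) : 0 < e ->
  ball x e = obox (fun i => x 0 i - e) (fun i => x 0 i + e).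
Proof.
move=> e0; rewrite -ball_normE; apply/seteqP; split => y /=.
  by move/(row_norm_ltP _ e0) => + i => /(_ i); rewrite !mxE ltr_norml; lra.
by move=> h; apply/(row_norm_ltP _ e0) => i; have := h i; rewrite !mxE ltr_norml; lra.
Qed.

(** An open set is the union of the countably many boxes with rational centre and half-side 1 / (n +
    1) that it contains. *)
Lemma open_measurable_row (U : set Rd) : open U -> measurable U.
Proof.
move=> oU.
pose B (q : {ffun 'I_d -> rat} * nat) : set Rd :=
  obox (fun i => ratr (q.1 i) - q.2.+1%:R^-1) (fun i => ratr (q.1 i) + q.2.+1%:R^-1).
rewrite (_ : U = \bigcup_(q in [set q | B q `<=` U]) B q); last first.
  apply/seteqP; split => [x Ux|x [q qU Bqx]]; last exact: qU.
  have /nbhs_ballP[e /= e0 xeU] : nbhs x U by exact: open_nbhs_nbhs.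
  have [n n0 ne] : exists2 n, (0 < n)%N & n.+1%:R^-1 < e / 2.
    pose n := (Num.truncn (e / 2)^-1).+1.
    exists n => //; rewrite invf_plt ?posrE//; last lra.
    by rewrite (lt_trans (truncnS_gt _))// ltr_nat.
  have n0' : 0 < n.+1%:R^-1 :> R by rewrite invr_gt0.
  pose r := n.+1%:R^-1 : R.
  have /choice[q qP] : forall i, exists q : rat, `|x 0 i - ratr q| < r.
    rewrite -/r in n0' => i.
    have [|q] := @rat_in_itvoo R (x 0 i - r) (x 0 i + r).
      lra.
    by rewrite in_itv/= => h; exists q; rewrite ltr_norml; lra.
  exists ([ffun i => q i], n) => /=; last first.
    by move=> i /=; rewrite ffunE -/r; have := qP i; rewrite ltr_norml; lra.
  move=> y By; apply: xeU; rewrite row_ballE// => i.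
  have := By i; have := qP i; rewrite -/r in ne *; rewrite /= ffunE -/r ltr_norml; lra.
rewrite bigcup_mkcond; apply: countable_bigcupT_measurable => // q.
by case: ifP => // _; exact: measurable_obox.
Qed.

Lemma closed_measurable_row (K : set Rd) : closed K -> measurable K.
Proof.
by rewrite -openC => /open_measurable_row /measurableC; rewrite setCK.
Qed.

Lemma compact_measurable_row (K : set Rd) : compact K -> measurable K.
Proof. by move=> /compact_closed-/(_ (@norm_hausdorff _ _))/closed_measurable_row. Qed.

Lemma continuous_measurable_row (f : Rd -> R) : continuous f ->
  measurable_fun setT f.
Proof.
move=> /continuousP cf; apply: (measurability _ (measurable_realfun.RGenOpens.measurableE R)).
move=> _ [_ [a [b ->]] <-]; rewrite setTI; apply: open_measurable_row.
exact/cf/interval_open.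
Qed.

Lemma obox_cover : \bigcup_k (obox (fun=> - k%:R) (fun=> k%:R) : set Rd) = setT.
Proof.
apply/seteqP; split => // x _.
exists (Num.truncn `|x|).+1 => // j; rewrite -ltr_norml.
exact: le_lt_trans (coord_le_norm x j) (truncnS_gt _).
Qed.

Let leb_row_sigma_finite : sigma_finite setT mu.
Proof.
exists (fun k => obox (fun=> - k%:R) (fun=> k%:R)); first by rewrite obox_cover.
by move=> k; split; [exact: measurable_obox|exact: leb_row_obox_lty].
Qed.

HB.instance Definition _ :=
  Measure_isSigmaFinite.Build _ _ _ mu leb_row_sigma_finite.

Definition cube (r : R) : set Rd := [set x | `|x| <= r].

Lemma cube_compact r : compact (cube r).
Proof.
apply: bounded_closed_compact.
  exists r; split; first exact: num_real.
  by move=> M rM x /= xr; apply: le_trans xr (ltW rM).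
rewrite (_ : cube r = (fun x => `|x|) @^-1` [set y | y <= r])//.
apply: closed_comp => [x _|]; [exact: norm_continuous|exact: closed_le].
Qed.

Lemma cube_lty r : (mu (cube r) < +oo)%E.
Proof.
apply: le_lt_trans (leb_row_obox_lty (fun=> - (`|r| + 1)) (fun=> `|r| + 1)).
apply: le_measure.
- apply/mem_set; apply: compact_measurable_row; exact: cube_compact.
- apply/mem_set; exact: measurable_obox.
- move=> x /= xr i; rewrite -ltr_norml (le_lt_trans (coord_le_norm x i))//.
  by rewrite (le_lt_trans xr)// (le_lt_trans (ler_norm r))// ltrDl.
Qed.

Lemma compact_sub_cube (K : set Rd) : compact K -> exists2 r, 0 < r & K `<=` cube r.
Proof.
move=> /compact_bounded[M [_ MK]]; exists (`|M| + 1) => //.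
by move=> x Kx; apply: MK => //; rewrite (le_lt_trans (ler_norm _))// ltrDl.
Qed.

Lemma measurable_translate (a : Rd) : measurable_fun setT (fun x : Rd => x + a).
Proof.
apply: measurable_row => i; apply: continuous_measurable_row => x.
rewrite (_ : (fun t : Rd => (t + a) 0 i) = fun t : Rd => t 0 i + a 0 i); last first.
  by apply/funext => t; rewrite mxE.
apply: (@continuousD _ _ _ (fun t : Rd => t 0 i) (fun=> a 0 i)). 2: exact: cst_continuous.
exact: (@coord_continuous R 1 d 0 i).
Qed.

(** The two measures agree on open boxes, which are moved to boxes with the same side lengths;
    [row_measure_unique] does the rest. *)
Lemma leb_row_translate (a : Rd) A : measurable A ->
  pushforward mu (fun x : Rd => x + a) A = mu A.
Proof.
move=> mA; apply/esym.
pose f : {mfun Rd >-> Rd} := HB.pack (fun x : Rd => x + a)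
  (isMeasurableFun.Build _ _ _ _ _ (measurable_translate a)).
apply: (@row_measure_unique _ _ mu (pushforward mu f)) => //; last first.
  exact: leb_row_obox_lty.
move=> u v; rewrite /pushforward/=.
transitivity (mu (obox (fun i => u i - a 0 i) (fun i => v i - a 0 i))); last first.
  congr (mu _); apply/seteqP; split => x /= h i; have := h i; rewrite /= mxE; lra.
have [uv|/existsNP[i /negP]] := pselect (forall i, u i <= v i).
  rewrite !leb_row_obox//; last by move=> i; have := uv i; lra.
  by congr EFin; apply: eq_bigr => i _; lra.
rewrite -ltNge => vu; rewrite (_ : obox u v = set0) ?[X in _ = mu X](_ : _ = set0)//.
  by apply/seteqP; split => // x /(_ i); lra.
by apply/seteqP; split => // x /(_ i); lra.
Qed.

End row_measure.

(** * Integrals of functions that agree almost everywhere *)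

Section integral_ae.
Local Open Scope ereal_scope.
Context (disp : measure_display) (T : measurableType disp) (R : realType)
  (m : {measure set T -> \bar R}).
Import HBNNSimple.

(** Neither function is assumed measurable: the integral is a supremum over simple functions below
    f, and such a function, set to 0 on the exceptional null set, lies below g and keeps its
    integral. This is what lets a Lebesgue measurable function be integrated through a Borel
    representative. *)
Let ge0_integral_ae_le (f g : T -> \bar R) :
  (forall x, 0 <= f x) -> (forall x, 0 <= g x) ->
  {ae m, forall x, f x = g x} -> \int[m]_x f x <= \int[m]_x g x.
Proof.
move=> f0 g0 [N [mN N0 fgN]].
rewrite !ge0_integralTE//; apply: ge_ereal_sup => _ [h hf <-].
have hN : ae_eq m setT (EFin \o h) (EFin \o proj_nnsfun h (measurableC mN)).
  exists N; split => // x /= /not_implyP[_].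
  rewrite mindicE; apply: contra_notP => Nx.
  by rewrite mem_set ?mulr1.
rewrite -integralT_nnsfun (ae_eq_integral _ _ _ _ _ hN)// ?integralT_nnsfun//.
apply: ereal_sup_ubound; exists (proj_nnsfun h (measurableC mN)) => // x /=.
rewrite mindicE; case: (asboolP (N x)) => Nx.
  by rewrite memNset ?mulr0//; apply.
rewrite mem_set// mulr1 (le_trans (hf x))// (_ : f x = g x)//.
by apply: contrapT => fg; exact/Nx/fgN.
all: apply/measurable_EFinP => //.
Qed.

Lemma integral_ae (f g : T -> \bar R) :
  {ae m, forall x, f x = g x} -> \int[m]_x f x = \int[m]_x g x.
Proof.
move=> fg; rewrite integralE [RHS]integralE.
have pos (u v : T -> \bar R) : {ae m, forall x, u x = v x} ->
    \int[m]_x u^\+ x = \int[m]_x v^\+ x.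
  move=> uv; apply/eqP; rewrite eq_le; apply/andP; split;
    apply: ge0_integral_ae_le => //; apply: filterS uv => x;
    by rewrite !funeposE => ->.
congr (_ - _); first exact: pos.
rewrite -!funeposN; apply: pos; apply: filterS fg => x.
by rewrite /= => ->.
Qed.

End integral_ae.

(** * Integration of Lebesgue measurable functions *)

Section lint.
Context (R : realType) (d : nat).
Local Notation Rd := 'rV[R]_d.
Local Notation mu := (@leb_row R d).
Implicit Types f g h : Rd -> R.

Lemma lmeasurable_ae f g : lmeasurable g -> {ae mu, forall x, f x = g x} ->
  lmeasurable f.
Proof.
move=> [g' mg' gg'] fg; exists g' => //.
by apply: filterS2 fg gg' => x -> ->.
Qed.

Lemma measurable_lmeasurable f : measurable_fun setT f -> lmeasurable f.
Proof. by move=> mf; exists f => //; exact: aeW. Qed.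

Lemma lmeasurable_cst (c : R) : lmeasurable (fun _ : Rd => c).
Proof. apply: measurable_lmeasurable; exact: measurable_cst. Qed.

Lemma continuous_lmeasurable f : continuous f -> lmeasurable f.
Proof. by move=> cf; apply: measurable_lmeasurable; exact: continuous_measurable_row. Qed.

Lemma lmeasurable_indic (A : set Rd) : measurable A -> lmeasurable (\1_A : Rd -> R).
Proof. by move=> mA; apply: measurable_lmeasurable; exact: measurable_indic. Qed.

Lemma lmeasurableD f g : lmeasurable f -> lmeasurable g ->
  lmeasurable (fun x => f x + g x).
Proof.
move=> [f' mf ff'] [g' mg gg']; exists (fun x => f' x + g' x).
  exact: measurable_funD.
by apply: filterS2 ff' gg' => x -> ->.
Qed.

Lemma lmeasurableM f g : lmeasurable f -> lmeasurable g ->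
  lmeasurable (fun x => f x * g x).
Proof.
move=> [f' mf ff'] [g' mg gg']; exists (fun x => f' x * g' x).
  exact: measurable_funM.
by apply: filterS2 ff' gg' => x -> ->.
Qed.

Lemma lmeasurable_comp (phi : R -> R) f : measurable_fun setT phi ->
  lmeasurable f -> lmeasurable (fun x => phi (f x)).
Proof.
move=> mphi [f' mf ff']; exists (fun x => phi (f' x)).
  exact: measurableT_comp.
by apply: filterS ff' => x ->.
Qed.

Lemma lmeasurableN f : lmeasurable f -> lmeasurable (fun x => - f x).
Proof.
move=> mf; rewrite (_ : (fun x => _) = fun x => -1 * f x); last first.
  by apply/funext => x; rewrite mulN1r.
by apply: lmeasurableM => //; exact: lmeasurable_cst.
Qed.

Lemma lmeasurableB f g : lmeasurable f -> lmeasurable g ->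
  lmeasurable (fun x => f x - g x).
Proof. by move=> mf mg; apply: lmeasurableD => //; exact: lmeasurableN. Qed.

Lemma lmeasurable_norm f : lmeasurable f -> lmeasurable (fun x => `|f x|).
Proof. by apply: lmeasurable_comp; exact: normr_measurable. Qed.

Lemma lmeasurableV f : (forall x, 0 <= f x) -> lmeasurable f ->
  lmeasurable (fun x => (f x)^-1).
Proof.
move=> f0 mf; rewrite (_ : (fun x => _) = fun x => f x `^ (-1)); last first.
  by apply/funext => x; rewrite powR_inv1.
by apply: (lmeasurable_comp (phi := fun t => t `^ (-1))) => //; exact: measurable_powR.
Qed.

Lemma lmeasurable_sum (I : Type) (s : seq I) (F : I -> Rd -> R) :
  (forall i, lmeasurable (F i)) -> lmeasurable (fun x => \sum_(i <- s) F i x).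
Proof.
move=> mF; elim: s => [|i s IH].
  by under eq_fun do rewrite big_nil; exact: lmeasurable_cst.
by under eq_fun do rewrite big_cons; apply: lmeasurableD.
Qed.

(** Whereas [mu.-integrable] demands a Borel function, this notion only asks for a Borel
    representative, to which the proofs below pass. *)
Definition lintegrable f :=
  lmeasurable f /\ (\int[mu]_x `|f x|%:E < +oo)%E.

Lemma ae_lintegrable f g : lintegrable g -> {ae mu, forall x, f x = g x} ->
  lintegrable f.
Proof.
move=> [mg ig] fg; split; first exact: lmeasurable_ae fg.
by rewrite (@integral_ae _ _ _ _ _ (fun x => `|g x|%:E))//; apply: filterS fg => x ->.
Qed.

Lemma lintegrableP f : lintegrable f ->
  exists g, [/\ measurable_fun setT g, mu.-integrable setT (EFin \o g) &
    {ae mu, forall x, f x = g x}].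
Proof.
move=> [[g mg fg] fi]; exists g; split => //.
apply/integrableP; split; first exact/measurable_EFinP.
rewrite -(@integral_ae _ _ _ _ (fun x => `|f x|%:E))//; by apply: filterS fg => x ->.
Qed.

Lemma integrable_lintegrable f : mu.-integrable setT (EFin \o f) -> lintegrable f.
Proof.
by move=> /integrableP[mf fi]; split => //; apply: measurable_lmeasurable; exact/measurable_EFinP.
Qed.

Lemma ae_Rintegral f g : {ae mu, forall x, f x = g x} ->
  \int[mu]_x f x = \int[mu]_x g x.
Proof.
by move=> fg; congr fine; apply: integral_ae; apply: filterS fg => x ->.
Qed.

Lemma lintegrableD f g : lintegrable f -> lintegrable g ->
  lintegrable (fun x => f x + g x) /\
  \int[mu]_x (f x + g x) = \int[mu]_x f x + \int[mu]_x g x.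
Proof.
move=> /lintegrableP[f' [mf If ff']] /lintegrableP[g' [mg Ig gg']].
have fg : {ae mu, forall x, f x + g x = f' x + g' x}.
  by apply: filterS2 ff' gg' => x -> ->.
split.
  apply: ae_lintegrable fg; apply: integrable_lintegrable.
  by rewrite (_ : _ \o _ = (EFin \o f') \+ (EFin \o g'))%E//; exact: integrableD.
by rewrite (ae_Rintegral fg) (ae_Rintegral ff') (ae_Rintegral gg') RintegralD.
Qed.

Lemma lintegrableZ (c : R) f : lintegrable f ->
  lintegrable (fun x => c * f x) /\
  \int[mu]_x (c * f x) = c * \int[mu]_x f x.
Proof.
move=> /lintegrableP[f' [mf If ff']].
have fg : {ae mu, forall x, c * f x = c * f' x}.
  by apply: filterS ff' => x ->.
split.
  apply: ae_lintegrable fg; apply: integrable_lintegrable.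
  by rewrite (_ : _ \o _ = fun x => c%:E * (EFin \o f') x)%E//; exact: integrableZl.
by rewrite (ae_Rintegral fg) (ae_Rintegral ff') RintegralZl.
Qed.

Lemma lintegrableB f g : lintegrable f -> lintegrable g ->
  lintegrable (fun x => f x - g x) /\
  \int[mu]_x (f x - g x) = \int[mu]_x f x - \int[mu]_x g x.
Proof.
move=> If Ig; have [INg ENg] := lintegrableZ (-1) Ig.
have [h1 h2] := lintegrableD If INg.
have -> : (fun x => f x - g x) = (fun x => f x + -1 * g x).
  by apply/funext => x; rewrite mulN1r.
by rewrite h2 ENg mulN1r.
Qed.

Lemma lintegrable_sum (I : Type) (s : seq I) (F : I -> Rd -> R) :
  (forall i, lintegrable (F i)) -> lintegrable (fun x => \sum_(i <- s) F i x) /\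
  \int[mu]_x (\sum_(i <- s) F i x) = \sum_(i <- s) \int[mu]_x F i x.
Proof.
move=> IF; elim: s => [|i s [IH1 IH2]].
  have -> : (fun x => \sum_(i <- [::]) F i x) = fun=> 0.
    by apply/funext => x; rewrite big_nil.
  rewrite big_nil Rintegral_cst// mul0r; split => //.
  split; first exact: lmeasurable_cst.
  under eq_integral do rewrite normr0.
  by rewrite integral0.
have -> : (fun x => \sum_(j <- i :: s) F j x) = fun x => F i x + \sum_(j <- s) F j x.
  by apply/funext => x; rewrite big_cons.
by rewrite big_cons -IH2; exact: lintegrableD.
Qed.

Lemma lintegrable_le f g : lmeasurable f -> lintegrable g ->
  (forall x, `|f x| <= g x) -> lintegrable f.
Proof.
move=> mf Ig fg; split => //; have [f' mf' ff'] := mf.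
have /lintegrableP[g' [mg' /integrableP[_ Ig'] gg']] := Ig.
rewrite (@integral_ae _ _ _ _ _ (fun x => `|f' x|%:E)); last first.
  by apply: filterS ff' => x ->.
apply: le_lt_trans Ig'; apply: ae_ge0_le_integral => //.
- by apply/measurable_EFinP; exact: measurableT_comp.
- by apply: measurableT_comp => //; exact/measurable_EFinP.
- apply: filterS2 ff' gg' => x ffx ggx _; rewrite lee_fin /= -ffx -ggx.
  by rewrite (le_trans (fg x))// ler_norm.
Qed.

Lemma lintegrable_norm f : lintegrable f -> lintegrable (fun x => `|f x|).
Proof.
move=> [mf If]; split; first exact: lmeasurable_norm.
by under eq_integral do rewrite normr_id.
Qed.

Lemma le_lint f g : lintegrable f -> lintegrable g -> (forall x, f x <= g x) ->
  \int[mu]_x f x <= \int[mu]_x g x.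
Proof.
move=> If Ig fg; rewrite -subr_ge0 -(lintegrableB Ig If).2.
by apply: Rintegral_ge0 => x _; rewrite subr_ge0.
Qed.

Lemma norm_lint f : lintegrable f -> `|\int[mu]_x f x| <= \int[mu]_x `|f x|.
Proof.
move=> If; have INf := lintegrable_norm If.
rewrite ler_norml lerNl -mulN1r -(lintegrableZ (-1) If).2.
apply/andP; split; apply: le_lint => //.
- exact: (lintegrableZ (-1) If).1.
- by move=> x; rewrite mulN1r -normrN ler_norm.
- by move=> x; rewrite ler_norm.
Qed.

Lemma lintegrable_cube (r : R) : lintegrable (\1_(cube r) : Rd -> R).
Proof.
have mc := compact_measurable_row (@cube_compact R d r).
split; first exact: lmeasurable_indic.
under eq_integral do rewrite ger0_norm//.
by rewrite integral_indic// setIT cube_lty.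
Qed.

Lemma lintegrable_bounded f (M r : R) : lmeasurable f ->
  (forall x, `|f x| <= M * \1_(cube r) x) ->
  lintegrable f /\ `|\int[mu]_x f x| <= M * fine (mu (cube r)).
Proof.
move=> mf fM; have IM := lintegrableZ M (lintegrable_cube r).
have If : lintegrable f by exact: lintegrable_le IM.1 _.
split => //; rewrite (le_trans (norm_lint If))//.
rewrite (le_trans (le_lint (lintegrable_norm If) IM.1 fM))// IM.2.
rewrite /Rintegral integral_indic ?setIT//; apply: compact_measurable_row; exact: cube_compact.
Qed.

Lemma lint_translate f (a : Rd) : lintegrable f ->
  lintegrable (fun x => f (x + a)) /\
  \int[mu]_x f (x + a) = \int[mu]_x f x.
Proof.
move=> /lintegrableP[f' [mf If ff']].
pose phi : {mfun Rd >-> Rd} := HB.pack (fun x : Rd => x + a)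
  (isMeasurableFun.Build _ _ _ _ _ (measurable_translate a)).
have ff'a : {ae mu, forall x, f (x + a) = f' (x + a)}.
  have [N [mN N0 fN]] := ff'; exists (phi @^-1` N); split.
  - by rewrite -[X in measurable X]setTI; exact: measurable_translate.
  - by have := leb_row_translate a mN; rewrite /pushforward N0.
  - by move=> x /= fx; exact: fN.
have mfa : measurable_fun setT (f' \o phi).
  by apply: measurableT_comp => //; exact: measurable_translate.
have muE : forall A, measurable A -> A `<=` setT -> pushforward mu phi A = mu A.
  by move=> A mA _; exact: leb_row_translate.
have Ifa : mu.-integrable setT (EFin \o (f' \o phi)).
  apply/integrableP; split; first exact/measurable_EFinP.
  move/integrableP : If => [_]; rewrite -(eq_measure_integral mu muE).
  rewrite ge0_integral_pushforward//=.
  - exact: measurable_translate.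
  - by apply/measurable_EFinP; apply: (measurableT_comp (f := Num.norm : R -> R)) => //; exact: normr_measurable.
split; first by apply: ae_lintegrable ff'a; exact: integrable_lintegrable.
rewrite (ae_Rintegral ff'a) (ae_Rintegral ff'); congr fine.
rewrite -[RHS](eq_measure_integral mu muE).
have mphi : measurable_fun setT phi by exact: measurable_translate.
rewrite (integral_pushforward mphi (mu := mu) _ Ifa measurableT) ?preimage_setT //.
exact/measurable_EFinP.
Qed.

End lint.

(** * Smooth functions *)

Section mean_value.
Context (R : realType).

(** The points a and b come in either order, since increments of coordinates have no sign; hence c
    is located by a distance. *)
Lemma MVT_R (f df : R -> R) (a b : R) : (forall x : R, is_derive x 1 f (df x)) ->
  exists2 c, `|c - a| <= `|b - a| & f b - f a = df c * (b - a).
Proof.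
move=> fdf.
have cf : continuous f.
  by move=> x; apply: differentiable_continuous; apply/derivable1_diffP; exact: (@ex_derive _ _ _ _ _ _ _ (fdf x)).
have [ab|/ltW ba] := leP a b.
  have [c + E] := MVT_segment ab (fun x _ => fdf x) (continuous_subspaceT cf).
  by rewrite in_itv/= => /andP[ac cb]; exists c => //; rewrite !ger0_norm ?subr_ge0 ?lerB.
have [c + E] := MVT_segment ba (fun x _ => fdf x) (continuous_subspaceT cf).
rewrite in_itv/= => /andP[bc ca]; exists c.
  by rewrite !ler0_norm ?subr_le0// lerN2 lerB.
by rewrite -opprB E -mulrN opprB.
Qed.

Lemma MVT_bound (f df : R -> R) (a b c e : R) : (forall x : R, is_derive x 1 f (df x)) ->
  (forall x, `|x - a| <= `|b - a| -> `|df x - c| <= e) ->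
  `|f b - f a - c * (b - a)| <= e * `|b - a|.
Proof.
move=> fdf dfc; have [x xab ->] := MVT_R a b fdf.
by rewrite -mulrBl normrM ler_wpM2r// dfc.
Qed.

End mean_value.

(** * Differentiability from partial derivatives *)

Section row_calculus.
Context (R : realType) (d : nat).
Local Notation Rd := 'rV[R]_d.
Local Notation e_ i := (delta_mx 0 i : Rd).
Implicit Types (f g : Rd -> R) (x : Rd).

(** The case of differential 0, to which a general differential is reduced by subtracting the linear
    part. *)
Lemma differentiable_littleo f x :
  (forall e, 0 < e -> \forall h \near (0 : Rd), `|f (h + x) - f x| <= e * `|h|) ->
  differentiable f x.
Proof.
move=> fx; apply/diffP.
(* [diffP] speaks of the differential picked by choice; it suffices to exhibit one linear map with
   the defining property. *)
apply: (@getPex _ (fun (df : {linear Rd -> R}) => continuous df /\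
  forall y, f y = f (lim (nbhs x)) + df (y - lim (nbhs x))
                  +o_(y \near x) (y - lim (nbhs x)))).
exists (@GRing.null_fun Rd R : {linear Rd -> R}); split; first exact: cst_continuous.
have E : f = cst (f x) +o_ x (fun y => y - x).
  apply/eqaddoP => e e0; rewrite [\forall x \near _, _ <= _](near_shift (0 : Rd)) /= subr0.
  by apply: filterS (fx e e0) => h /= fh; rewrite addrK.
by move=> y; rewrite {1}E lim_id// addr0.
Qed.

Lemma coord_differentiable i x : differentiable (fun y : Rd => y 0 i) x.
Proof. exact: differentiable_coord. Qed.

Lemma line_derive f i x t : derivable f (x + t *: e_ i) (e_ i) ->
  is_derive t 1 (fun s : R => f (x + s *: e_ i)) (partial i f (x + t *: e_ i)).
Proof.
move=> df.
have E : (fun h => h^-1 *: (((fun s : R => f (x + s *: e_ i)) \o shift t) (h *: 1) -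
       (fun s : R => f (x + s *: e_ i)) t)) =
  (fun h => h^-1 *: ((f \o shift (x + t *: e_ i)) (h *: e_ i) - f (x + t *: e_ i))).
  apply/funext => h /=; congr (_ *: (f _ - _)).
  by rewrite [h%:A]mulr1 scalerDl addrCA.
apply: DeriveDef; first by rewrite /derivable E.
by rewrite /derive E.
Qed.

End row_calculus.

Section row_C1.
Context (R : realType) (d : nat).
Local Notation Rd := 'rV[R]_d.
Local Notation e_ i := (delta_mx 0 i : Rd).
Implicit Types (f g : Rd -> R) (x : Rd).

Let trunc_row (k : nat) (h : Rd) : Rd := \row_i (if (i < k)%N then h 0 i else 0).

(** The path from x to x + h follows the axes, one coordinate at a time. Its corners
    [x + trunc_row k h] stay within |h| of x in the maximum norm, and each of the d legs contributes
    at most e |h| by the mean value theorem in one variable. *)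
Lemma row_MVT f x h (c : 'I_d -> R) e : (forall i y, derivable f y (e_ i)) ->
  (forall i y, `|y - x| <= `|h| -> `|partial i f y - c i| <= e) ->
  `|f (x + h) - f x - \sum_i c i * h 0 i| <= d%:R * e * `|h|.
Proof.
move=> df fc; pose G k := f (x + trunc_row k h).
have -> : f (x + h) - f x = \sum_(i < d) (G i.+1 - G i).
  rewrite -(big_mkord xpredT (fun k => G k.+1 - G k)) telescope_sumr// /G.
  congr (f (x + _) - f _).
    by apply/rowP => i; rewrite mxE ltn_ord.
  by apply/rowP => i; rewrite !mxE addr0.
rewrite -sumrB; apply: (le_trans (ler_norm_sum _ _ _)).
apply: (@le_trans _ _ (\sum_(i < d) e * `|h|)); last first.
  by rewrite sumr_const card_ord -[leLHS]mulr_natl mulrA.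
apply: ler_sum => i _.
have e0 : 0 <= e.
  by apply: le_trans (fc i x _); rewrite ?normr_ge0// subrr normr0.
have -> : G i.+1 = f (x + trunc_row i h + h 0 i *: e_ i).
  rewrite /G -addrA; congr (f (x + _)); apply/rowP => j; rewrite !mxE eqxx /= ltnS.
  rewrite leq_eqVlt; case: eqVneq => [/val_inj ->|ji]; rewrite ?eqxx ?ltnn/= ?mulr1 ?add0r//.
  by rewrite (_ : (j == i) = false) ?mulr0 ?addr0//; apply/negP => /eqP ji'; rewrite ji' eqxx in ji.
have -> : G i = f (x + trunc_row i h + 0 *: e_ i) by rewrite /G scale0r addr0.
have := @MVT_bound R (fun s => f (x + trunc_row i h + s *: e_ i))
  (fun s => partial i f (x + trunc_row i h + s *: e_ i)) 0 (h 0 i) (c i) e.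
rewrite subr0 => H; apply: le_trans (H _ _) _.
- by move=> s; exact: line_derive.
- move=> s; rewrite subr0 => sh; apply: fc.
  rewrite -(addrA x) (addrC x) addrK.
  apply/row_normP => // j; rewrite !mxE eqxx/=.
  have [ji|ij|/val_inj ->] := ltngtP j i.
  - rewrite (_ : (j == i) = false) ?mulr0 ?addr0 ?coord_le_norm//.
    by apply/negP => /eqP ji'; rewrite ji' ltnn in ji.
  - rewrite (_ : (j == i) = false) ?mulr0 ?addr0 ?normr0//.
    by apply/negP => /eqP ji'; rewrite ji' ltnn in ij.
  - by rewrite eqxx mulr1 add0r (le_trans sh)// coord_le_norm.
- by rewrite ler_wpM2l// coord_le_norm.
Qed.

Lemma differentiable_approx f x (c : 'I_d -> R) :
  (forall e, 0 < e -> \forall h \near (0 : Rd),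
    `|f (x + h) - f x - \sum_i c i * h 0 i| <= e * `|h|) ->
  differentiable f x /\ forall i, partial i f x = c i.
Proof.
move=> fx; pose L := fun h : Rd => \sum_i c i * h 0 i.
have dL y : differentiable L y.
  rewrite (_ : L = \sum_i (fun h : Rd => c i * h 0 i)); last first.
    by apply/funext => h; rewrite fct_sumE.
  apply: differentiable_sum => i; apply: differentiableZ; exact: coord_differentiable.
have df : differentiable f x.
  suff : differentiable (f \- L) x.
    by move=> /(differentiableD (dL x)); rewrite addrC subrK.
  apply: differentiable_littleo => e e0.
  apply: filterS (fx e e0) => h.
  have -> : (f \- L) (h + x) - (f \- L) x = f (x + h) - f x - L h.
    rewrite /= /L (addrC h).
    rewrite (_ : \sum_i c i * (x + h) 0 i = \sum_i c i * x 0 i + \sum_i c i * h 0 i); first by ring.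
    by rewrite -big_split/=; apply: eq_bigr => i _; rewrite mxE mulrDr.
  by [].
split => // i; apply: cvg_lim => //; apply/cvgrPdist_le => e e0.
have /nbhs_ballP[r /= r0 rfx] := fx _ e0.
near=> h.
have hn0 : h != 0 by near: h; exact: nbhs_dnbhs_neq.
have hr : `|h| < r by near: h; exact: dnbhs0_lt.
have Lh : \sum_j c j * (h *: e_ i) 0 j = h * c i.
  rewrite (bigD1 i)//= big1 ?addr0; first by rewrite !mxE !eqxx mulr1 mulrC.
  by move=> j /negbTE ji; rewrite !mxE ji andbF !mulr0.
have hn : `|h *: e_ i| <= `|h|.
  apply/row_normP => // j; rewrite !mxE eqxx /=.
  by case: eqP => _; rewrite ?mulr1// mulr0 normr0.
have := rfx (h *: e_ i); rewrite -ball_normE /= sub0r normrN Lh => /(_ (le_lt_trans hn hr)).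
move=> fh; rewrite (_ : c i - _ = - (h^-1 * (f (x + h *: e_ i) - f x - h * c i))); last first.
  rewrite (addrC x) [in RHS]mulrBr mulrA mulVf// mul1r opprB /GRing.scale//=.
rewrite normrN normrM normfV ler_pdivrMl ?normr_gt0// (le_trans fh)//.
by rewrite mulrC ler_wpM2r// ltW.
Unshelve. all: by end_near. Qed.

End row_C1.

(** * Closure properties of smooth functions and the Leibniz formula *)

Section smooth_closure.
Context (R : realType) (d : nat).
Local Notation Rd := 'rV[R]_d.
Local Notation e_ i := (delta_mx 0 i : Rd).
Implicit Types (f g : Rd -> R) (x : Rd).

Lemma partials_rcons s i f : partials (rcons s i) f = partials s (partial i f).
Proof. by rewrite /partials foldr_rcons. Qed.

Lemma partials_cat s t f : partials (s ++ t) f = partials s (partials t f).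
Proof. by rewrite /partials foldr_cat. Qed.

Lemma smooth_differentiable f x : smooth_real f -> differentiable f x.
Proof. by move=> /(_ [::]); apply. Qed.

Lemma smooth_continuous f : smooth_real f -> continuous f.
Proof. by move=> sf x; apply: differentiable_continuous; exact: smooth_differentiable. Qed.

Lemma smooth_derivable f x v : smooth_real f -> derivable f x v.
Proof. by move=> sf; apply: diff_derivable; exact: smooth_differentiable. Qed.

Lemma smooth_partials s f : smooth_real f -> smooth_real (partials s f).
Proof. by move=> sf t x; rewrite -partials_cat; exact: sf. Qed.

Lemma smooth_partial i f : smooth_real f -> smooth_real (partial i f).
Proof. exact: (@smooth_partials [:: i]). Qed.

(** A graded form of [smooth_real] that differentiates the function itself first: closure under
    products is then an induction on n in which [partialM] is applied once. *)
Fixpoint ndiff n f : Prop := if n is n'.+1 then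
  (forall x, differentiable f x) /\ forall i, ndiff n' (partial i f) else True.

Lemma smooth_ndiff f : smooth_real f <-> forall n, ndiff n f.
Proof.
split => [sf n|nf s].
  elim: n f sf => //= n IH f sf; split => [x|i]; first exact: smooth_differentiable.
  by apply: IH; exact: smooth_partial.
elim/last_ind: s f nf => [|s i IH] f nf x; first by have [] := nf 1%N.
by rewrite partials_rcons; apply: IH => n; have [_ /(_ i)] := nf n.+1.
Qed.

Lemma ndiffS n f : ndiff n.+1 f -> ndiff n f.
Proof.
elim: n f => //= n IH f [df pf]; split => // i; apply: IH; exact: pf.
Qed.

Lemma partial_cst i (c : R) : partial i (fun _ : Rd => c) = fun=> 0.
Proof. by apply/funext => x; rewrite /partial derive_cst. Qed.

Lemma partialD i f g x : differentiable f x -> differentiable g x ->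
  partial i (fun y => f y + g y) x = partial i f x + partial i g x.
Proof. by move=> df dg; apply: (@deriveD _ _ _ f g); exact: diff_derivable. Qed.

Lemma partialM i f g x : differentiable f x -> differentiable g x ->
  partial i (fun y => f y * g y) x = partial i f x * g x + f x * partial i g x.
Proof.
move=> df dg; rewrite /partial (@deriveM _ _ f g); try exact: diff_derivable.
by rewrite addrC; congr (_ + _); rewrite mulrC.
Qed.

Lemma partialZ i (c : R) f x : differentiable f x ->
  partial i (fun y => c * f y) x = c * partial i f x.
Proof.
move=> df; rewrite partialM//.
by rewrite partial_cst mul0r add0r.
Qed.

Lemma ndiff_cst n (c : R) : ndiff n (fun=> c).
Proof.
elim: n c => //= n IH c; split => [x|i]; first exact: (@differentiable_cst _ _ _ _ x).
by rewrite partial_cst; exact: IH.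
Qed.

Lemma ndiffD n f g : ndiff n f -> ndiff n g -> ndiff n (fun x => f x + g x).
Proof.
elim: n f g => //= n IH f g [df pf] [dg pg]; split => [x|i].
  exact: (@differentiableD _ _ _ f g).
rewrite (_ : partial i _ = fun x => partial i f x + partial i g x).
  by apply: IH; [exact: pf|exact: pg].
by apply/funext => x; rewrite partialD.
Qed.

Lemma ndiffM n f g : ndiff n f -> ndiff n g -> ndiff n (fun x => f x * g x).
Proof.
elim: n f g => // n IH f g nf ng; have [/= df pf] := nf; have [/= dg pg] := ng.
split => [x|i]; first exact: (@differentiableM _ _ f g).
rewrite (_ : partial i _ = fun x => partial i f x * g x + f x * partial i g x).
  have nf' := ndiffS nf; have ng' := ndiffS ng.
  by apply: ndiffD; apply: IH => //; [exact: pf|exact: pg].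
by apply/funext => x; rewrite partialM.
Qed.

Lemma smooth_cst (c : R) : smooth_real (fun _ : Rd => c).
Proof. by apply/smooth_ndiff => n; exact: ndiff_cst. Qed.

Lemma smoothD f g : smooth_real f -> smooth_real g ->
  smooth_real (fun x => f x + g x).
Proof.
by move=> /smooth_ndiff nf /smooth_ndiff ng; apply/smooth_ndiff => n; exact: ndiffD.
Qed.

Lemma smoothM f g : smooth_real f -> smooth_real g ->
  smooth_real (fun x => f x * g x).
Proof.
by move=> /smooth_ndiff nf /smooth_ndiff ng; apply/smooth_ndiff => n; exact: ndiffM.
Qed.

Lemma smoothZ (c : R) f : smooth_real f -> smooth_real (fun x => c * f x).
Proof. by apply: smoothM; exact: smooth_cst. Qed.

Lemma smoothB f g : smooth_real f -> smooth_real g ->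
  smooth_real (fun x => f x - g x).
Proof.
move=> sf sg; rewrite (_ : (fun x => _) = fun x => f x + -1 * g x); last first.
  by apply/funext => x; rewrite mulN1r.
by apply: smoothD => //; exact: smoothZ.
Qed.

Lemma smooth_prod (I : Type) (r : seq I) (F : I -> Rd -> R) :
  (forall i, smooth_real (F i)) -> smooth_real (fun x => \prod_(i <- r) F i x).
Proof.
move=> sF; elim: r => [|i r IH].
  rewrite (_ : (fun x => _) = fun=> 1); first exact: smooth_cst.
  by apply/funext => x; rewrite big_nil.
rewrite (_ : (fun x => _) = fun x => F i x * \prod_(j <- r) F j x).
  exact: smoothM.
by apply/funext => x; rewrite big_cons.
Qed.

Lemma partialsZ s (c : R) f : smooth_real f ->
  partials s (fun y => c * f y) = fun x => c * partials s f x.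
Proof.
move=> sf; elim: s => //= i s ->; apply/funext => x; apply: partialZ; exact: sf.
Qed.

Lemma partialsD s f g : smooth_real f -> smooth_real g ->
  partials s (fun y => f y + g y) = fun x => partials s f x + partials s g x.
Proof.
move=> sf sg; elim: s => //= i s ->; apply/funext => x; apply: partialD; [exact: sf|exact: sg].
Qed.

(** The ways to distribute the letters of s over two factors, listed with repetition: this replaces
    the binomial coefficients of the Leibniz formula. *)
Fixpoint splits (s : seq 'I_d) : seq (seq 'I_d * seq 'I_d) :=
  if s is i :: s' then
    [seq (i :: p.1, p.2) | p <- splits s'] ++ [seq (p.1, i :: p.2) | p <- splits s']
  else [:: ([::], [::])].

Lemma partial_sum i (I : Type) (r : seq I) (F : I -> Rd -> R) x :
  (forall k, differentiable (F k) x) ->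
  differentiable (fun y => \sum_(k <- r) F k y) x /\
  partial i (fun y => \sum_(k <- r) F k y) x = \sum_(k <- r) partial i (F k) x.
Proof.
move=> dF; elim: r => [|k r [IH1 IH2]].
  rewrite (_ : (fun x => _) = fun=> 0) ?big_nil ?partial_cst.
    by split => //; exact: (@differentiable_cst _ _ _ _ x).
  by apply/funext => y; rewrite big_nil.
rewrite (_ : (fun x => _) = fun y => F k y + \sum_(j <- r) F j y); last first.
  by apply/funext => y; rewrite big_cons.
split; first exact: (@differentiableD _ _ _ (F k)).
by rewrite partialD// big_cons IH2.
Qed.

Lemma partials_Leibniz s f g x : smooth_real f -> smooth_real g ->
  partials s (fun y => f y * g y) x =
  \sum_(p <- splits s) partials p.1 f x * partials p.2 g x.
Proof.
move=> sf sg; elim: s x => [|i s IH] x; first by rewrite /= big_seq1.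
rewrite /= big_cat !big_map/= -big_split/=.
rewrite (_ : partials s _ = fun x => \sum_(p <- splits s) partials p.1 f x * partials p.2 g x); last first.
  by apply/funext => y; exact: IH.
rewrite (partial_sum i _ _).2; last first.
  by move=> p; apply: differentiableM; [exact: sf|exact: sg].
by apply: eq_bigr => p _; rewrite partialM//.
Qed.

(** Together with [splits_tl] this isolates the only Leibniz term with all derivatives on the first
    factor, as the induction on the order in [multiplier_tempered] requires. *)
Lemma splits_hd s : splits s = (s, [::]) :: behead (splits s).
Proof. by elim: s => //= i s ->. Qed.

Lemma splits_tl s p : p \in behead (splits s) -> (size p.1 < size s)%N.
Proof.
elim: s p => [|i s IH] p //=.
rewrite splits_hd /= mem_cat inE => /orP[/mapP[q /IH qs ->]|] //=.
move=> /predU1P[->//|/mapP[q /IH qs ->]] /=.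
exact: ltn_trans qs _.
Qed.

End smooth_closure.

(** * Symmetry of mixed derivatives, locality and supports *)

Section smooth_order.
Context (R : realType) (d : nat).
Local Notation Rd := 'rV[R]_d.
Local Notation e_ i := (delta_mx 0 i : Rd).
Implicit Types (f g : Rd -> R) (x : Rd).

Lemma norm_e_le i (t : R) : `|t *: e_ i| <= `|t|.
Proof.
apply/row_normP => // j; rewrite !mxE eqxx /=.
by case: eqP => _; rewrite ?mulr1// mulr0 normr0.
Qed.

Lemma partial_translate i f a x :
  partial i (fun y => f (y + a)) x = partial i f (x + a).
Proof.
rewrite /partial /derive.
rewrite (_ : (fun h => _) = fun h => h^-1 *: ((f \o shift (x + a)) (h *: e_ i) - f (x + a)))//.
by apply/funext => h /=; rewrite addrA.
Qed.

Lemma partials_translate s f a x :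
  partials s (fun y => f (y + a)) x = partials s f (x + a).
Proof.
elim: s x => //= i s IH x; rewrite -partial_translate; congr (partial i _ x).
by apply/funext => y; exact: IH.
Qed.

Lemma differentiable_translate f a x : differentiable f (x + a) ->
  differentiable (fun y => f (y + a)) x.
Proof.
move=> df; apply: (@differentiable_comp _ _ _ _ (fun y => y + a) f) => //.
Qed.

Lemma smooth_translate f a : smooth_real f -> smooth_real (fun y => f (y + a)).
Proof.
move=> sf s x; rewrite (_ : partials s _ = fun y => partials s f (y + a)).
  exact/differentiable_translate/sf.
by apply/funext => y; rewrite partials_translate.
Qed.

(** The mean value theorem is applied twice. As the second difference is symmetric in i and j, it is
    also a value of the derivative taken in the other order, which is the core of Schwarz's theorem
    [partialC]. *)
Lemma mixed_difference i j f x t : smooth_real f ->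
  exists2 p, `|p - x| <= `|t| + `|t| &
    f (x + t *: e_ i + t *: e_ j) - f (x + t *: e_ i) - f (x + t *: e_ j) + f x
      = t * t * partial i (partial j f) p.
Proof.
move=> sf.
pose phi (s : R) := f (x + t *: e_ i + s *: e_ j) - f (x + s *: e_ j).
have dphi (s : R) : is_derive s 1 phi (partial j f (x + t *: e_ i + s *: e_ j)
    - partial j f (x + s *: e_ j)).
  by apply: is_deriveB; apply: line_derive; exact: smooth_derivable.
have [s st Es] := MVT_R 0 t dphi.
have dpsi (r : R) : is_derive r 1 (fun r => partial j f (x + s *: e_ j + r *: e_ i))
    (partial i (partial j f) (x + s *: e_ j + r *: e_ i)).
  by apply: line_derive; apply: smooth_derivable; exact: smooth_partial.
have [r rt Er] := MVT_R 0 t dpsi.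
exists (x + s *: e_ j + r *: e_ i).
  rewrite addrAC (addrC x) addrK (le_trans (ler_normD _ _))//.
  rewrite !subr0 in st rt.
  by rewrite lerD// (le_trans (norm_e_le _ _)).
move: Es Er; rewrite /phi !scale0r !addr0 !subr0 => Es Er.
rewrite addrAC in Er; rewrite -mulrA (mulrC t (partial _ _ _)) -Er.
by rewrite mulrC -Es; ring.
Qed.

Let dist_half (a b c e : R) : `|a - c| <= e / 2 -> `|b - c| <= e / 2 -> `|a - b| <= e.
Proof. by rewrite !ler_norml => /andP[h1 h2] /andP[h3 h4]; apply/andP; split; lra. Qed.

Lemma partialC i j f : smooth_real f ->
  partial i (partial j f) = partial j (partial i f).
Proof.
move=> sf; apply/funext => x; apply/eqP; rewrite -subr_eq0 -normr_le0.
apply/ler_addgt0Pr => e e0; rewrite add0r.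
have e2 : 0 < e / 2 by rewrite divr_gt0.
have cij k l : \forall y \near x, `|partial k (partial l f) x - partial k (partial l f) y| <= e / 2.
  have := @smooth_continuous _ _ _ (smooth_partial k (smooth_partial l sf)) x.
  by move=> /cvgr_dist_le/(_ _ e2).
have : \forall y \near x,
    `|partial i (partial j f) x - partial i (partial j f) y| <= e / 2 /\
    `|partial j (partial i f) x - partial j (partial i f) y| <= e / 2.
  by apply: filterI; exact: cij.
move=> /nbhs_ballP[r /= r0 xr].
(* The points given by [mixed_difference] are within 2 t = r / 2 of x, hence in the ball of radius
   r. *)
pose t := r / 4.
have t0 : 0 < t by rewrite divr_gt0.
have xt p : `|p - x| <= `|t| + `|t| -> ball x r p.
  rewrite -ball_normE /= distrC => /le_lt_trans; apply; rewrite ger0_norm ?ltW// /t; lra.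
have [p px Ep] := mixed_difference i j x t sf.
have [q qx] := mixed_difference j i x t sf.
rewrite (_ : _ + f x = t * t * partial i (partial j f) p); last first.
  by rewrite -Ep (addrAC x); ring.
move=> /mulfI pq; have {}pq : partial i (partial j f) p = partial j (partial i f) q.
  by apply: pq; rewrite mulf_neq0// gt_eqF.
have [+ _] := xr _ (xt _ px); have [_ +] := xr _ (xt _ qx); rewrite /= pq => h1 h2.
exact: dist_half h2 h1.
Qed.

Lemma partialsC s t f : smooth_real f ->
  partials s (partials t f) = partials t (partials s f).
Proof.
move=> sf; elim: s => //= i s ->.
elim: t => //= j t IHt; rewrite partialC; first by rewrite IHt.
by apply: smooth_partials; exact: smooth_partials.
Qed.

Lemma perm_partials s t f : smooth_real f -> perm_eq s t ->
  partials s f = partials t f.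
Proof.
move=> sf; apply: (catCA_perm_subst (F := fun s => partials s f)) => s1 s2 s3.
by rewrite !partials_cat partialsC//; exact: smooth_partials.
Qed.

Lemma near_differentiable f g x : (\near x, f x = g x) -> differentiable f x ->
  differentiable g x.
Proof.
move=> fg df; suff : differentiable (g \- f) x.
  by move=> /(differentiableD df); rewrite addrC subrK.
apply: differentiable_littleo => e e0.
have := fg; rewrite (near_shift (0 : Rd)) /= subr0 => fg0.
apply: filterS fg0 => h /= <-; rewrite subrr sub0r -(nbhs_singleton fg) subrr oppr0 normr0.
by rewrite mulr_ge0// ltW.
Qed.

Lemma partials_local (U : set Rd) f g s x : open U ->
  (forall y, U y -> f y = g y) -> U x -> partials s f x = partials s g x.
Proof.
move=> oU fg; elim: s x => [|i s IH] x Ux; first exact: fg.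
apply: near_eq_derive; have : nbhs x U by exact: open_nbhs_nbhs.
by apply: filterS => y; exact: IH.
Qed.

Lemma cubeC_open (r : R) : open (~` cube r : set Rd).
Proof.
rewrite openC; apply: compact_closed; first exact: norm_hausdorff.
exact: cube_compact.
Qed.

Definition supp_in (r : R) f := forall x, ~ cube r x -> f x = 0.

Lemma supp_in_partials r f s : supp_in r f -> supp_in r (partials s f).
Proof.
move=> f0 x xr; rewrite (partials_local s (@cubeC_open r) f0 xr).
suff -> : partials s (fun _ : Rd => 0 : R) = fun=> 0 by [].
by elim: s => //= i s ->; rewrite partial_cst.
Qed.

Lemma supp_in_bounded r f : continuous f -> supp_in r f ->
  exists2 M, 0 <= M & forall x, `|f x| <= M * \1_(cube r) x.
Proof.
move=> cf f0.
have /compact_bounded[M [_ fM]] : compact (f @` cube r).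
  by apply: continuous_compact; [exact: continuous_subspaceT|exact: cube_compact].
exists (`|M| + 1) => // x; rewrite indicE.
case: (asboolP (cube r x)) => xr.
  rewrite mem_set// mulr1; apply: fM; last by exists x.
  by rewrite (le_lt_trans (ler_norm _))// ltrDl.
by rewrite memNset// mulr0 f0// normr0.
Qed.

End smooth_order.

(** * Smooth functions of one variable *)

Section smooth1.
Context (R : realType).
Implicit Types (a b : R -> R) (t : R).

Fixpoint ndiff1 n a : Prop := if n is n'.+1 then
  (forall t, derivable a t 1) /\ ndiff1 n' (derive1 a) else True.

Definition smooth1 a := forall n, ndiff1 n a.

Lemma smooth1_derivable a t : smooth1 a -> derivable a t 1.
Proof. by move=> /(_ 1%N)[+ _]; apply. Qed.

Lemma smooth1_is_derive a t : smooth1 a -> is_derive t 1 a (derive1 a t).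
Proof.
by move=> sa; apply: DeriveDef; [exact: smooth1_derivable|rewrite derive1E].
Qed.

Lemma smooth1_derive1 a : smooth1 a -> smooth1 (derive1 a).
Proof. by move=> sa n; have [] := sa n.+1. Qed.

Lemma smooth1_derive1n n a : smooth1 a -> smooth1 (derive1n n a).
Proof. by move=> sa; elim: n => // n IH; rewrite derive1nS; exact: smooth1_derive1. Qed.

Lemma smooth1_continuous a : smooth1 a -> continuous a.
Proof.
move=> sa t; apply: differentiable_continuous; apply/derivable1_diffP.
exact: smooth1_derivable.
Qed.

(** Coinduction: a class of functions stable under derivation consists of smooth functions. It is
    meant for [exp_inv], whose derivatives have no closed form but stay in one family. *)
Lemma smooth1_coind (P : (R -> R) -> Prop) :
  (forall a, P a -> exists2 b, P b & forall t, is_derive t 1 a (b t)) ->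
  forall a, P a -> smooth1 a.
Proof.
move=> dP a Pa n; elim: n a Pa => //= n IH a Pa.
have [b Pb ab] := dP a Pa; split => [t|]; first exact: (@ex_derive _ _ _ _ _ _ _ (ab t)).
rewrite (_ : derive1 a = b); first exact: IH.
by apply/funext => t; rewrite derive1E (@derive_val _ _ _ _ _ _ _ (ab t)).
Qed.

Lemma ndiff1S n a : ndiff1 n.+1 a -> ndiff1 n a.
Proof. by elim: n a => //= n IH a [da pa]; split => //; exact: IH. Qed.

Lemma derive1D_fun a b : (forall t, derivable a t 1) -> (forall t, derivable b t 1) ->
  derive1 (fun t => a t + b t) = fun t => derive1 a t + derive1 b t.
Proof. by move=> da db; apply/funext => t; rewrite !derive1E (@deriveD _ _ _ a b). Qed.

Lemma derive1M_fun a b : (forall t, derivable a t 1) -> (forall t, derivable b t 1) ->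
  derive1 (fun t => a t * b t) = fun t => derive1 a t * b t + a t * derive1 b t.
Proof.
move=> da db; apply/funext => t; rewrite !derive1E (@deriveM _ _ a b)//.
by rewrite addrC; congr (_ + _); rewrite mulrC.
Qed.

Lemma ndiff1D n a b : ndiff1 n a -> ndiff1 n b -> ndiff1 n (fun t => a t + b t).
Proof.
elim: n a b => //= n IH a b [da pa] [db pb]; split => [t|].
  exact: (@derivableD _ _ _ a b).
by rewrite derive1D_fun//; exact: IH.
Qed.

Lemma ndiff1M n a b : ndiff1 n a -> ndiff1 n b -> ndiff1 n (fun t => a t * b t).
Proof.
elim: n a b => // n IH a b na nb; have [/= da pa] := na; have [/= db pb] := nb.
split => [t|]; first exact: (@derivableM _ _ a b).
have na' := ndiff1S na; have nb' := ndiff1S nb.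
by rewrite derive1M_fun//; apply: ndiff1D; apply: IH.
Qed.

Lemma smooth1D a b : smooth1 a -> smooth1 b -> smooth1 (fun t => a t + b t).
Proof. by move=> sa sb n; exact: ndiff1D. Qed.

Lemma smooth1M a b : smooth1 a -> smooth1 b -> smooth1 (fun t => a t * b t).
Proof. by move=> sa sb n; exact: ndiff1M. Qed.

Lemma smooth1_cst c : smooth1 (fun=> c).
Proof.
apply: (smooth1_coind (P := fun a => exists c, a = fun=> c)); last by exists c.
move=> _ [k ->]; exists (fun=> 0); first by exists 0.
by move=> t; exact: is_derive_cst.
Qed.

Lemma smooth1_id : smooth1 id.
Proof.
move=> [|n]//=; split => [t|]; first exact: derivable_id.
rewrite (_ : derive1 id = fun=> 1); first exact: smooth1_cst.
by apply/funext => t; rewrite derive1E derive_id.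
Qed.

Lemma smooth1X n : smooth1 (fun t => t ^+ n).
Proof.
elim: n => [|n IH]; first by under eq_fun do rewrite expr0; exact: smooth1_cst.
by under eq_fun do rewrite exprS; apply: smooth1M => //; exact: smooth1_id.
Qed.

Lemma smooth1B a b : smooth1 a -> smooth1 b -> smooth1 (fun t => a t - b t).
Proof.
move=> sa sb; rewrite (_ : (fun t => _) = fun t => a t + -1 * b t).
  by apply: smooth1D => //; apply: smooth1M => //; exact: smooth1_cst.
by apply/funext => t; rewrite mulN1r.
Qed.

Lemma is_derive_affine a (c k t : R) : smooth1 a ->
  is_derive t 1 (fun t => a (c * t + k)) (c * derive1 a (c * t + k)).
Proof.
move=> sa; have da := smooth1_is_derive (c * t + k) sa.
have dl : is_derive t 1 (fun t => c * t + k) c.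
  by apply: is_derive_eq; rewrite addr0 [c%:A]mulr1.
by have := @is_derive1_comp R a (fun t => c * t + k) t _ _ da dl; rewrite mulrC.
Qed.

Lemma smooth1_affine a c k : smooth1 a -> smooth1 (fun t => a (c * t + k)).
Proof.
move=> sa n; elim: n a sa => //= n IH a sa; split => [t|].
  exact: (@ex_derive _ _ _ _ _ _ _ (is_derive_affine c k t sa)).
rewrite (_ : derive1 _ = fun t => c * derive1 a (c * t + k)).
  by apply: ndiff1M; [exact: smooth1_cst|apply: IH; exact: smooth1_derive1].
by apply/funext => t; rewrite derive1E (@derive_val _ _ _ _ _ _ _ (is_derive_affine c k t sa)).
Qed.

Lemma derive1n_affine n a c k : smooth1 a ->
  derive1n n (fun t => a (c * t + k)) = fun t => c ^+ n * derive1n n a (c * t + k).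
Proof.
move=> sa; elim: n => [|n IH]; first by apply/funext => t; rewrite expr0 mul1r.
rewrite derive1nS IH; apply/funext => t; rewrite derive1E.
have := is_derive_affine c k t (smooth1_derive1n n sa) => /(is_deriveZ (c ^+ n)) H.
by rewrite (@derive_val _ _ _ _ _ _ _ H) derive1nS exprSr -mulrA.
Qed.

Lemma smooth1V a : (forall t, a t != 0) -> smooth1 a -> smooth1 (fun t => (a t)^-1).
Proof.
move=> a0 sa n; elim: n => // n IH; split => [t|].
  by apply: derivableV => //; exact: smooth1_derivable.
rewrite (_ : derive1 _ = fun t => (-1 * derive1 a t) * ((a t)^-1 * (a t)^-1)).
  apply: ndiff1M; last exact: ndiff1M.
  by apply: ndiff1M; [exact: smooth1_cst|exact: smooth1_derive1].
apply/funext => t; rewrite derive1E deriveV//; last exact: smooth1_derivable.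
by rewrite -derive1E mulN1r /GRing.scale/= -exprVn expr2 mulrC mulrN mulNr mulrC.
Qed.

End smooth1.

(** * Bump functions *)

Section bump.
Context (R : realType).
Implicit Types (a b : R -> R) (t : R) (p : {poly R}).

(** Needed for [exp_inv] at 0, the point where its two pieces meet. *)
Lemma is_derive_quadratic0 a (C : R) : (forall t, `|a t| <= C * t ^+ 2) ->
  is_derive (0 : R) (1 : R) a 0.
Proof.
move=> aC; have a0 : a 0 = 0.
  by apply/eqP; rewrite -normr_le0 (le_trans (aC 0))// expr0n mulr0.
have C0 : 0 <= C by have := le_trans (normr_ge0 _) (aC 1); rewrite expr1n mulr1.
have h0 : (fun h : R => h^-1 *: ((a \o shift 0) (h *: 1) - a 0)) @ 0^' --> (0 : R).
  apply/cvgrPdist_le => e e0; near=> h.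
  have hn0 : h != 0 by near: h; exact: nbhs_dnbhs_neq.
  rewrite sub0r normrN /= addr0 a0 subr0 [h%:A]mulr1 normrM normfV.
  rewrite ler_pdivrMl ?normr_gt0// (le_trans (aC h))//.
  rewrite -real_normK ?num_real// expr2 mulrA mulrC ler_wpM2l//.
  have : `|h| <= e / (C + 1).
    near: h; apply: dnbhs0_le.
    by rewrite divr_gt0// ltr_wpDl.
  rewrite ler_pdivlMr ?ltr_wpDl// => he; apply: le_trans he.
  by rewrite mulrC ler_wpM2l// lerDl.
apply: DeriveDef; first by apply/cvg_ex; exists 0.
exact: cvg_lim h0.
Unshelve. all: by end_near. Qed.

Lemma poly_expR_bounded p : exists C, forall y, 0 <= y -> `|p.[y]| * expR (- y) <= C.
Proof.
(* Term by term, y^i <= i! exp y for y >= 0. *)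
exists (\sum_(i < size p) `|p`_i| * i`!%:R) => y y0.
rewrite horner_coef (le_trans (ler_wpM2r (expR_ge0 _) (ler_norm_sum _ _ _)))//.
rewrite mulr_suml; apply: ler_sum => i _.
rewrite normrM -mulrA ler_wpM2l// ger0_norm ?exprn_ge0//.
rewrite expRN ler_pdivrMr ?expR_gt0// -ler_pdivrMl ?ltr0n ?fact_gt0//.
case: (i : nat) => [|n]; first by rewrite expr0 fact0 invr1 mulr1 -expR0 ler_expR.
by rewrite mulrC; apply: (@le_trans _ _ _ _ _ _ (expR_ge1Dxn n y0)); rewrite lerDr.
Qed.

(** The flat function exp(-1/t) with a polynomial factor in 1/t. The polynomial is a parameter
    because the family is then stable under derivation, p becoming (p - p') X^2. *)
Definition exp_inv p t : R := if 0 < t then p.[t^-1] * expR (- t^-1) else 0.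

Lemma exp_inv_quadratic p : exists C, forall t, `|exp_inv p t| <= C * t ^+ 2.
Proof.
have [C pC] := poly_expR_bounded (p * 'X^2).
exists C => t; rewrite /exp_inv; case: ifPn => t0.
  have := pC t^-1; rewrite invr_ge0 (ltW t0) => /(_ isT).
  rewrite hornerM hornerXn normrM (ger0_norm (sqr_ge0 _)) mulrAC => h.
  rewrite normrM (ger0_norm (expR_ge0 _)) -ler_pdivrMr ?exprn_gt0//.
  by rewrite -exprVn.
rewrite normr0 mulr_ge0// ?sqr_ge0//.
by have := pC 0 (lexx 0); apply: le_trans; rewrite mulr_ge0 ?expR_ge0.
Qed.

Lemma is_derive_exp_inv p t :
  is_derive t 1 (exp_inv p) (exp_inv ((p - p^`()) * 'X^2) t).
Proof.
have [t0|t0|<-] := ltgtP 0 t; last first.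
- rewrite {2}/exp_inv ltxx.
  have [C pC] := exp_inv_quadratic p.
  exact: is_derive_quadratic0 pC.
- rewrite {2}/exp_inv ltNge (ltW t0)/=.
  have d0 : is_derive t (1 : R) (fun _ : R => 0 : R) 0 by exact: is_derive_cst.
  apply: near_eq_is_derive d0.
  have : \forall s \near t, s < 0 by exact: lt_nbhsl.
  by apply: filterS => s s0; rewrite /exp_inv ltNge (ltW s0).
- rewrite {2}/exp_inv t0.
  have tn0 : t != 0 by rewrite gt_eqF.
  suff dd : is_derive t (1 : R) (fun s => p.[s^-1] * expR (- s^-1))
      (((p - p^`()) * 'X^2).[t^-1] * expR (- t^-1)).
    apply: near_eq_is_derive dd.
    have : \forall s \near t, 0 < s by exact: lt_nbhsr.
    by apply: filterS => s s0; rewrite /exp_inv s0.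
  have dV : is_derive t 1 (fun s : R => s^-1) (- t ^- 2).
    apply: DeriveDef; first by apply: derivableV => //; exact: derivable_id.
    by rewrite deriveV// derive_id /GRing.scale/= mulr1.
  have dp : is_derive t^-1 1 (horner p) (p^`()).[t^-1].
    exact: is_derive_poly.
  have d1 := @is_derive1_comp R (horner p) (fun s => s^-1) t _ _ dp dV.
  have dVN : is_derive t 1 (fun s : R => - s^-1) (t ^- 2).
    by have := is_deriveN dV; rewrite opprK.
  have d2 := @is_derive1_comp R expR (fun s => - s^-1) t _ _ (is_derive_expR _) dVN.
  have H := is_deriveM d1 d2.
  apply: DeriveDef; first exact: (@ex_derive _ _ _ _ _ _ _ H).
  rewrite (@derive_val _ _ _ _ _ _ _ H) /= /GRing.scale/= hornerM hornerXn hornerD hornerN exprVn; ring.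
Qed.

Lemma smooth1_exp_inv p : smooth1 (exp_inv p).
Proof.
apply: (smooth1_coind (P := fun a => exists p, a = exp_inv p)); last by exists p.
move=> _ [q ->]; exists (exp_inv ((q - q^`()) * 'X^2)); first by eexists.
by move=> t; exact: is_derive_exp_inv.
Qed.

Let e := exp_inv 1.

Let e_gt0 t : 0 < t -> 0 < e t.
Proof. by move=> t0; rewrite /e /exp_inv t0 hornerC mul1r expR_gt0. Qed.

Let e_le0 t : t <= 0 -> e t = 0.
Proof. by move=> t0; rewrite /e /exp_inv ltNge t0. Qed.

Let e_ge0 t : 0 <= e t.
Proof. by have [/e_le0->|/e_gt0/ltW] := leP t 0. Qed.

Let e_homo s t : s <= t -> e s <= e t.
Proof.
move=> st; have [s0|s0] := leP s 0; first by rewrite (e_le0 s0).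
have t0 := lt_le_trans s0 st.
by rewrite /e /exp_inv s0 t0 !hornerC !mul1r ler_expR lerN2 lef_pV2.
Qed.

(** The classical smooth transition from 0 to 1, taking place on [-1, 1]; the denominator never
    vanishes because one of t + 1 and 1 - t is positive. *)
Definition step t : R := e (t + 1) / (e (t + 1) + e (1 - t)).

Let den_gt0 t : 0 < e (t + 1) + e (1 - t).
Proof.
have [t0|t0] := leP t 0.
  by rewrite ltr_wpDl// e_gt0//; lra.
by rewrite ltr_pwDl// e_gt0//; lra.
Qed.

Lemma smooth1_step : smooth1 step.
Proof.
have s1 : smooth1 (fun t => e (t + 1)).
  rewrite (_ : (fun t => _) = fun t => e (1 * t + 1)).
    by apply: smooth1_affine; exact: smooth1_exp_inv.
  by apply/funext => t; rewrite mul1r.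
have s2 : smooth1 (fun t => e (1 - t)).
  rewrite (_ : (fun t => _) = fun t => e (-1 * t + 1)).
    by apply: smooth1_affine; exact: smooth1_exp_inv.
  by apply/funext => t; rewrite mulN1r addrC.
apply: smooth1M => //; apply: smooth1V; last exact: smooth1D.
by move=> t; rewrite gt_eqF.
Qed.

Lemma step_le t : t <= -1 -> step t = 0.
Proof. by move=> t1; rewrite /step e_le0 ?mul0r//; lra. Qed.

Lemma step_ge t : 1 <= t -> step t = 1.
Proof.
by move=> t1; rewrite /step (e_le0 (t := 1 - t)) ?addr0 ?divff//; [rewrite gt_eqF// e_gt0|]; lra.
Qed.

Lemma step_ge0 t : 0 <= step t.
Proof. by rewrite divr_ge0// ltW. Qed.

Lemma step_le1 t : step t <= 1.
Proof. by rewrite ler_pdivrMr// mul1r lerDl. Qed.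

Lemma step_homo s t : s <= t -> step s <= step t.
Proof.
move=> st; rewrite ler_pdivrMr// mulrAC ler_pdivlMr// !mulrDr (mulrC (e (s + 1))) lerD2l.
by rewrite ler_pM//; apply: e_homo; lra.
Qed.

Lemma step_derive_ge0 t : 0 <= derive1 step t.
Proof.
rewrite derive1E; apply: limr_ge; first exact: smooth1_derivable smooth1_step.
near=> h; have [h0|h0|<-] := ltgtP 0 h.
- rewrite mulr_ge0// ?invr_ge0 ?(ltW h0)// subr_ge0 step_homo//= [h%:A]mulr1; lra.
- rewrite mulr_le0// ?invr_le0 ?(ltW h0)// subr_le0 step_homo//= [h%:A]mulr1; lra.
- by rewrite invr0 scale0r.
Unshelve. all: by end_near. Qed.

End bump.

(** * Tensor products of functions of one variable *)

Section tensor.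
Context (R : realType) (d : nat).
Local Notation Rd := 'rV[R]_d.
Local Notation e_ i := (delta_mx 0 i : Rd).

Lemma coord_partial (a : R -> R) i j (x : Rd) : smooth1 a ->
  partial j (fun y : Rd => a (y 0 i)) x = if j == i then derive1 a (x 0 i) else 0.
Proof.
move=> sa; rewrite /partial /derive.
case: eqVneq => [->|ji].
  rewrite derive1E /derive.
  rewrite (_ : (fun h => _) = fun h => h^-1 *: ((a \o shift (x 0 i)) (h *: 1) - a (x 0 i)))//.
  by apply/funext => h /=; rewrite !mxE !eqxx.
rewrite (_ : (fun h => _) = fun=> 0); first exact: lim_cst.
by apply/funext => h /=; rewrite !mxE eqxx (eq_sym i) (negbTE ji) /= mulr0 add0r subrr scaler0.
Qed.

Lemma coord_ndiff n (a : R -> R) i : smooth1 a -> ndiff n (fun y : Rd => a (y 0 i)).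
Proof.
elim: n a => //= n IH a sa; split => [x|j].
  apply: (@differentiable_comp _ _ _ _ (fun y : Rd => y 0 i) a).
    exact: coord_differentiable.
  by apply/derivable1_diffP; exact: smooth1_derivable.
rewrite (_ : partial j _ = fun x => if j == i then derive1 a (x 0 i) else 0).
  case: eqP => _; last exact: ndiff_cst.
  by apply: IH; exact: smooth1_derive1.
by apply/funext => x; rewrite coord_partial.
Qed.

Lemma coord_smooth (a : R -> R) i : smooth1 a -> smooth_real (fun y : Rd => a (y 0 i)).
Proof. by move=> sa; apply/smooth_ndiff => n; exact: coord_ndiff. Qed.

Definition tens (a : 'I_d -> R -> R) (x : Rd) : R := \prod_l a l (x 0 l).

Definition upd (a : 'I_d -> R -> R) (i : 'I_d) (b : R -> R) : 'I_d -> R -> R :=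
  fun l => if l == i then b else a l.

Lemma tens_upd a i b x : tens (upd a i b) x = b (x 0 i) * \prod_(l | l != i) a l (x 0 l).
Proof.
rewrite /tens (bigD1 i)//= /upd eqxx; congr (_ * _).
by apply: eq_bigr => l /negbTE ->.
Qed.

Lemma tensE a i x : tens a x = a i (x 0 i) * \prod_(l | l != i) a l (x 0 l).
Proof. by rewrite /tens (bigD1 i). Qed.

Lemma tens_smooth a : (forall l, smooth1 (a l)) -> smooth_real (tens a).
Proof. by move=> sa; apply: smooth_prod => l; exact: coord_smooth. Qed.

Lemma partial_tens a i : (forall l, smooth1 (a l)) ->
  partial i (tens a) = tens (upd a i (derive1 (a i))).
Proof.
move=> sa; apply/funext => x; rewrite tens_upd.
have -> : tens a = fun y => a i (y 0 i) * \prod_(l | l != i) a l (y 0 l).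
  by apply/funext => y; exact: tensE.
have srest : smooth_real (fun y : Rd => \prod_(l | l != i) a l (y 0 l)).
  under eq_fun do rewrite -big_filter.
  by apply: smooth_prod => l; exact: coord_smooth.
rewrite partialM; [|exact: smooth_differentiable (coord_smooth _ (sa i))|exact: smooth_differentiable].
rewrite coord_partial// eqxx (_ : partial i (fun y => \prod_(l | l != i) _) x = 0).
  by rewrite mulr0 addr0.
rewrite /partial /derive (_ : (fun h => _) = fun=> 0); first exact: lim_cst.
apply/funext => h /=; rewrite (_ : \prod_(l | l != i) _ = \prod_(l | l != i) a l (x 0 l)).
  by rewrite subrr scaler0.
by apply: eq_bigr => l li; rewrite !mxE (negbTE li) andbF mulr0 add0r.
Qed.

Lemma updK a i b c : upd (upd a i b) i c = upd a i c.
Proof. by apply/funext => l; rewrite /upd; case: eqP. Qed.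

Lemma upd_smooth a i b : (forall l, smooth1 (a l)) -> smooth1 b ->
  forall l, smooth1 (upd a i b l).
Proof. by move=> sa sb l; rewrite /upd; case: eqP. Qed.

Lemma partials_tens a i m : (forall l, smooth1 (a l)) ->
  partials (nseq m i) (tens a) = tens (upd a i (derive1n m (a i))).
Proof.
move=> sa; elim: m => [|m IH] /=.
  congr tens; apply/funext => l; rewrite /upd; by case: eqP => [->|].
rewrite IH partial_tens; last by apply: upd_smooth => //; exact: smooth1_derive1n.
by rewrite updK {2}/upd eqxx.
Qed.

Lemma supp_in_tens a r : 0 <= r -> (forall l t, r < `|t| -> a l t = 0) ->
  supp_in r (tens a).
Proof.
move=> r0 ar x xr; have [l xl] : exists l, r < `|x 0 l|.
  apply: contrapT => h; apply: xr; apply/row_normP => // l.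
  by rewrite leNgt; apply/negP => lr; apply: h; exists l.
by rewrite (tensE a l) (ar _ _ xl) mul0r.
Qed.

End tensor.

(** * Correlation with a test function *)

Section corr.
Context (R : realType) (d : nat).
Local Notation Rd := 'rV[R]_d.
Local Notation mu := (@leb_row R d).
Local Notation e_ i := (delta_mx 0 i : Rd).
Implicit Types (f g psi : Rd -> R).

Lemma row_near0 (e : R) : 0 < e -> \forall h \near (0 : Rd), `|h| <= e.
Proof.
move=> e0; apply/nbhs_ballP; exists e => //= h.
by rewrite -ball_normE /= sub0r normrN => /ltW.
Qed.

Definition rL1loc g := lmeasurable g /\
  forall r, lintegrable (fun x => g x * \1_(cube r) x).

Lemma lmeasurable_cube (r : R) : lmeasurable (\1_(cube r) : Rd -> R).
Proof. by apply: lmeasurable_indic; apply: compact_measurable_row; exact: cube_compact. Qed.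

Lemma indic_cube_norm (r : R) (x : Rd) : `|\1_(cube r) x| = \1_(cube r) x :> R.
Proof. by rewrite ger0_norm. Qed.

Definition locnorm g (r : R) : R := \int[mu]_x `|g x * \1_(cube r) x|.

Lemma locnorm_ge0 g r : 0 <= locnorm g r.
Proof. exact: Rintegral_ge0. Qed.

Lemma rL1loc_bound g psi (M r : R) : rL1loc g -> lmeasurable psi ->
  (forall x, `|psi x| <= M * \1_(cube r) x) ->
  lintegrable (fun x => g x * psi x) /\
  `|\int[mu]_x (g x * psi x)| <= M * locnorm g r.
Proof.
move=> [mg ig] mpsi pM; have IM := lintegrableZ M (lintegrable_norm (ig r)).
have gM x : `|g x * psi x| <= M * `|g x * \1_(cube r) x|.
  by rewrite !normrM indic_cube_norm mulrCA ler_wpM2l.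
have I : lintegrable (fun x => g x * psi x).
  by apply: lintegrable_le IM.1 gM; exact: lmeasurableM.
split => //; rewrite (le_trans (norm_lint I))//.
by rewrite (le_trans (le_lint (lintegrable_norm I) IM.1 gM))// IM.2.
Qed.

Lemma rL1loc_test g psi r : rL1loc g -> continuous psi -> supp_in r psi ->
  lintegrable (fun x => g x * psi x).
Proof.
move=> lg cpsi spsi; have [M M0 pM] := supp_in_bounded cpsi spsi.
exact: (rL1loc_bound lg (continuous_lmeasurable cpsi) pM).1.
Qed.

Lemma supp_in_translate r psi (a : Rd) : supp_in r psi ->
  supp_in (r + `|a|) (fun y => psi (y + a)).
Proof.
move=> sp x xr; apply: sp => xa; apply: xr; rewrite /cube /=.
by rewrite -[x](addrK a) (le_trans (ler_normB _ _))// lerD2r.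
Qed.

Lemma continuous_translate psi (a : Rd) : continuous psi -> continuous (fun y : Rd => psi (y + a)).
Proof.
move=> cp x; apply: (@continuous_comp Rd Rd R (fun y : Rd => y + a) psi); last exact: cp.
apply: (@continuousD _ _ _ (fun y : Rd => y) (fun _ : Rd => a)); first exact: cvg_id.
exact: cst_continuous.
Qed.

(** Correlation rather than convolution: g is paired with a translate of psi without reflection.
    Derivatives in x fall on psi with a minus sign, which cancels against the one of a
    distributional derivative of g. *)
Definition corr g psi (x : Rd) : R := \int[mu]_y (g y * psi (y - x)).

Lemma smooth_Lipschitz psi r : smooth_real psi -> supp_in r psi ->
  exists2 M, 0 <= M & forall x h, `|psi (x + h) - psi x| <= M * `|h|.
Proof.
move=> sp up.
have /choice[M MP] : forall i : 'I_d, exists M, 0 <= M /\ forall x, `|partial i psi x| <= M.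
  move=> i; have [M M0 pM] := supp_in_bounded (smooth_continuous (smooth_partial i sp))
    (supp_in_partials [:: i] up).
  exists M; split => // x; rewrite (le_trans (pM x))// ler_piMr// indicE lern1 leq_b1.
exists (d%:R * \sum_i M i) => [|x h].
  by rewrite mulr_ge0// sumr_ge0// => i _; have [] := MP i.
have := @row_MVT _ _ psi x h (fun=> 0) (\sum_i M i) (fun i y => @smooth_derivable _ _ psi y _ sp).
rewrite [X in _ - X]big1 ?subr0; last by move=> i _; rewrite mul0r.
apply => i y _; rewrite subr0 (le_trans ((MP i).2 y))//.
rewrite (bigD1 i)//= lerDl sumr_ge0// => j _; by have [] := MP j.
Qed.

(** The first order expansion of psi has a remainder C |h|^2 uniform in the point, because the
    derivatives of psi are Lipschitz; integrated against g it gives the expansion of the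
    correlation. *)
Lemma corr_diff g psi r x : rL1loc g -> smooth_real psi -> supp_in r psi ->
  differentiable (corr g psi) x /\
  forall i, partial i (corr g psi) x = - corr g (partial i psi) x.
Proof.
move=> lg sp up.
have /choice[M MP] : forall i : 'I_d, exists M, 0 <= M /\
    forall x h, `|partial i psi (x + h) - partial i psi x| <= M * `|h|.
  move=> i; have [M M0 pM] := smooth_Lipschitz (smooth_partial i sp)
    (supp_in_partials [:: i] up).
  by exists M.
pose C := d%:R * \sum_i M i.
have C0 : 0 <= C by rewrite mulr_ge0// sumr_ge0// => i _; have [] := MP i.
have taylor z h : `|psi (z - h) - psi z + \sum_i partial i psi z * h 0 i| <= C * `|h| ^+ 2.
  have := @row_MVT _ _ psi z (- h) (fun i => partial i psi z) ((\sum_i M i) * `|h|)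
    (fun i y => @smooth_derivable _ _ psi y _ sp).
  rewrite (_ : \sum_i _ * _ = - \sum_i partial i psi z * h 0 i); last first.
    by rewrite -sumrN; apply: eq_bigr => i _; rewrite mxE mulrN.
  rewrite opprK normrN expr2 !mulrA; apply => i y yz.
  have := (MP i).2 z (y - z); rewrite (addrC z) subrK => /le_trans; apply.
  apply: ler_pM => //; first by have [] := MP i.
  rewrite (bigD1 i)//= lerDl sumr_ge0// => j _; by have [] := MP j.
pose D h y := psi (y - x - h) - psi (y - x) + \sum_i partial i psi (y - x) * h 0 i.
have int1 h : lintegrable (fun y => g y * psi (y - x - h)).
  have := @rL1loc_test g (fun y => psi (y + (- x - h))) _ lg
    (continuous_translate (smooth_continuous sp)) (supp_in_translate up).
  by under eq_fun do rewrite addrA.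
have int2 i : lintegrable (fun y => g y * partial i psi (y - x)).
  exact: (@rL1loc_test g (fun y => partial i psi (y - x)) _ lg
    (continuous_translate (smooth_continuous (smooth_partial i sp)))
    (supp_in_translate (supp_in_partials [:: i] up))).
have int0 : lintegrable (fun y => g y * psi (y - x)).
  by have := int1 0; under eq_fun do rewrite subr0.
have ED h : corr g psi (x + h) - corr g psi x - \sum_i (- corr g (partial i psi) x) * h 0 i =
    \int[mu]_y (g y * D h y).
  have i3 := lintegrableB (int1 h) int0.
  have i4 := lintegrable_sum (index_enum 'I_d) (fun i => (lintegrableZ (h 0 i) (int2 i)).1).
  have := (lintegrableD i3.1 i4.1).2; rewrite i3.2 i4.2.
  rewrite (_ : (fun y => _ - _ + _) = fun y => g y * D h y); last first.
    apply/funext => y; rewrite /D mulrDr mulrBr; congr (_ + _).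
    by rewrite mulr_sumr; apply: eq_bigr => i _; ring.
  move=> ->; rewrite /corr; congr (_ - _ + _).
    by congr fine; apply: eq_integral => y _; rewrite opprD addrA.
  rewrite -sumrN; apply: eq_bigr => i _; rewrite (lintegrableZ (h 0 i) (int2 i)).2; ring.
(* A cube that contains the supports of all translates psi (y - x - h) with |h| <= 1. *)
pose r' := r + `|x| + 1.
have DM h : `|h| <= 1 -> forall y, `|D h y| <= (C * `|h| ^+ 2) * \1_(cube r') y.
  move=> h1 y; rewrite indicE; case: (asboolP (cube r' y)) => yr.
    by rewrite mem_set// mulr1 taylor.
  have yx : ~ cube r (y - x).
    move=> yx; apply: yr; rewrite /cube/= -[y](subrK x) (le_trans (ler_normD _ _))// /r'.
    by rewrite -addrA lerD// lerDl.
  have yxh : ~ cube r (y - x - h).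
    move=> yxh; apply: yr; rewrite /cube/= -[y](subrK x) (le_trans (ler_normD _ _))// /r'.
    rewrite addrAC lerD2r -[y - x](subrK h) (le_trans (ler_normD _ _))//.
    exact: lerD.
  rewrite memNset// mulr0 /D up// up// subrr add0r big1 ?normr0// => i _.
  by rewrite (_ : partial i psi (y - x) = 0) ?mul0r//; exact: (supp_in_partials [:: i] up).
apply: (@differentiable_approx _ _ (corr g psi) x (fun i => - corr g (partial i psi) x)).
move=> e e0.
have G0 := locnorm_ge0 g r'.
have CG : 0 < C * locnorm g r' + 1 by rewrite ltr_wpDl// mulr_ge0.
have eCG : 0 < e / (C * locnorm g r' + 1) by rewrite divr_gt0.
near=> h; rewrite ED.
have h1 : `|h| <= 1 by near: h; exact: row_near0.
have mD : lmeasurable (D h).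
  apply: lmeasurableD.
    apply: lmeasurableB; apply: continuous_lmeasurable.
      rewrite (_ : (fun y => _) = fun y => psi (y + (- x - h))); last first.
        by apply/funext => y; rewrite addrA.
      exact/continuous_translate/smooth_continuous.
    exact/continuous_translate/smooth_continuous.
  apply: lmeasurable_sum => i; apply: lmeasurableM; last exact: lmeasurable_cst.
  exact/continuous_lmeasurable/continuous_translate/smooth_continuous/smooth_partial.
rewrite (le_trans (rL1loc_bound lg mD (DM h h1)).2)//.
have : `|h| <= e / (C * locnorm g r' + 1).
  by near: h; exact: row_near0.
rewrite ler_pdivlMr// => he.
rewrite expr2 mulrA mulrAC ler_wpM2r// (le_trans _ he)//.
rewrite mulrC mulrA mulrC ler_wpM2l// (mulrC _ C) lerDl//.
Unshelve. all: by end_near. Qed.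

End corr.

(** * Integration by parts and cutoff functions *)

Section parts.
Context (R : realType) (d : nat).
Local Notation Rd := 'rV[R]_d.
Local Notation mu := (@leb_row R d).
Implicit Types (f g psi : Rd -> R).

Lemma corr_partials g psi r s : rL1loc g -> smooth_real psi -> supp_in r psi ->
  partials s (corr g psi) = fun x => (-1) ^+ size s * corr g (partials s psi) x.
Proof.
move=> lg sp up; elim: s => [|i s IH] /=.
  by apply/funext => x; rewrite expr0 mul1r.
have H x := corr_diff x lg (smooth_partials s sp) (supp_in_partials s up).
rewrite IH; apply/funext => x; rewrite partialZ; last exact: (H x).1.
by rewrite (H x).2 exprS mulN1r mulrN mulNr.
Qed.

Lemma corr_smooth g psi r : rL1loc g -> smooth_real psi -> supp_in r psi ->
  smooth_real (corr g psi).
Proof.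
move=> lg sp up s x; rewrite (corr_partials _ lg sp up).
apply: (@differentiableM _ _ (fun=> (-1) ^+ size s)) => //.
exact: (corr_diff x lg (smooth_partials s sp) (supp_in_partials s up)).1.
Qed.

Lemma rL1loc_bounded g : lmeasurable g ->
  (forall r, exists M, forall x, cube r x -> `|g x| <= M) -> rL1loc g.
Proof.
move=> mg bg; split => // r; have [M gM] := bg r.
apply: (lintegrable_bounded (M := M) (r := r) _ _).1.
  by apply: lmeasurableM => //; exact: lmeasurable_cube.
move=> x; rewrite indicE; case: (asboolP (cube r x)) => xr.
  by rewrite mem_set// !mulr1; exact: gM.
by rewrite memNset// !mulr0 normr0.
Qed.

Lemma continuous_rL1loc f : continuous f -> rL1loc f.
Proof.
move=> cf; apply: rL1loc_bounded; first exact: continuous_lmeasurable.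
move=> r.
have /compact_bounded[M [_ fM]] : compact (f @` cube r).
  by apply: continuous_compact; [exact: continuous_subspaceT|exact: cube_compact].
exists (`|M| + 1) => // x xr; apply: fM; last by exists x.
by rewrite (le_lt_trans (ler_norm _))// ltrDl.
Qed.

(** The correlation of the constant 1 with psi is constant in x by translation invariance; its
    derivative, which is minus the integral in question by [corr_diff], is therefore 0. *)
Lemma lint_partial0 psi r i : smooth_real psi -> supp_in r psi ->
  \int[mu]_x partial i psi x = 0.
Proof.
move=> sp up.
have l1 : rL1loc (fun _ : Rd => 1 : R) by apply: continuous_rL1loc => x; exact: cst_continuous.
have [_ /(_ i)] := corr_diff 0 l1 sp up.
have E p r' : smooth_real p -> supp_in r' p ->
    corr (fun=> 1) p = fun=> \int[mu]_x p x.
  move=> sp' up'; apply/funext => x; rewrite /corr.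
  under eq_Rintegral do rewrite mul1r.
  have Ip : lintegrable p.
    have := rL1loc_test l1 (smooth_continuous sp') up'.
    by under eq_fun do rewrite mul1r.
  exact: (lint_translate (- x) Ip).2.
rewrite (E _ _ sp up) partial_cst (E _ _ (smooth_partial i sp) (supp_in_partials [:: i] up)).
by move/esym/eqP; rewrite oppr_eq0 => /eqP.
Qed.

Lemma supp_inM f psi r : supp_in r psi -> supp_in r (fun x => f x * psi x).
Proof. by move=> up x /up ->; rewrite mulr0. Qed.

Lemma lint_parts1 f psi r i : smooth_real f -> smooth_real psi -> supp_in r psi ->
  \int[mu]_x (f x * partial i psi x) = - \int[mu]_x (partial i f x * psi x).
Proof.
move=> sf sp up; apply/eqP; rewrite -addr_eq0; apply/eqP.
rewrite -(lint_partial0 i (smoothM sf sp) (supp_inM f up)).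
have I1 : lintegrable (fun x => f x * partial i psi x).
  exact: (rL1loc_test (continuous_rL1loc (smooth_continuous sf))
    (smooth_continuous (smooth_partial i sp)) (supp_in_partials [:: i] up)).
have I2 : lintegrable (fun x => partial i f x * psi x).
  exact: (rL1loc_test (continuous_rL1loc (smooth_continuous (smooth_partial i sf)))
    (smooth_continuous sp) up).
rewrite -(lintegrableD I1 I2).2; apply: eq_Rintegral => x _.
by rewrite partialM; [rewrite addrC|exact: smooth_differentiable|exact: smooth_differentiable].
Qed.

Lemma lint_parts f psi r s : smooth_real f -> smooth_real psi -> supp_in r psi ->
  \int[mu]_x (f x * partials s psi x) =
  (-1) ^+ size s * \int[mu]_x (partials s f x * psi x).
Proof.
move=> sf sp up; elim/last_ind: s psi sp up => [|s i IH] psi sp up.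
  by rewrite expr0 mul1r.
rewrite partials_rcons IH; [|exact: smooth_partial|exact: (supp_in_partials [:: i])].
rewrite (lint_parts1 i (smooth_partials s sf) sp up) size_rcons exprS mulN1r mulrN -mulNr.
rewrite (@perm_partials _ _ (rcons s i) (i :: s))//.
by rewrite perm_rcons.
Qed.

(** In each variable one step rises on [-r - 2, -r] and the other falls on [r, r + 2]; the width 2
    of the transition of [step] is the margin that reappears wherever a cutoff is used. *)
Definition cutoff (r : R) : Rd -> R :=
  tens (fun _ t => step (1 * t + (r + 1)) * step (-1 * t + (r + 1))).

Lemma cutoff_smooth r : smooth_real (cutoff r).
Proof.
by apply: tens_smooth => l; apply: smooth1M; apply: smooth1_affine; exact: smooth1_step.
Qed.

Lemma cutoff1 r x : cube r x -> cutoff r x = 1.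
Proof.
move=> xr; rewrite /cutoff /tens big1// => l _.
have : `|x 0 l| <= r by rewrite (le_trans (coord_le_norm _ _)).
by rewrite ler_norml => /andP[h1 h2]; rewrite !step_ge ?mulr1//; lra.
Qed.

Lemma cutoff_supp r : 0 <= r -> supp_in (r + 2) (cutoff r).
Proof.
move=> r0; apply: supp_in_tens; first lra.
move=> _ t; rewrite ltr_normr => /orP[h|h]; last by rewrite step_le ?mul0r//; lra.
by rewrite mulrC step_le ?mul0r//; lra.
Qed.

Lemma cutoff_ge0 r x : 0 <= cutoff r x.
Proof. by apply: prodr_ge0 => l _; rewrite mulr_ge0// step_ge0. Qed.

End parts.

(** * The fundamental lemma of the calculus of variations *)

Section density_measure.
Context (R : realType) (d : nat).
Local Notation Rd := 'rV[R]_d.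
Local Notation mu := (@leb_row R d).
Local Open Scope ereal_scope.
Variable (f : Rd -> \bar R).
Hypotheses (mf : measurable_fun setT f) (f0 : forall x, 0 <= f x).

Definition density (A : set Rd) : \bar R := \int[mu]_(x in A) f x.

Let density0 : density set0 = 0. Proof. by rewrite /density integral_set0. Qed.
Let density_ge0 A : 0 <= density A. Proof. exact: integral_ge0. Qed.
Let density_sigma : semi_sigma_additive density.
Proof. exact: semi_sigma_additive_nng_induced. Qed.

Definition density_measure : {measure set Rd -> \bar R} :=
  HB.pack density (isMeasure.Build _ _ _ density density0 density_ge0 density_sigma).

End density_measure.

Section du_bois_reymond.
Context (R : realType) (d : nat).
Local Notation Rd := 'rV[R]_d.
Local Notation mu := (@leb_row R d).
Implicit Types (f g psi : Rd -> R).

(** For n > 0 each factor rises on [a l, a l + 2/n] and falls on [b l - 2/n, b l], so that the bumps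
    stay below the indicator of the open box and converge to it. *)
Definition box_bump (a b : 'I_d -> R) (n : nat) : Rd -> R :=
  tens (fun l t => step (n%:R * t + (- (n%:R * a l) - 1)) *
                   step (- n%:R * t + (n%:R * b l - 1))).

Lemma box_bump_smooth a b n : smooth_real (box_bump a b n).
Proof.
by apply: tens_smooth => l; apply: smooth1M; apply: smooth1_affine; exact: smooth1_step.
Qed.

Lemma box_bump_norm_le a b n x : `|box_bump a b n x| <= \1_(obox a b) x.
Proof.
rewrite ger0_norm; last by apply: prodr_ge0 => l _; rewrite mulr_ge0// step_ge0.
rewrite indicE; case: (asboolP (obox a b x)) => xab.
  rewrite mem_set//; apply: prodr_ile1 => l _; rewrite mulr_ge0 ?step_ge0//=.
  by rewrite mulr_ile1// ?step_ge0// step_le1.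
have [l xl] : exists l, ~ (a l < x 0 l < b l).
  by apply: contrapT => h; apply: xab => l; apply: contrapT => hl; apply: h; exists l.
rewrite memNset// /box_bump (tensE _ l) /=.
move: xl => /negP; rewrite negb_and -!leNgt => /orP[xa|bx].
  rewrite step_le ?mul0r ?mul0r//.
  have : n%:R * x 0 l <= n%:R * a l by rewrite ler_wpM2l.
  lra.
rewrite mulrAC mulrC step_le ?mul0r ?mulr0//.
have : n%:R * b l <= n%:R * x 0 l by rewrite ler_wpM2l.
rewrite mulNr; lra.
Qed.

Lemma box_bump_cvg a b x : (box_bump a b n x @[n --> \oo]) --> (\1_(obox a b) x : R).
Proof.
case: (asboolP (obox a b x)) => xab; last first.
  rewrite (_ : (fun n => _) = fun=> \1_(obox a b) x); first exact: cvg_cst.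
  apply/funext => n; have := box_bump_norm_le a b n x.
  by rewrite indicE memNset// normr_le0 => /eqP.
rewrite indicE mem_set//; apply: cvg_near_cst.
have : \forall n \near \oo, forall l : 'I_d,
    2 <= n%:R * (x 0 l - a l) /\ 2 <= n%:R * (b l - x 0 l).
  apply: (@filter_forall nat 'I_d (fun l n =>
    2 <= n%:R * (x 0 l - a l) /\ 2 <= n%:R * (b l - x 0 l)) \oo _) => l.
  have /andP[al bl] := xab l.
  have N (e : R) : 0 < e -> \forall n \near \oo, 2 <= n%:R * e.
    move=> e0; near=> n; rewrite -ler_pdivrMr//; near: n; exact: nbhs_infty_ger.
  by apply: filterI; apply: N; rewrite subr_gt0.
apply: filterS => n nl; rewrite /box_bump /tens big1// => l _.
have [h1 h2] := nl l; rewrite mulrBr in h1; rewrite mulrBr in h2.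
rewrite -[1 *- n]/(- n%:R) mulNr !step_ge ?mulr1//; lra.
Unshelve. all: by end_near. Qed.

Lemma obox_sub_cube (a b : 'I_d -> R) : exists2 r, 0 <= r & obox a b `<=` cube r.
Proof.
exists (\sum_l (`|a l| + `|b l|)) => [|x xab].
  by apply: sumr_ge0 => l _; rewrite addr_ge0.
apply/row_normP; first by apply: sumr_ge0 => l _; rewrite addr_ge0.
move=> l; have /andP[al bl] := xab l.
rewrite (bigD1 l)//= (@le_trans _ _ (`|a l| + `|b l|))//; last first.
  by rewrite lerDl sumr_ge0// => j _; rewrite addr_ge0.
rewrite ler_norml; have := ler_norm (b l); have := ler_norm (- a l); rewrite normrN.
have := normr_ge0 (a l); have := normr_ge0 (b l); lra.
Qed.

Lemma indic_sub (A B : set Rd) x : A `<=` B -> \1_A x <= \1_B x :> R.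
Proof.
move=> AB; rewrite !indicE; case: (asboolP (A x)) => Ax; last by rewrite memNset.
by rewrite !mem_set//; exact: AB.
Qed.

Lemma lint_obox0 g a b : rL1loc g ->
  (forall psi r, smooth_real psi -> supp_in r psi -> \int[mu]_x (g x * psi x) = 0) ->
  \int[mu]_x (g x * \1_(obox a b) x) = 0.
Proof.
move=> lg g0; have [[g' mg' gg'] ig] := lg.
have [r r0 abr] := obox_sub_cube a b.
have ae (h : Rd -> R) : {ae mu, forall x, g x * h x = g' x * h x}.
  by apply: filterS gg' => x ->.
have gb0 n : \int[mu]_x (g' x * box_bump a b n x) = 0.
  rewrite -(ae_Rintegral (ae _)); apply: (g0 _ r); first exact: box_bump_smooth.
  move=> x xr; apply/eqP; rewrite -normr_le0 (le_trans (box_bump_norm_le _ _ _ _))//.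
  by rewrite indicE memNset// => /abr.
have mb n : measurable_fun setT (fun x => (g' x * box_bump a b n x)%:E).
  apply/measurable_EFinP; apply: measurable_funM => //.
  by apply: continuous_measurable_row; apply: smooth_continuous; exact: box_bump_smooth.
have mi : measurable_fun setT (fun x => (g' x * \1_(obox a b) x)%:E).
  apply/measurable_EFinP; apply: measurable_funM => //.
  by apply: measurable_indic; exact: measurable_obox.
have mc : measurable_fun setT (fun x => `|g' x * \1_(cube r) x|).
  apply: measurableT_comp; first exact: normr_measurable.
  apply: measurable_funM => //; apply: measurable_indic.
  by apply: compact_measurable_row; exact: cube_compact.
have Ic : mu.-integrable setT (fun x => `|g' x * \1_(cube r) x|%:E).
  apply/integrableP; split; first exact/measurable_EFinP.
  have [_] := ae_lintegrable (ig r) (filterS (fun x e => esym e) (ae (\1_(cube r)))).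
  by apply: le_lt_trans; apply: ge0_le_integral => //= [||x _];
    rewrite ?normr_id//; [exact/measurable_EFinP/measurableT_comp|exact/measurable_EFinP].
have [|||] := @dominated_convergence _ _ _ mu setT measurableT
   (fun n x => (g' x * box_bump a b n x)%:E) (fun x => (g' x * \1_(obox a b) x)%:E)
   (fun x => `|g' x * \1_(cube r) x|%:E) mb mi.
- apply: aeW => x _; apply: cvg_EFin; first exact: nearW.
  by apply: cvgMr; exact: box_bump_cvg.
- exact: Ic.
- apply: aeW => x n _; rewrite lee_fin !normrM ler_wpM2l//.
  by rewrite (le_trans (box_bump_norm_le _ _ _ _))// (le_trans (indic_sub _ abr))// ler_norm.
move=> Ii _ cI; rewrite (ae_Rintegral (ae _)).
have I0 n : (\int[mu]_x (g' x * box_bump a b n x)%:E = 0)%E.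
  have In : mu.-integrable setT (fun x => (g' x * box_bump a b n x)%:E).
    apply: le_integrable Ic => // x _; rewrite lee_fin normr_id !normrM ler_wpM2l//.
    by rewrite (le_trans (box_bump_norm_le _ _ _ _))// (le_trans (indic_sub _ abr))// ler_norm.
  by rewrite -(fineK (integrable_fin_num _ In))//; have := gb0 n; rewrite /Rintegral => ->.
have : (\int[mu]_x (g' x * \1_(obox a b) x)%:E = 0)%E.
  have c0 : (fun n => \int[mu]_x (g' x * box_bump a b n x)%:E)%E @ \oo --> 0%E.
    rewrite (_ : (fun n => _) = fun=> 0%E); first exact: cvg_cst.
    by apply/funext => n; exact: I0.
  exact: (cvg_unique _ cI c0).
by rewrite /Rintegral => ->.
Qed.

(** Dominated convergence along [box_bump] shows that g has integral 0 over every box. On the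
    bounded box [B k], the positive and negative parts of a Borel representative are then densities
    of two finite measures that agree on boxes, hence on all Borel sets, so that g has integral 0
    over each Borel subset. *)
Theorem du_bois_reymond g : rL1loc g ->
  (forall psi r, smooth_real psi -> supp_in r psi -> \int[mu]_x (g x * psi x) = 0) ->
  {ae mu, forall x, g x = 0}.
Proof.
move=> lg g0; have [[g' mg' gg'] ig] := lg.
pose B (k : nat) : set Rd := obox (fun=> - k%:R) (fun=> k%:R).
suff h k : {ae mu, forall x, g' x * \1_(B k) x = 0}.
  have : {ae mu, forall x, forall k, g' x * \1_(B k) x = 0} by exact/ae_foralln.
  apply: filterS2 gg' => x gx gB; rewrite gx.
  have [k _ Bx] : (\bigcup_k B k) x by rewrite obox_cover.
  by have := gB k; rewrite indicE mem_set// mulr1.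
pose f x := g' x * \1_(B k) x.
have mf : measurable_fun setT f.
  by apply: measurable_funM => //; apply: measurable_indic; exact: measurable_obox.
have [r r0 Br] := obox_sub_cube (fun=> - k%:R) (fun=> k%:R).
have If : mu.-integrable setT (EFin \o f).
  apply/integrableP; split; first exact/measurable_EFinP.
  have : lintegrable f.
    have l1 : lintegrable (fun x => g' x * \1_(cube r) x).
      by apply: ae_lintegrable (ig r) _; apply: filterS gg' => x ->.
    apply: (lintegrable_le (measurable_lmeasurable mf) (lintegrable_norm l1)) => x.
    by rewrite /f !normrM ler_wpM2l// !ger0_norm//; exact: indic_sub.
  by case.
pose fp := density_measure (measurable_funepos (measurable_int _ If)) (fun x => funepos_ge0 _ x).
pose fn := density_measure (measurable_funeneg (measurable_int _ If)) (fun x => funeneg_ge0 _ x).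
have restr A (h : Rd -> R) : (\int[mu]_(x in A) (h x)%:E = \int[mu]_x (h x * \1_A x)%:E)%E.
  rewrite integral_mkcond; apply: eq_integral => x _; rewrite patchE indicE.
  by case: ifPn => _; rewrite ?mulr1 ?mulr0.
have IfA A : measurable A -> mu.-integrable A (EFin \o f).
  by move=> mA; exact: (integrableS measurableT mA (@subsetT _ _) If).
have intB a b : (\int[mu]_(x in obox a b) (f x)%:E = 0)%E.
  rewrite -(fineK (integrable_fin_num _ (IfA _ (measurable_obox a b))))//; last exact: measurable_obox.
  congr EFin; rewrite restr.
  rewrite -[RHS](@lint_obox0 g (fun i => Num.max (- k%:R) (a i)) (fun i => Num.min k%:R (b i)) lg g0).
  rewrite -obox_setI; apply: ae_Rintegral; apply: filterS gg' => x ->.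
  by rewrite /f -mulrA; congr (_ * _); rewrite indicI.
have fpn A : measurable A -> fp A = fn A.
  apply: row_measure_unique => a b.
    have mab := measurable_obox a b; have Iab := IfA _ mab.
    have := intB a b; rewrite integralE => /eqP.
    rewrite sube_eq ?add0e; first by move/eqP.
    - exact: integrable_pos_fin_num.
    - by apply: fin_num_adde_defr.
  have mab := measurable_obox a b; have Iab := IfA _ mab.
  by have := integrable_pos_fin_num mab Iab; rewrite ge0_fin_numE//; exact: integral_ge0.
have : ae_eq mu setT (EFin \o f) (cst 0%E).
  apply: integral_ae_eq => // A _ mA; rewrite integral_cst// mul0e integralE.
  have := fpn A mA; rewrite /fp /fn /= /density => ->.
  by rewrite subee//; apply: integrable_neg_fin_num => //; exact: IfA.
by apply: filterS => x /(_ Logic.I) [].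
Qed.

End du_bois_reymond.

(** * Distributions with locally integrable derivatives are smooth *)

Section mollifier1.
Context (R : realType).
Implicit Types (a b : R -> R) (t : R).

Lemma derive1n_local (U : set R) a b n t : open U ->
  (forall s, U s -> a s = b s) -> U t -> derive1n n a t = derive1n n b t.
Proof.
move=> oU ab; elim: n t => [|n IH] t Ut; first exact: ab.
rewrite !derive1nS !derive1E; apply: near_eq_derive.
by have : nbhs t U by [exact: open_nbhs_nbhs]; apply: filterS => s; exact: IH.
Qed.

Lemma derive1nSr n a : derive1n n.+1 a = derive1n n (derive1 a).
Proof. by rewrite /derive1n iterSr. Qed.

Definition powf n t : R := t ^+ n / n`!%:R.

Lemma smooth1_powf n : smooth1 (powf n).
Proof. by apply: smooth1M; [exact: smooth1X|exact: smooth1_cst]. Qed.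

Lemma derive1_powf n : derive1 (powf n.+1) = powf n.
Proof.
rewrite /powf derive1M_fun; first last.
- by move=> t; exact: derivable_cst.
- by move=> t; exact: smooth1_derivable (smooth1X _ n.+1).
apply/funext => t; rewrite derive1_cst mulr0 addr0 exp_derive1 factS natrM.
rewrite [X in X * _](_ : _ = n.+1%:R * t ^+ n) //.
have n0 : n.+1%:R != 0 :> R by rewrite pnatr_eq0.
have f0 : n`!%:R != 0 :> R by rewrite pnatr_eq0 -lt0n fact_gt0.
by move: (n.+1%:R : R) (n`!%:R : R) n0 f0 => N F n0 f0; field; rewrite f0 n0.
Qed.

Lemma derive1n_powf n k : derive1n n (powf (n + k)) = powf k.
Proof. by elim: n => // n IH; rewrite derive1nSr addSn derive1_powf. Qed.

Lemma powf0 : powf 0 = fun=> 1.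
Proof. by apply/funext => t; rewrite /powf expr0 fact0 divr1. Qed.

(* The crucial identity is [rho1_scale]: the dyadic increments of the mollifier
   are derivatives of high order. *)
Definition Phi n t : R := step t * powf n t.
Definition rho1 n : R -> R := derive1n n.+1 (Phi n).
Definition kap n t : R := (step (2 * t + 0) - step t) * powf n t.

Lemma smooth1_Phi n : smooth1 (Phi n).
Proof. by apply: smooth1M; [exact: smooth1_step|exact: smooth1_powf]. Qed.

Lemma smooth1_rho1 n : smooth1 (rho1 n).
Proof. by apply: smooth1_derive1n; exact: smooth1_Phi. Qed.

Lemma smooth1_kap n : smooth1 (kap n).
Proof.
apply: smooth1M; last exact: smooth1_powf.
by apply: smooth1B; [apply: smooth1_affine|]; exact: smooth1_step.
Qed.

Lemma derive1n_add n a b : smooth1 a -> smooth1 b ->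
  derive1n n (fun t => a t + b t) = fun t => derive1n n a t + derive1n n b t.
Proof.
elim: n a b => // n IH a b sa sb; rewrite !derive1nSr derive1D_fun; last 2 first.
- by move=> t; exact: smooth1_derivable.
- by move=> t; exact: smooth1_derivable.
by rewrite IH//; exact: smooth1_derive1.
Qed.

Lemma derive1n_scale n (c : R) a : smooth1 a ->
  derive1n n (fun t => c * a t) = fun t => c * derive1n n a t.
Proof.
elim: n a => // n IH a sa; rewrite !derive1nSr derive1M_fun; last 2 first.
- by move=> t; exact: derivable_cst.
- by move=> t; exact: smooth1_derivable.
rewrite -IH; last exact: smooth1_derive1.
by congr (derive1n n _); apply/funext => t; rewrite derive1_cst mul0r add0r.
Qed.

(** [Phi n] is a smoothed truncated power, and [powf n] is homogeneous of degree n: in 2^-n Phi n (2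
    t) - Phi n t the powers match and leave the compactly supported [kap n]. Deriving n + 1 times
    turns the factor 2^-n into 2. *)
Lemma rho1_scale n t : 2 * rho1 n (2 * t) - rho1 n t = derive1n n.+1 (kap n) t.
Proof.
have -> : kap n = fun t => 2 ^- n * Phi n (2 * t + 0) + -1 * Phi n t.
  apply/funext => s; rewrite /kap /Phi /powf addr0 exprMn.
  have : 2 ^+ n != 0 :> R by rewrite expf_neq0.
  have : n`!%:R != 0 :> R by rewrite pnatr_eq0 -lt0n fact_gt0.
  by move=> h1 h2; field; rewrite h1 h2.
have s2 : smooth1 (fun t => Phi n (2 * t + 0)) by apply: smooth1_affine; exact: smooth1_Phi.
rewrite derive1n_add; [|apply: smooth1M => //; exact: smooth1_cst|
  apply: smooth1M; [exact: smooth1_cst|exact: smooth1_Phi]].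
rewrite derive1n_scale// derive1n_scale; last exact: smooth1_Phi.
rewrite (derive1n_affine n.+1 2 0 (smooth1_Phi n)) addr0 mulN1r -/(rho1 n); congr (_ - _).
rewrite mulrA; congr (_ * _); rewrite exprS mulrCA mulVf ?mulr1//.
Qed.

Lemma Phi_gt1 n k t : 1 < t -> derive1n k (Phi n) t = derive1n k (powf n) t.
Proof.
move=> t1; apply: (@derive1n_local [set t : R | 1 < t]) => //.
by move=> s /= s1; rewrite /Phi step_ge ?mul1r// ltW.
Qed.

Lemma Phi_ltN1 n k t : t < -1 -> derive1n k (Phi n) t = 0.
Proof.
move=> t1; rewrite (@derive1n_local [set t : R | t < -1] _ (fun=> 0) k t) //.
- elim: k {t1} t => // k IH t.
  by rewrite derive1nSr (_ : derive1 _ = fun=> 0)//; apply/funext => s; rewrite derive1_cst.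

- by move=> s /= s1; rewrite /Phi step_le ?mul0r// ltW.
Qed.

(** To the right of 1 the function [Phi n] is a polynomial of degree n, which n + 1 derivatives
    annihilate; to the left of -1 it is 0. *)
Lemma rho1_supp n t : 1 < `|t| -> rho1 n t = 0.
Proof.
rewrite ltr_normr => /orP[t1|t1]; last by apply: Phi_ltN1; lra.
rewrite /rho1 Phi_gt1// derive1nS -{2}[n]addn0 derive1n_powf powf0.
by rewrite derive1_cst.
Qed.

Lemma kap_supp n t : 1 < `|t| -> kap n t = 0.
Proof.
rewrite /kap ltr_normr => /orP[t1|t1].
  by rewrite !step_ge ?subrr ?mul0r//; lra.
by rewrite !step_le ?subrr ?mul0r//; lra.
Qed.

Lemma bounded_supp1 a : continuous a -> (forall t, 1 < `|t| -> a t = 0) ->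
  exists2 M, 1 <= M & forall t, `|a t| <= M.
Proof.
move=> ca a0.
have /compact_bounded[M [_ aM]] : compact (a @` `[-1, 1]%classic).
  by apply: continuous_compact; [exact: continuous_subspaceT|exact: segment_compact].
exists (`|M| + 1) => [|t]; first by rewrite lerDr.
have [t1|t1] := ltP 1 `|t|; first by rewrite a0// normr0 addr_ge0.
apply: aM; first by rewrite (le_lt_trans (ler_norm _))// ltrDl.
by exists t => //=; rewrite in_itv/= -ler_norml.
Qed.

Lemma step_derive_gt0 : exists t : R, 0 < derive1 (@step R) t.
Proof.
have [t _] := MVT_R (-1 : R) 1 (fun t => smooth1_is_derive t (@smooth1_step R)).
rewrite step_ge// step_le// subr0 => E; exists t.
rewrite lt_def step_derive_ge0 andbT; apply/eqP => t0; move: E; rewrite t0 mul0r.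
by move/eqP; rewrite oner_eq0.
Qed.

End mollifier1.

(** * The mollifiers and their dyadic increments *)

Section mollifier.
Context (R : realType) (d : nat).
Local Notation Rd := 'rV[R]_d.
Local Notation mu := (@leb_row R d).
Implicit Types (a b : R -> R) (g psi : Rd -> R).

(** The intervals of radius e j = 2 C 2^-j around u j are nested, since the increments are at most C
    2^-j = e j - e j.+1; the limit is the supremum of their left ends, which gives the rate at
    once. *)
Lemma geometric_limit (u : nat -> R) (C : R) :
  (forall j, `|u j.+1 - u j| <= C * 2 ^- j) ->
  exists l, forall j, `|l - u j| <= 2 * C * 2 ^- j.
Proof.
move=> uC.
have C0 : 0 <= C by have := le_trans (normr_ge0 _) (uC 0%N); rewrite expr0 invr1 mulr1.
have [e eE] : exists e : nat -> R, forall j, e j = 2 * C * 2 ^- j by exists (fun j => 2 * C * 2 ^- j).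
have e0 j : 0 <= e j by rewrite eE !mulr_ge0// invr_ge0 exprn_ge0.
have eS j : e j = 2 * e j.+1 by rewrite !eE exprS invfM; field; rewrite expf_neq0.
have {}uC j : `|u j.+1 - u j| <= e j.+1.
  by rewrite (le_trans (uC j))// eE exprS invfM (_ : 2 * C * _ = C * 2 ^- j)//; field; rewrite expf_neq0.
suff [l lu] : exists l, forall j, `|l - u j| <= e j by exists l => j; rewrite -eE.
pose lo j := u j - e j; pose hi j := u j + e j.
have los j : lo j <= lo j.+1.
  by rewrite /lo eS; have := uC j; rewrite ler_norml; lra.
have his j : hi j.+1 <= hi j.
  by rewrite /hi (eS j); have := uC j; rewrite ler_norml; lra.
have lohi j : lo j <= hi j by rewrite /lo /hi; have := e0 j; lra.
have nlo : {homo lo : m n / (m <= n)%N >-> m <= n} by apply: homo_leq => //; exact: le_trans.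
have nhi : {homo hi : m n / (m <= n)%N >-> n <= m}.
  by apply: (@homo_leq _ _ (fun x y => y <= x)) => // y x z xy yz; exact: le_trans yz xy.
have lh i j : lo i <= hi j.
  apply: (@le_trans _ _ (lo (maxn i j))); first by apply: nlo; exact: leq_maxl.
  by apply: le_trans (lohi _) _; apply: nhi; exact: leq_maxr.
pose S := [set x | exists j, x = lo j].
have S0 : S !=set0 by exists (lo 0%N); exists 0%N.
have Sub : has_ubound S by exists (hi 0%N) => _ [j ->].
exists (sup S) => j.
have h1 : lo j <= sup S by apply: ub_le_sup => //; exists j.
have h2 : sup S <= hi j by apply: ge_sup => // _ [i ->].
by move: h1 h2; rewrite /lo /hi ler_norml; lra.
Qed.

(** The dilation that preserves the integral; the summand 0 matches the affine form of
    [derive1n_affine]. *)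
Definition dil (j : nat) a t : R := 2 ^+ j * a (2 ^+ j * t + 0).

Lemma smooth1_dil j a : smooth1 a -> smooth1 (dil j a).
Proof. by move=> sa; apply: smooth1M; [exact: smooth1_cst|exact: smooth1_affine]. Qed.

Lemma pow2_ge1 j : 1 <= 2 ^+ j :> R.
Proof. by rewrite exprn_ege1// ler1n. Qed.

Lemma dil_supp j a t : (forall s, 1 < `|s| -> a s = 0) -> 1 < 2 ^+ j * `|t| -> dil j a t = 0.
Proof.
move=> a0 t1; rewrite /dil a0 ?mulr0// addr0 normrM ger0_norm// exprn_ge0//.
Qed.

Lemma dil_supp1 j a t : (forall s, 1 < `|s| -> a s = 0) -> 1 < `|t| -> dil j a t = 0.
Proof.
move=> a0 t1; apply: dil_supp => //; apply: (lt_le_trans t1).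
by rewrite ler_peMl// pow2_ge1.
Qed.

(** The parameter d makes the increments derivatives of order d + 1, one more than is needed to
    compensate the height of order 2^(j d). *)
Definition moll j : Rd -> R := tens (fun _ => dil j (rho1 d)).

Lemma moll_smooth j : smooth_real (moll j).
Proof. by apply: tens_smooth => l; apply: smooth1_dil; exact: smooth1_rho1. Qed.

Lemma moll_supp j : supp_in 1 (moll j).
Proof.
by apply: supp_in_tens => // _ t; apply: dil_supp1 => s; exact: rho1_supp.
Qed.

(** The i-th term of the telescoping sum from scale j to scale j + 1, before its derivatives: the
    variables before i are already at the finer scale, those after i still at the coarser one. *)
Definition mollA j (i : 'I_d) : 'I_d -> R -> R := fun l =>
  if (l < i)%N then dil j.+1 (rho1 d) else
  if l == i then dil j (kap d) else dil j (rho1 d).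

Lemma mollA_smooth j i l : smooth1 (mollA j i l).
Proof.
rewrite /mollA; case: ifP => _; first by apply: smooth1_dil; exact: smooth1_rho1.
by case: ifP => _; apply: smooth1_dil; [exact: smooth1_kap|exact: smooth1_rho1].
Qed.

Lemma mollA_supp j i : supp_in 1 (tens (mollA j i)).
Proof.
apply: supp_in_tens => // l t; rewrite /mollA.
case: ifP => _; first by apply: dil_supp1 => s; exact: rho1_supp.
by case: ifP => _; apply: dil_supp1 => s; [exact: kap_supp|exact: rho1_supp].
Qed.

Lemma tens_telescope (a b : 'I_d -> R -> R) (x : Rd) :
  tens a x - tens b x = \sum_(i < d) tens (fun l : 'I_d =>
    if (l < i)%N then a l else if l == i then (fun t => a l t - b l t) else b l) x.
Proof.
pose T k := \prod_(l < d) (if (l < k)%N then a l (x 0 l) else b l (x 0 l)).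
have -> : tens a x - tens b x = T d - T 0%N.
  congr (_ - _); apply: eq_bigr => l _; by rewrite ?ltn_ord.
rewrite -telescope_sumr// big_mkord; apply: eq_bigr => i _.
rewrite /T /tens (bigD1 i)//= ltnSn [X in _ - X](bigD1 i)//= ltnn.
rewrite [in RHS](bigD1 i)//= ltnn eqxx mulrBl; congr (_ * _ - _ * _).
  by apply: eq_bigr => l li; rewrite ltnS leq_eqVlt val_eqE !(negbTE li)/=; case: ifP.
by apply: eq_bigr => l li; rewrite (negbTE li); case: ifP.
Qed.

Lemma moll_step j x : moll j.+1 x - moll j x =
  \sum_i 2 ^- (j * d.+1) * partials (nseq d.+1 i) (tens (mollA j i)) x.
Proof.
rewrite tens_telescope; apply: eq_bigr => i _.
rewrite partials_tens; last exact: mollA_smooth.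
rewrite tens_upd (tensE _ i) ltnn eqxx mulrA; congr (_ * _); last first.
  by apply: eq_bigr => l li; rewrite /mollA (negbTE li).
rewrite {1}/mollA ltnn eqxx /dil.
rewrite derive1n_scale; last by apply: smooth1_affine; exact: smooth1_kap.
rewrite (derive1n_affine d.+1 (2 ^+ j) 0 (@smooth1_kap R d)) !addr0 -rho1_scale exprM.
rewrite [in LHS]exprS -!mulrA [2 * (2 ^+ j * x 0 i)]mulrA.
have : (2 ^+ j : R) ^+ d.+1 != 0 by rewrite !expf_neq0.
by rewrite -mulrA; move: (_ ^+ d.+1) => z z0; field.
Qed.

Lemma moll_bound : exists2 K, 1 <= K & forall j x,
  `|moll j x| <= (2 ^+ j * K) ^+ d /\
  forall i, `|tens (mollA j i) x| <= (2 ^+ j * K) ^+ d.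
Proof.
have [K1 K11 HK1] := bounded_supp1 (smooth1_continuous (@smooth1_rho1 R d)) (@rho1_supp R d).
have [K2 K21 HK2] := bounded_supp1 (smooth1_continuous (@smooth1_kap R d)) (@kap_supp R d).
(* K1 and K2 bound [rho1 d] and [kap d]; the factor 2 absorbs the scale j + 1 that occurs in
   [mollA]. *)
exists (2 * K1 + K2) => [|j x]; first lra.
have pj := pow2_ge1 j.
have bnd (a : R -> R) M : (forall t, `|a t| <= M) -> M <= 2 * K1 + K2 ->
    forall t, `|dil j a t| <= 2 ^+ j * (2 * K1 + K2).
  move=> aM MK t; rewrite normrM ger0_norm ?exprn_ge0// ler_wpM2l ?exprn_ge0//.
  exact: le_trans (aM _) MK.
have prd (a : 'I_d -> R -> R) : (forall l t, `|a l t| <= 2 ^+ j * (2 * K1 + K2)) ->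
    `|tens a x| <= (2 ^+ j * (2 * K1 + K2)) ^+ d.
  move=> aM; rewrite /tens normr_prod -[X in _ ^+ X]card_ord -prodr_const.
  by apply: ler_prod => l _; rewrite normr_ge0 aM.
split => [|i]; apply: prd => l t; first by apply: (bnd _ K1) => //; lra.
rewrite /mollA; case: ifP => _; last by case: ifP => _; [apply: (bnd _ K2) => //|apply: (bnd _ K1) => //]; lra.
rewrite normrM ger0_norm ?exprn_ge0// exprS mulrAC mulrC ler_wpM2l ?exprn_ge0//.
by have := HK1 (2 * 2 ^+ j * t + 0); lra.
Qed.

End mollifier.

(** * Convergence of the mollifications with all derivatives *)

Section regularity.
Context (R : realType) (d : nat).
Local Notation Rd := 'rV[R]_d.
Local Notation mu := (@leb_row R d).
Implicit Types (g psi : Rd -> R).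

Let norm_near (w v u a b : R) : `|w - v| <= 2 * b -> `|w - u| <= 2 * b -> `|u| <= a ->
  `|v| <= a + 4 * b.
Proof. by rewrite !ler_norml => /andP[? ?] /andP[? ?] /andP[? ?]; apply/andP; split; lra. Qed.

Let norm_limit (wh w l vh v l' : R) : wh - w - l - (vh - v - l') = wh - vh - (w - v) - (l - l').
Proof. ring. Qed.

Lemma locnorm_homo g (r r' : R) : rL1loc g -> r <= r' -> locnorm g r <= locnorm g r'.
Proof.
move=> [mg ig] rr; apply: le_lint; [exact/lintegrable_norm/ig|exact/lintegrable_norm/ig|].
move=> x; rewrite !normrM ler_wpM2l// !indic_cube_norm; apply: indic_sub => y /= yr.
exact: le_trans yr rr.
Qed.

Lemma corr_bound g psi (M r : R) x : rL1loc g -> continuous psi -> supp_in r psi ->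
  (forall y, `|psi y| <= M) -> `|corr g psi x| <= M * locnorm g (r + `|x|).
Proof.
move=> lg cp up pM.
have h := @supp_in_translate _ _ r psi (- x) up; rewrite normrN in h.
apply: (rL1loc_bound lg _ _).2.
  exact/continuous_lmeasurable/continuous_translate.
move=> y; rewrite indicE; case: (asboolP (cube (r + `|x|) y)) => yr.
  by rewrite mem_set// mulr1; exact: pM.
by rewrite memNset// mulr0 h// normr0.
Qed.

(** [G s] plays the role of the derivative of [G [::]] along the word s, which grows on the right;
    only integration by parts against test functions is known about it. *)
Variable G : seq 'I_d -> Rd -> R.
Hypothesis GL : forall s, rL1loc (G s).
Hypothesis GD : forall s i psi r, smooth_real psi -> supp_in r psi ->
  \int[mu]_x (G s x * partial i psi x) = - \int[mu]_x (G (rcons s i) x * psi x).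

Let GDs s t psi r : smooth_real psi -> supp_in r psi ->
  \int[mu]_x (G s x * partials t psi x) =
  (-1) ^+ size t * \int[mu]_x (G (s ++ t) x * psi x).
Proof.
move=> sp up; elim: t s => [|i t IH] s; first by rewrite cats0 mul1r.
rewrite /= (GD s i (smooth_partials t sp) (supp_in_partials t up)) IH.
by rewrite cat_rcons exprS mulN1r mulNr.
Qed.

Let corr_G s t psi r x : smooth_real psi -> supp_in r psi ->
  corr (G s) (partials t psi) x = (-1) ^+ size t * corr (G (s ++ t)) psi x.
Proof.
move=> sp up; have := GDs s t (smooth_translate (- x) sp) (@supp_in_translate _ _ r psi (- x) up).
by move=> <-; apply: eq_Rintegral => y _; rewrite partials_translate.
Qed.

Let V s j := corr (G s) (moll j).

Let V_diff s j x : differentiable (V s j) x /\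
  forall i, partial i (V s j) x = V (rcons s i) j x.
Proof.
have [h1 h2] := corr_diff x (GL s) (@moll_smooth R d j) (@moll_supp R d j).
split => // i; rewrite h2 (corr_G s [:: i] x (@moll_smooth R d j) (@moll_supp R d j)).
by rewrite /= expr1 mulN1r opprK cats1.
Qed.

Let V_derivable s j i x : derivable (V s j) x (delta_mx 0 i).
Proof. by apply: diff_derivable; exact: (V_diff s j x).1. Qed.

Let K := sval (cid2 (@moll_bound R d)).
Let K1 : 1 <= K. Proof. by rewrite /K; case: cid2. Qed.
Let KP j (x : Rd) : `|moll j x| <= (2 ^+ j * K) ^+ d /\
  forall i, `|tens (mollA j i) x| <= (2 ^+ j * K) ^+ d.
Proof. by rewrite /K; case: cid2. Qed.

Let C s r := K ^+ d * \sum_(i < d) locnorm (G (s ++ nseq d.+1 i)) (1 + r).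

Let V_step s j x : `|V s j.+1 x - V s j x| <= C s `|x| * 2 ^- j.
Proof.
have It (psi : Rd -> R) r : smooth_real psi -> supp_in r psi ->
    lintegrable (fun y => G s y * psi (y - x)).
  move=> sp up; exact: (rL1loc_test (GL s) (continuous_translate (a := - x) (smooth_continuous sp))
    (@supp_in_translate _ _ r psi (- x) up)).
have sA i := @tens_smooth _ _ _ (@mollA_smooth R d j i).
have uA i := @mollA_supp R d j i.
have -> : V s j.+1 x - V s j x = \sum_(i < d) 2 ^- (j * d.+1) *
    corr (G s) (partials (nseq d.+1 i) (tens (mollA j i))) x.
  have Ii i : lintegrable (fun y => G s y * partials (nseq d.+1 i) (tens (mollA j i)) (y - x)).
    by apply: (It _ 1); [exact: smooth_partials|exact: supp_in_partials].
  rewrite /V /corr -(lintegrableB (It _ _ (@moll_smooth R d j.+1) (@moll_supp R d j.+1))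
    (It _ _ (@moll_smooth R d j) (@moll_supp R d j))).2.
  have := lintegrable_sum (index_enum 'I_d) (fun i => (lintegrableZ (2 ^- (j * d.+1)) (Ii i)).1).
  move=> [_ E]; rewrite (eq_bigr _ (fun i _ => esym (lintegrableZ (2 ^- (j * d.+1)) (Ii i)).2)) -E.
  apply: eq_Rintegral => y _; rewrite -mulrBr moll_step mulr_sumr.
  by apply: eq_bigr => i _; rewrite mulrCA.
rewrite (le_trans (ler_norm_sum _ _ _))// /C mulrAC mulr_sumr ler_sum// => i _.
rewrite (corr_G s (nseq d.+1 i) x (sA i) (uA i)).
have p0 : 0 <= 2 ^- (j * d.+1) :> R by rewrite invr_ge0 exprn_ge0.
rewrite normrM (ger0_norm p0) normrMsign.
rewrite (le_trans (ler_wpM2l _ (corr_bound x (GL _) (smooth_continuous (sA i)) (uA i)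
  (fun y => (KP j y).2 i))))//.
rewrite mulrA ler_wpM2r ?locnorm_ge0//.
rewrite (_ : 2 ^- (j * d.+1) * (2 ^+ j * K) ^+ d = K ^+ d * 2 ^- j)//.
by rewrite mulnS exprD exprMn -exprM; field; rewrite !expf_neq0.
Qed.

Let C_homo s r r' : r <= r' -> C s r <= C s r'.
Proof.
move=> rr; rewrite ler_wpM2l//; first by rewrite exprn_ge0// (le_trans _ K1).
by apply: ler_sum => i _; apply: locnorm_homo => //; rewrite lerD2l.
Qed.

Let C_ge0 s r : 0 <= C s r.
Proof.
rewrite mulr_ge0//; first by rewrite exprn_ge0// (le_trans _ K1).
by apply: sumr_ge0 => i _; exact: locnorm_ge0.
Qed.

Let W s x := sval (cid (geometric_limit (V_step s ^~ x))).

Let WV s j x : `|W s x - V s j x| <= 2 * C s `|x| * 2 ^- j.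
Proof. by rewrite /W; case: cid => l /= ->. Qed.

Let cvg0 (D : R) : 0 <= D -> (forall e, 0 < e -> exists j : nat, D * 2 ^- j < e).
Proof.
move=> D0 e e0; exists (Num.truncn (D / e)).+1.
rewrite ltr_pdivrMr ?exprn_gt0// mulrC -ltr_pdivrMr//.
apply: (lt_le_trans (truncnS_gt _)).
by rewrite -natrX ler_nat ltnW// ltn_expl.
Qed.

Let B s r := (2 ^+ 0 * K) ^+ d * locnorm (G s) (1 + r) + 4 * C s r.

Let V_bound s j x r : `|x| <= r -> `|V s j x| <= B s r.
Proof.
move=> xr; have h j' : `|W s x - V s j' x| <= 2 * C s r.
  rewrite (le_trans (WV _ _ _))// (le_trans (ler_piMr _ _))//.
  - by rewrite mulr_ge0.
  - by rewrite invf_le1 ?exprn_gt0// pow2_ge1.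
  - by rewrite ler_wpM2l// C_homo.
have h0 : `|V s 0 x| <= (2 ^+ 0 * K) ^+ d * locnorm (G s) (1 + r).
  rewrite (le_trans (corr_bound x (GL s) (smooth_continuous (@moll_smooth R d 0)) (@moll_supp R d 0) (fun y => (KP 0 y).1)))//.
  rewrite ler_wpM2l//; first by rewrite exprn_ge0// mulr_ge0// (le_trans _ K1).
  by apply: locnorm_homo => //; rewrite lerD2l.
exact: norm_near (h j) (h 0%N) h0.
Qed.

(** The expansions of [V s j] at x have a remainder LL |h|^2 independent of j, since their second
    derivatives are again mollifications, bounded uniformly in j by [V_bound]. For fixed h, letting
    j tend to infinity yields the same expansion for [W s]. *)
Let W_diff s x : differentiable (W s) x /\
  forall i, partial i (W s) x = W (rcons s i) x.
Proof.
pose r := `|x| + 1.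
pose L i := d%:R * \sum_k B (rcons (rcons s i) k) r.
have xr : `|x| <= r by rewrite /r lerDl.
have B0 t : 0 <= B t r := le_trans (normr_ge0 _) (V_bound t 0 xr).
have lip i j y : `|y - x| <= 1 -> `|V (rcons s i) j y - V (rcons s i) j x| <= L i * `|y - x|.
  move=> yx.
  have := @row_MVT _ _ (V (rcons s i) j) x (y - x) (fun=> 0) (\sum_k B (rcons (rcons s i) k) r)
    (fun k z => @V_derivable (rcons s i) j k z).
  rewrite [\sum_i _ * _]big1 ?subr0; last by move=> k _; rewrite mul0r.
  rewrite (addrC x) subrK; apply => k z zx; rewrite subr0 (V_diff _ _ _).2.
  have zr : `|z| <= r.
    by rewrite -[z](subrK x) (le_trans (ler_normD _ _))// addrC lerD2l (le_trans zx).
  rewrite (le_trans (V_bound _ _ zr))// (bigD1 k)//= lerDl.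
  by apply: sumr_ge0.
pose LL := d%:R * \sum_i L i.
have L0 i : 0 <= L i by rewrite mulr_ge0// sumr_ge0.
have key h : `|h| <= 1 ->
    `|W s (x + h) - W s x - \sum_i W (rcons s i) x * h 0 i| <= LL * `|h| ^+ 2.
  move=> h1.
  have keyj j : `|V s j (x + h) - V s j x - \sum_i V (rcons s i) j x * h 0 i| <= LL * `|h| ^+ 2.
    have := @row_MVT _ _ (V s j) x h (fun i => V (rcons s i) j x) ((\sum_i L i) * `|h|)
      (fun k z => @V_derivable s j k z).
    rewrite /LL expr2 !mulrA; apply => i y yx.
    rewrite (V_diff _ _ _).2 (le_trans (lip i j y (le_trans yx h1)))//.
    rewrite ler_pM ?L0 ?normr_ge0//.
    by rewrite (bigD1 i)//= lerDl sumr_ge0.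
  (* D 2^-j bounds the error of replacing every W in the expansion by its mollification V at stage
     j. *)
  pose D := 2 * C s `|x + h| + 2 * C s `|x| + \sum_i 2 * C (rcons s i) `|x| * `|h 0 i|.
  have D0 : 0 <= D.
    have C2 t z : 0 <= 2 * C t z by rewrite mulr_ge0.
    by rewrite /D !addr_ge0// sumr_ge0// => i _; rewrite mulr_ge0.
  apply/ler_addgt0Pr => e e0; have [j je] := cvg0 D0 e0.
  rewrite -lerBlDr; apply: le_trans (keyj j); rewrite lerBlDr.
  rewrite -lerBlDl; apply: (le_trans (lerB_dist _ _)).
  apply: le_trans (ltW je).
  rewrite /D (mulrDl _ _ (2 ^- j)) (mulrDl _ _ (2 ^- j)) mulr_suml.
  rewrite norm_limit -sumrB.
  rewrite (eq_bigr (fun i => (W (rcons s i) x - V (rcons s i) j x) * h 0 i)); last first.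
    by move=> i _; rewrite mulrBl.
  rewrite (le_trans (ler_normB _ _))// lerD//.
    rewrite (le_trans (ler_normB _ _))//. apply: lerD; exact: WV.
  rewrite (le_trans (ler_norm_sum _ _ _))// ler_sum// => i _.
  by rewrite normrM mulrAC ler_wpM2r// WV.
have LL0 : 0 <= LL by rewrite mulr_ge0// sumr_ge0.
apply: differentiable_approx => e e0.
have eL : 0 < e / (LL + 1) by rewrite divr_gt0// ltr_wpDl.
near=> h.
have h1 : `|h| <= 1 by near: h; exact: row_near0.
have : `|h| <= e / (LL + 1) by near: h; exact: row_near0.
rewrite ler_pdivlMr ?ltr_wpDl// => he.
rewrite (le_trans (key h h1))// expr2 mulrA ler_wpM2r// (le_trans _ he)//.
by rewrite mulrC ler_wpM2l// lerDl.
Unshelve. all: by end_near. Qed.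

(** [partials] applies the last letter first, while the words of G grow on the right, hence the
    reversal. *)
Let W_partials s t x : partials t (W s) x = W (s ++ rev t) x.
Proof.
elim: t x => [|i t IH] x; first by rewrite cats0.
rewrite rev_cons -rcons_cat -(W_diff _ _).2 /=; congr (partial i _ x).
by apply/funext => y; exact: IH.
Qed.

Lemma family_limit : exists f, smooth_real f /\
  exists2 C, (forall r, 0 <= C r) & forall j r x, `|x| <= r ->
    `|f x - corr (G [::]) (moll j) x| <= C r * 2 ^- j.
Proof.
exists (W [::]); split.
  move=> t x; rewrite (_ : partials t _ = W (rev t)); first exact: (W_diff _ _).1.
  by apply/funext => y; rewrite W_partials.
exists (fun r => 2 * C [::] r) => [r|j r x xr]; first by rewrite mulr_ge0.
rewrite (le_trans (WV _ _ _))// ler_wpM2r ?invr_ge0 ?exprn_ge0// ler_wpM2l//.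
exact: C_homo.
Qed.

End regularity.

(** * The integral of the mollifiers *)

Section mollifier_mass.
Context (R : realType) (d : nat).
Local Notation Rd := 'rV[R]_d.
Local Notation mu := (@leb_row R d).
Implicit Types (a b k : R -> R).

Let supp1 a := forall t, 1 < `|t| -> a t = 0.

Lemma derive1n_powf_diag n : derive1n n (@powf R n) = fun=> 1.
Proof. by rewrite -{2}[n]addn0 derive1n_powf powf0. Qed.

Lemma derive1_local (U : set R) a b t : open U ->
  (forall s, U s -> a s = b s) -> U t -> derive1 a t = derive1 b t.
Proof. exact: (@derive1n_local _ U a b 1%N t). Qed.

Lemma test_lintegrable (psi : Rd -> R) r : continuous psi -> supp_in r psi -> lintegrable psi.
Proof.
move=> cp up; have [M M0 pM] := supp_in_bounded cp up.
exact: (lintegrable_bounded (continuous_lmeasurable cp) pM).1.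
Qed.

(** The two tensors differ by the i-th partial derivative of a compactly supported smooth function,
    which has integral 0. Integrals of tensors are thus compared without being computed. *)
Lemma lint_tens_replace (a : 'I_d -> R -> R) i b k :
  (forall l, smooth1 (a l) /\ supp1 (a l)) -> smooth1 b -> supp1 b ->
  smooth1 k -> supp1 k -> (forall t, a i t - b t = derive1 k t) ->
  \int[mu]_x tens a x = \int[mu]_x tens (upd a i b) x.
Proof.
move=> sa sb ub sk uk E.
have I (c : 'I_d -> R -> R) : (forall l, smooth1 (c l) /\ supp1 (c l)) -> lintegrable (tens c).
  move=> sc; apply: (@test_lintegrable _ 1).
    by apply: smooth_continuous; apply: tens_smooth => l; exact: (sc l).1.
  by apply: supp_in_tens => // l t; exact: (sc l).2.
have su c : smooth1 c -> supp1 c -> forall l, smooth1 (upd a i c l) /\ supp1 (upd a i c l).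
  by move=> sc uc l; rewrite /upd; case: ifP.
apply/eqP; rewrite -subr_eq0 -(lintegrableB (I _ sa) (I _ (su _ sb ub))).2; apply/eqP.
have sp : smooth_real (tens (upd a i k)) by apply: tens_smooth => l; exact: (su _ sk uk l).1.
have up : supp_in 1 (tens (upd a i k)) by apply: supp_in_tens => // l t; exact: (su _ sk uk l).2.
rewrite -[RHS](lint_partial0 i sp up); apply: eq_Rintegral => x _.
rewrite partial_tens; last by move=> l; exact: (su _ sk uk l).1.
have -> : upd a i k i = k by rewrite /upd eqxx.
by rewrite updK !tens_upd (tensE a i) -mulrBl E.
Qed.

Lemma lint_tens_replace_all a b k : smooth1 a -> supp1 a -> smooth1 b -> supp1 b ->
  smooth1 k -> supp1 k -> (forall t, a t - b t = derive1 k t) ->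
  \int[mu]_x tens (fun _ : 'I_d => a) x = \int[mu]_x tens (fun _ : 'I_d => b) x.
Proof.
move=> sa ua sb ub sk uk E.
pose T n := fun l : 'I_d => if (l < n)%N then b else a.
have -> : (fun _ : 'I_d => a) = T 0%N by apply/funext.
have -> : (fun _ : 'I_d => b) = T d by apply/funext => l; rewrite /T ltn_ord.
suff H n : (n <= d)%N -> \int[mu]_x tens (T 0%N) x = \int[mu]_x tens (T n) x by exact: H.
elim: n => // n IH nd.
rewrite (IH (ltnW nd)) (@lint_tens_replace (T n) (Ordinal nd) b k)//.
- congr (Rintegral _ _ (tens _)); apply/funext => l.
  rewrite /upd /T -val_eqE/= ltnS [in RHS]leq_eqVlt.
  by case: (nat_of_ord l == n).
- by move=> l; rewrite /T; case: ifP.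
- by move=> t; rewrite /T /= ltnn.
Qed.

(** The common integral of the reflected mollifiers. Its value is never computed: positivity is
    enough to divide by it in [family_smooth], and positivity is visible on the nonnegative
    derivative of [step], not on [rho1]. *)
Definition mass : R := \int[mu]_x tens (fun _ t => derive1 (@step R) (-1 * t + 0)) x.

(** The d-th derivative [D] of [Phi d] is a primitive of [rho1 d] that, like [step], equals 0 on the
    far left and 1 on the far right. Hence the reflected primitives of both, at any scale, differ by
    a compactly supported function, and [lint_tens_replace] exchanges the factors one by one. *)
Lemma moll_mass j : \int[mu]_x moll j (- x) = mass.
Proof.
have -> : (fun x : Rd => moll j (- x)) = tens (fun _ t => dil j (rho1 d) (-1 * t + 0)).
  apply/funext => x; apply: eq_bigr => l _.
  by rewrite mxE mulN1r addr0.
pose D := derive1n d (@Phi R d).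
have sD : smooth1 D by apply: smooth1_derive1n; exact: smooth1_Phi.
have s0 : smooth1 (@step R) := @smooth1_step R.
have Ngt (t : R) : 1 < `|t| -> 1 < `|-1 * t + 0| by rewrite addr0 mulN1r normrN.
apply: (@lint_tens_replace_all _ _ (fun t => -1 * D (- 2 ^+ j * t + 0) + step (-1 * t + 0))).
- by apply: smooth1_affine; apply: smooth1_dil; exact: smooth1_rho1.
- by move=> t /Ngt; apply: dil_supp1 => s; exact: rho1_supp.
- by apply: smooth1_affine; exact: smooth1_derive1.
- move=> t /Ngt; rewrite ltr_normr => /orP[t1|t1].
    rewrite (@derive1_local [set s : R | 1 < s] _ (fun=> 1)) ?derive1_cst// => s /= s1.
    by rewrite step_ge// ltW.
  rewrite (@derive1_local [set s : R | s < -1] _ (fun=> 0)) ?derive1_cst//=; last lra.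
  by move=> s s1; rewrite step_le// ltW.
- apply: smooth1D; last exact: smooth1_affine.
  by apply: smooth1M; [exact: smooth1_cst|exact: smooth1_affine].
- move=> t; have p1 := @pow2_ge1 R j; rewrite ltr_normr addr0 => /orP[t1|t1].
    have ht : 2 ^+ j * 1 < 2 ^+ j * t by rewrite ltr_pM2l// exprn_gt0.
    rewrite /D Phi_ltN1 ?step_le ?mulr0 ?addr0//; [lra|].
    rewrite mulNr; lra.
  have ht : 2 ^+ j * 1 < 2 ^+ j * - t by rewrite ltr_pM2l// exprn_gt0.
  rewrite /D Phi_gt1; last by rewrite mulNr; lra.
  rewrite derive1n_powf_diag step_ge; last lra.
  by rewrite mulr1 addNr.
- move=> t; rewrite -[RHS]/(derive1n 1 (fun t => -1 * D (- 2 ^+ j * t + 0) + step (-1 * t + 0)) t).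
  have sDj : smooth1 (fun t => D (- 2 ^+ j * t + 0)) by exact: smooth1_affine.
  rewrite (derive1n_add 1 (smooth1M (@smooth1_cst R (-1)) sDj) (smooth1_affine (-1) 0 s0)).
  rewrite (derive1n_scale 1 (-1) sDj) (derive1n_affine 1 _ 0 sD) (derive1n_affine 1 _ 0 s0).
  by rewrite !expr1 /dil !addr0 !mulN1r !mulNr !mulrN opprK.
Qed.

Lemma lint_gt0 (f : Rd -> R) x0 : continuous f -> lintegrable f ->
  (forall x, 0 <= f x) -> 0 < f x0 -> 0 < \int[mu]_x f x.
Proof.
move=> cf If f0 fx0.
have h2 : 0 < f x0 / 2 by rewrite divr_gt0.
have := cf x0; move=> /cvgr_dist_le/(_ _ h2)/nbhs_ballP[e /= e0 fe].
pose A := obox (fun i => x0 0 i - e) (fun i => x0 0 i + e).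
have mA : measurable A by exact: measurable_obox.
have IA : lintegrable (\1_A : Rd -> R).
  split; first exact: lmeasurable_indic.
  under eq_integral do rewrite ger0_norm//.
  by rewrite integral_indic// setIT leb_row_obox_lty.
have muAE : mu A = (\prod_(i < d) (e + e))%:E.
  rewrite /A leb_row_obox; last by move=> i; lra.
  by congr EFin; apply: eq_bigr => i _; lra.
have muA : \int[mu]_x (\1_A x : R) = \prod_(i < d) (e + e).
  by rewrite /Rintegral integral_indic// setIT; exact: (congr1 fine muAE).
apply: (@lt_le_trans _ _ (f x0 / 2 * \int[mu]_x (\1_A x : R))).
  by rewrite mulr_gt0// muA prodr_gt0// => i _; lra.
rewrite -(lintegrableZ _ IA).2; apply: le_lint => //; first exact: (lintegrableZ _ IA).1.
move=> x; rewrite indicE; case: (asboolP (A x)) => Ax; last by rewrite memNset// mulr0.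
rewrite mem_set// mulr1; have := fe x; rewrite row_ballE// => /(_ Ax).
by rewrite ler_norml; lra.
Qed.

Lemma mass_gt0 : 0 < mass.
Proof.
have [t t0] := @step_derive_gt0 R.
have s1 : smooth1 (fun t => derive1 (@step R) (-1 * t + 0)).
  by apply: smooth1_affine; apply: smooth1_derive1; exact: smooth1_step.
have u1 : supp1 (derive1 (@step R) \o (fun t => -1 * t + 0)).
  move=> s s1'; have : 1 < `|-1 * s + 0| by rewrite addr0 mulN1r normrN.
  rewrite ltr_normr /= => /orP[h|h].
    rewrite (@derive1_local [set s : R | 1 < s] _ (fun=> 1)) ?derive1_cst// => r /= r1.
    by rewrite step_ge// ltW.
  rewrite (@derive1_local [set s : R | s < -1] _ (fun=> 0)) ?derive1_cst//=; last lra.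
  by move=> r r1; rewrite step_le// ltW.
have ct : continuous (tens (fun (_ : 'I_d) t => derive1 (@step R) (-1 * t + 0))).
  by apply: smooth_continuous; apply: tens_smooth.
apply: (@lint_gt0 _ (const_mx (- t))) => //.
- by apply: (@test_lintegrable _ 1) => //; apply: supp_in_tens => // l s; exact: u1.
- by move=> x; apply: prodr_ge0 => l _; exact: step_derive_ge0.
- by apply: prodr_gt0 => l _; rewrite mxE addr0 mulN1r opprK.
Qed.

End mollifier_mass.

(** * Identification of the limit with the given function *)

Section identification.
Context (R : realType) (d : nat).
Local Notation Rd := 'rV[R]_d.
Local Notation mu := (@leb_row R d).
Implicit Types (f g phi psi : Rd -> R).

Lemma corr_fubini g phi psi r s : rL1loc g -> continuous phi -> supp_in s phi ->
  continuous psi -> supp_in r psi ->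
  \int[mu]_x (corr g phi x * psi x) =
  \int[mu]_y (g y * \int[mu]_x (phi (y - x) * psi x)).
Proof.
move=> lg cphi uphi cpsi upsi; have [[g' mg' gg'] ig] := lg.
have [M M0 phiM] := supp_in_bounded cphi uphi.
(* Fubini's theorem is applied to a Borel function on the product, hence to the representative of
   g. *)
pose F (z : Rd * Rd) := g' z.2 * phi (z.2 - z.1) * psi z.1.
have mF : measurable_fun setT F.
  apply: measurable_funM; first apply: measurable_funM.
  - exact: (measurableT_comp mg' measurable_snd).
  - apply: (measurableT_comp (continuous_measurable_row cphi) (f := phi)).
    apply: measurable_row => i.
    rewrite (_ : (fun t => _) = fun t : Rd * Rd => t.2 0 i - t.1 0 i); last first.
      by apply/funext => t; rewrite !mxE.
    exact: (measurable_funB (measurableT_comp (measurable_coord i) measurable_snd)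
      (measurableT_comp (measurable_coord i) measurable_fst)).
  - exact: (measurableT_comp (continuous_measurable_row cpsi) measurable_fst).
have psi0 : lintegrable psi := test_lintegrable cpsi upsi.
have [Mp Mp0 psiM] := supp_in_bounded cpsi upsi.
pose h y := `|g' y * \1_(cube (r + s)) y|.
have mh : measurable_fun setT h.
  apply: measurableT_comp; first exact: normr_measurable.
  apply: measurable_funM => //; apply: measurable_indic.
  by apply: compact_measurable_row; exact: cube_compact.
have Ih : (\int[mu]_y (h y)%:E < +oo)%E.
  have [_ +] := ig (r + s); apply: le_lt_trans; rewrite le_eqVlt; apply/orP; left; apply/eqP.
  by apply: integral_ae; apply: filterS gg' => y ->.
have Fh x y : `|F (x, y)| <= (M * `|psi x|) * h y.
  rewrite /F /h !normrM /= indic_cube_norm.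
  have [xr|xr] := pselect (cube r x); last by rewrite upsi// normr0 !(mulr0, mul0r).
  rewrite [leRHS](_ : _ = `|g' y| * (M * \1_(cube (r + s)) y) * `|psi x|); last by ring.
  rewrite ler_wpM2r// ler_wpM2l//.
  rewrite (le_trans (phiM _))// ler_wpM2l// !indicE.
  case: (asboolP (cube s (y - x))) => ys; last by rewrite memNset.
  rewrite !mem_set// /cube /= -[y](subrK x) addrC (le_trans (ler_normD _ _))// lerD//.
have mnF : measurable_fun setT (fun z => `|F z|%:E).
  by apply/measurable_EFinP; exact: (measurableT_comp (@normr_measurable R setT) mF).
have nF0 (z : Rd * Rd) : (0 <= `|F z|%:E)%E by rewrite lee_fin.
have mnpsi : measurable_fun setT (fun x => `|psi x|).
  exact: (measurableT_comp (@normr_measurable R setT) (continuous_measurable_row cpsi)).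
have mMp : measurable_fun setT (fun x => (M * `|psi x|)%:E).
  by apply/measurable_EFinP; exact: (measurable_funM (measurable_cst M) mnpsi).
have IF : (mu \x mu)%E.-integrable setT (EFin \o F).
  apply/integrable12ltyP; first exact/measurable_EFinP.
  apply: (@le_lt_trans _ _ (\int[mu]_x ((M * `|psi x|)%:E * \int[mu]_y (h y)%:E))%E).
    apply: ge0_le_integral => //=.
    - by move=> x _; apply: integral_ge0.
    - exact: (@measurable_fun_fubini_tonelli_F _ _ _ _ _ mu (fun z => `|F z|%:E) mnF nF0).
    - exact: (emeasurable_funM mMp (measurable_cst _)).
    - move=> x _; rewrite -ge0_integralZl//; last by rewrite lee_fin mulr_ge0.
      + apply: ge0_le_integral => //=.
        * exact: (measurableT_comp mnF (measurable_pair1 x)).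
        * by apply/measurable_EFinP; apply: measurable_funM.
        * by move=> y _; rewrite -EFinM lee_fin.
      + exact/measurable_EFinP.
      + by move=> y _; rewrite lee_fin /h.
  have h0 y : (0 <= (h y)%:E)%E by rewrite lee_fin /h.
  have p0 x : (0 <= (M * `|psi x|)%:E)%E by rewrite lee_fin mulr_ge0.
  rewrite ge0_integralZr//; last exact: integral_ge0.
  apply: lte_mul_pinfty; [exact: integral_ge0| |exact: Ih].
  have [_ +] := (lintegrableZ M (lintegrable_norm psi0)).1.
  rewrite ge0_fin_numE; last exact: integral_ge0.
  apply: le_lt_trans; rewrite le_eqVlt; apply/orP; left; apply/eqP.
  by apply: eq_integral => x _; rewrite [`|M * _|]ger0_norm// mulr_ge0.
have Iy x : lintegrable (fun y => g y * phi (y - x)).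
  exact: (rL1loc_test lg (continuous_translate (a := - x) cphi)
    (@supp_in_translate _ _ s phi (- x) uphi)).
have cpp (y : Rd) : continuous (fun x : Rd => phi (y - x) * psi x).
  move=> x; apply: (@continuousM _ _ (fun x : Rd => phi (y - x)) psi); last exact: cpsi.
  apply: (@continuous_comp Rd Rd R (fun x : Rd => y - x) phi); last exact: cphi.
  by apply: (@continuousB _ _ _ (fun _ : Rd => y) (fun x : Rd => x)); [exact: cst_continuous|exact: cvg_id].
have Ix (y : Rd) : lintegrable (fun x => phi (y - x) * psi x).
  by apply: (@test_lintegrable _ _ _ r) => //; exact: supp_inM.
have aeF (x : Rd) : {ae mu, forall y, g y * phi (y - x) * psi x = F (x, y)}.
  by apply: filterS gg' => y ->.
have E1 (x : Rd) : corr g phi x * psi x = \int[mu]_y F (x, y).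
  rewrite -(ae_Rintegral (aeF x)) mulrC -(lintegrableZ (psi x) (Iy x)).2.
  by apply: eq_Rintegral => y _; rewrite mulrC.
have E2 (y : Rd) : g' y * (\int[mu]_x (phi (y - x) * psi x)) = \int[mu]_x F (x, y).
  rewrite -(lintegrableZ (g' y) (Ix y)).2.
  by apply: eq_Rintegral => x _; rewrite mulrA.
have F1 (x : Rd) : (\int[mu]_y (F (x, y))%:E)%E \is a fin_num.
  apply: integrable_fin_num => //; apply/integrableP; split.
    by apply/measurable_EFinP; exact: (measurableT_comp mF (measurable_pair1 x)).
  have [_ +] := (lintegrableZ (psi x) (Iy x)).1.
  apply: le_lt_trans; rewrite le_eqVlt; apply/orP; left; apply/eqP; apply: integral_ae.
  by apply: filterS (aeF x) => y <-; rewrite /= mulrC.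
have F2 (y : Rd) : (\int[mu]_x (F (x, y))%:E)%E \is a fin_num.
  apply: integrable_fin_num => //; apply/integrableP; split.
    by apply/measurable_EFinP; exact: (measurableT_comp mF (measurable_pair2 y)).
  have [_ +] := (lintegrableZ (g' y) (Ix y)).1.
  apply: le_lt_trans; rewrite le_eqVlt; apply/orP; left; apply/eqP.
  by apply: eq_integral => x _; rewrite /= /F /= -mulrA.
rewrite (@ae_Rintegral _ _ (fun y => g y * _) (fun y => \int[mu]_x F (x, y))); last first.
  by apply: filterS gg' => y ->; exact: E2.
under eq_Rintegral do rewrite E1.
congr fine.
under eq_integral do rewrite /Rintegral fineK//.
under [RHS]eq_integral do rewrite /Rintegral fineK//.
exact: (Fubini IF).
Qed.

Lemma mollN_smooth j : smooth_real (fun x : Rd => moll j (- x)).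
Proof.
rewrite (_ : (fun x => _) = tens (fun _ t => dil j (rho1 d) (-1 * t + 0))).
  by apply: tens_smooth => l; apply: smooth1_affine; apply: smooth1_dil; exact: smooth1_rho1.
by apply/funext => x; apply: eq_bigr => l _; rewrite mxE mulN1r addr0.
Qed.

Lemma mollN_supp j : supp_in 1 (fun x : Rd => moll j (- x)).
Proof. by move=> x x1; apply: moll_supp; rewrite /cube /= normrN. Qed.

Lemma moll_supp_dil j : supp_in (2 ^- j) (@moll R d j).
Proof.
apply: supp_in_tens => [|_ t]; first by rewrite invr_ge0 exprn_ge0.
rewrite -[X in X < _]mulr1 ltr_pdivrMl ?exprn_gt0// => t1.
by apply: dil_supp t1 => s; exact: rho1_supp.
Qed.

(** The closed cube is enclosed in an open box of twice its size, hence 4 r in place of the side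
    length 2 r. *)
Lemma cube_measure_le (r : R) : 0 < r -> fine (mu (cube r)) <= (4 * r) ^+ d.
Proof.
move=> r0; have mc := compact_measurable_row (@cube_compact R d r).
rewrite -lee_fin fineK; last by rewrite ge0_fin_numE//; exact: cube_lty.
have -> : ((4 * r) ^+ d)%:E = mu (obox (fun=> - (2 * r)) (fun=> 2 * r)).
  rewrite leb_row_obox; last by move=> i; lra.
  rewrite prodr_const card_ord; congr (_ ^+ _)%:E; lra.
apply: le_measure; [exact/mem_set|apply/mem_set; exact: measurable_obox|].
move=> x xr i; rewrite -ltr_norml (le_lt_trans (coord_le_norm x i))//.
by rewrite (le_lt_trans xr)//; lra.
Qed.

(** The error is at most the height (2^j K)^d of the mollifier, times the oscillation L 2^-j of psi
    on its support, times the volume bound (4 2^-j)^d of that support; the powers of 2^j cancel up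
    to one. *)
Lemma moll_approx psi r : smooth_real psi -> supp_in r psi ->
  exists2 D, 0 <= D & forall j y,
    `|(\int[mu]_x (moll j (y - x) * psi x)) - mass R d * psi y| <= D * 2 ^- j * \1_(cube (r + 1)) y.
Proof.
move=> sp up; have [L L0 psiL] := smooth_Lipschitz sp up.
have [K K1 KP] := @moll_bound R d.
exists (L * (4 * K) ^+ d) => [|j y]; first by rewrite mulr_ge0// exprn_ge0; lra.
have p2 : 0 < 2 ^- j :> R by rewrite invr_gt0 exprn_gt0.
rewrite indicE; case: (asboolP (cube (r + 1) y)) => yr; last first.
  rewrite memNset// mulr0 up ?mulr0 ?subr0; last first.
    by move=> yr'; apply: yr; apply: le_trans yr' _; rewrite lerDl.
  rewrite (_ : (fun x => _) = fun=> 0) ?Rintegral_cst ?mul0r ?normr0//.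
  apply/funext => x; have [xr|xr] := pselect (cube r x); last by rewrite up// mulr0.
  rewrite moll_supp ?mul0r// => yx; apply: yr.
  by rewrite /cube/= -[y](subrK x) addrC (le_trans (ler_normD _ _))// lerD.
rewrite mem_set// mulr1.
have Ipsi : lintegrable (fun x => moll j (y - x) * psi x).
  have := rL1loc_test (continuous_rL1loc (smooth_continuous sp))
    (continuous_translate (a := - y) (smooth_continuous (mollN_smooth j)))
    (@supp_in_translate _ _ 1 _ (- y) (@mollN_supp j)).
  by under eq_fun do rewrite opprB mulrC.
have cN := smooth_continuous (mollN_smooth j).
have I1 : lintegrable (fun x : Rd => moll j (- x)) := test_lintegrable cN (@mollN_supp j).
have I2 : lintegrable (fun x => moll j (- x) * psi (x + y)).
  have := (lint_translate y Ipsi).1.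
  by under eq_fun do rewrite opprD addrCA subrr addr0.
have -> : \int[mu]_x (moll j (y - x) * psi x) = \int[mu]_x (moll j (- x) * psi (x + y)).
  rewrite -(lint_translate y Ipsi).2; apply: eq_Rintegral => x _.
  by rewrite opprD addrCA subrr addr0.
rewrite -(moll_mass R d j) mulrC -(lintegrableZ (psi y) I1).2.
rewrite -(lintegrableB I2 (lintegrableZ (psi y) I1).1).2.
have mb x : `|moll j (- x) * psi (x + y) - psi y * moll j (- x)| <=
    ((2 ^+ j * K) ^+ d * (L * 2 ^- j)) * \1_(cube (2 ^- j)) x.
  rewrite (mulrC (psi y)) -mulrBr normrM indicE.
  case: (asboolP (cube (2 ^- j) x)) => xj; last first.
    by rewrite memNset// mulr0 moll_supp_dil ?normr0 ?mul0r// /cube /= normrN.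
  rewrite mem_set// mulr1 ler_pM//; first exact: (KP j (- x)).1.
  by rewrite (addrC x) (le_trans (psiL _ _))// ler_wpM2l.
have mm : lmeasurable (fun x => moll j (- x) * psi (x + y) - psi y * moll j (- x)).
  exact: (lintegrableB I2 (lintegrableZ (psi y) I1).1).1.1.
rewrite (le_trans (lintegrable_bounded mm mb).2)//.
have K0 : 0 <= K by lra.
rewrite (le_trans (ler_wpM2l _ (cube_measure_le p2)))//.
  by rewrite !mulr_ge0// ?exprn_ge0 ?mulr_ge0 ?exprn_ge0// ltW.
rewrite mulrAC -exprMn mulrCA (_ : 2 ^+ j * K * (4 * 2 ^- j) = 4 * K).
  by rewrite mulrA.
by field; rewrite expf_neq0.
Qed.

(** The mollifications converge to f locally uniformly, and to [mass] times g when tested against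
    psi, by [corr_fubini] and [moll_approx]. So f and [mass] times g have the same integrals against
    test functions and coincide by [du_bois_reymond]. *)
Theorem family_smooth (G : seq 'I_d -> Rd -> R) :
  (forall s, rL1loc (G s)) ->
  (forall s i psi r, smooth_real psi -> supp_in r psi ->
    \int[mu]_x (G s x * partial i psi x) = - \int[mu]_x (G (rcons s i) x * psi x)) ->
  exists2 f, smooth_real f & {ae mu, forall x, G [::] x = f x}.
Proof.
move=> GL GD; have [f [sf [C C0 fC]]] := family_limit GL GD.
set g := G [::] in fC *; have lg : rL1loc g := GL [::].
have m0 := mass_gt0 R d.
have fg psi r : smooth_real psi -> supp_in r psi ->
    \int[mu]_x (f x * psi x) = mass R d * \int[mu]_x (g x * psi x).
  move=> sp up; have cp := smooth_continuous sp.
  have [D D0 DP] := moll_approx sp up.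
  have Ipsi := test_lintegrable cp up.
  have If : lintegrable (fun x => f x * psi x).
    exact: (rL1loc_test (continuous_rL1loc (smooth_continuous sf)) cp up).
  have Ig : lintegrable (fun x => g x * psi x) := rL1loc_test lg cp up.
  pose N := C r * (\int[mu]_x `|psi x|) + D * locnorm g (r + 1).
  have N0 : 0 <= N by rewrite addr_ge0 ?mulr_ge0 ?locnorm_ge0// Rintegral_ge0.
  suff H j : `|\int[mu]_x (f x * psi x) - mass R d * \int[mu]_x (g x * psi x)| <= N * 2 ^- j.
    apply/eqP; rewrite -subr_eq0 -normr_le0; apply/ler_addgt0Pr => e e0; rewrite add0r.
    have [j je] : exists j : nat, N * 2 ^- j < e.
      exists (Num.truncn (N / e)).+1.
      rewrite ltr_pdivrMr ?exprn_gt0// mulrC -ltr_pdivrMr//.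
      apply: (lt_le_trans (truncnS_gt _)).
      by rewrite -natrX ler_nat ltnW// ltn_expl.
    exact: le_trans (H j) (ltW je).
  have sm := @moll_smooth R d j; have um := @moll_supp R d j.
  pose V := corr g (moll j).
  have cV : continuous V := smooth_continuous (corr_smooth lg sm um).
  have IV : lintegrable (fun x => V x * psi x) := rL1loc_test (continuous_rL1loc cV) cp up.
  have h1 : `|\int[mu]_x (f x * psi x) - \int[mu]_x (V x * psi x)| <=
      C r * (\int[mu]_x `|psi x|) * 2 ^- j.
    rewrite -(lintegrableB If IV).2.
    rewrite (le_trans (norm_lint (lintegrableB If IV).1))//.
    rewrite mulrAC -(lintegrableZ _ (lintegrable_norm Ipsi)).2.
    apply: le_lint; [exact: lintegrable_norm (lintegrableB If IV).1| |].
      exact: (lintegrableZ _ (lintegrable_norm Ipsi)).1.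
    move=> x; rewrite -mulrBl normrM.
    have [xr|xr] := pselect (cube r x); last by rewrite up// normr0 !mulr0.
    by rewrite ler_wpM2r// fC.
  pose W y := \int[mu]_x (moll j (y - x) * psi x).
  have mW : lmeasurable (fun y => W y - mass R d * psi y).
    apply: lmeasurableB; last by apply: lmeasurableM; [exact: lmeasurable_cst|exact: continuous_lmeasurable].
    rewrite (_ : W = corr psi (fun x => moll j (- x))).
      apply: continuous_lmeasurable; apply: smooth_continuous.
      exact: (corr_smooth (continuous_rL1loc cp) (mollN_smooth j) (@mollN_supp j)).
    by apply/funext => y; apply: eq_Rintegral => x _; rewrite opprB mulrC.
  have [IW hW] := rL1loc_bound lg mW (DP j).
  have h2 : \int[mu]_x (V x * psi x) - mass R d * \int[mu]_x (g x * psi x) =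
      \int[mu]_y (g y * (W y - mass R d * psi y)).
    rewrite (corr_fubini lg (smooth_continuous sm) um cp up).
    have IgW : lintegrable (fun y => g y * W y).
      have := (lintegrableD IW (lintegrableZ (mass R d) Ig).1).1.
      by under eq_fun do rewrite mulrBr (mulrCA (g _)) subrK.
    rewrite -(lintegrableZ (mass R d) Ig).2 -(lintegrableB IgW (lintegrableZ (mass R d) Ig).1).2.
    by apply: eq_Rintegral => y _; rewrite mulrBr (mulrCA (g _)).
  rewrite -[X in `|X - _|](subrK (\int[mu]_x (V x * psi x))) -addrA h2 /N mulrDl.
  rewrite (le_trans (ler_normD _ _))// lerD// (le_trans hW)//.
  by rewrite mulrAC.
exists (fun x => (mass R d)^-1 * f x); first exact: smoothZ.
have lf : rL1loc (fun x => f x - mass R d * g x).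
  have lf := continuous_rL1loc (smooth_continuous sf).
  split.
    apply: lmeasurableB; first exact: lf.1.
    by apply: lmeasurableM; [exact: lmeasurable_cst|exact: lg.1].
  move=> r; have := (lintegrableB (lf.2 r) (lintegrableZ (mass R d) (lg.2 r)).1).1.
  by under eq_fun do rewrite mulrA -mulrBl.
have : {ae mu, forall x, f x - mass R d * g x = 0}.
  apply: du_bois_reymond lf _ => psi r sp up; have cp := smooth_continuous sp.
  have If : lintegrable (fun x => f x * psi x).
    exact: (rL1loc_test (continuous_rL1loc (smooth_continuous sf)) cp up).
  have Ig : lintegrable (fun x => g x * psi x) := rL1loc_test lg cp up.
  rewrite -[RHS](subrr (\int[mu]_x (f x * psi x))) {2}(fg _ _ sp up).
  rewrite -(lintegrableZ _ Ig).2 -(lintegrableB If (lintegrableZ _ Ig).1).2.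
  by apply: eq_Rintegral => x _; rewrite mulrBl mulrA.
apply: filterS => x /eqP; rewrite subr_eq0 => /eqP ->.
by rewrite mulrA mulVf ?mul1r// gt_eqF.
Qed.

End identification.

(** * Complex-valued functions and distributions *)

Section cplx.
Local Open Scope complex_scope.
Context (R : realType).
Local Notation normc := (@ComplexField.Normc.normc R).
Implicit Types z : R[i].

Lemma normcE z : normc z = Num.sqrt (complex.Re z ^+ 2 + complex.Im z ^+ 2).
Proof. by case: z. Qed.

Lemma normc_ge0 z : 0 <= normc z.
Proof. by rewrite normcE sqrtr_ge0. Qed.

Lemma Re_le_normc z : `|complex.Re z| <= normc z.
Proof.
rewrite normcE -sqrtr_sqr ler_sqrt; first by rewrite lerDl sqr_ge0.
by rewrite addr_ge0 ?sqr_ge0.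
Qed.

Lemma Im_le_normc z : `|complex.Im z| <= normc z.
Proof.
rewrite normcE -sqrtr_sqr ler_sqrt; first by rewrite lerDr sqr_ge0.
by rewrite addr_ge0 ?sqr_ge0.
Qed.

Lemma normc_le z : normc z <= `|complex.Re z| + `|complex.Im z|.
Proof.
rewrite -[leRHS]ger0_norm ?addr_ge0// -sqrtr_sqr normcE ler_sqrt ?sqr_ge0//.
rewrite sqrrD !real_normK ?num_real// -addrA lerD2l lerDr.
by rewrite mulrn_wge0// mulr_ge0.
Qed.

Lemma normc_real (r : R) : normc r%:C = `|r|.
Proof. by rewrite normcE /= expr0n /= addr0 sqrtr_sqr. Qed.

Lemma cReD z1 z2 : complex.Re (z1 + z2) = complex.Re z1 + complex.Re z2.
Proof. by case: z1 => ? ?; case: z2. Qed.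

Lemma cImD z1 z2 : complex.Im (z1 + z2) = complex.Im z1 + complex.Im z2.
Proof. by case: z1 => ? ?; case: z2. Qed.

Lemma cReM z1 z2 : complex.Re (z1 * z2) =
  complex.Re z1 * complex.Re z2 - complex.Im z1 * complex.Im z2.
Proof. by case: z1 => ? ?; case: z2. Qed.

Lemma cImM z1 z2 : complex.Im (z1 * z2) =
  complex.Re z1 * complex.Im z2 + complex.Im z1 * complex.Re z2.
Proof. by case: z1 => a b; case: z2 => c e. Qed.

Lemma complex_ext z1 z2 : complex.Re z1 = complex.Re z2 ->
  complex.Im z1 = complex.Im z2 -> z1 = z2.
Proof. by case: z1 => a b; case: z2 => c e /= -> ->. Qed.

End cplx.

(** * Complex measurable functions and the spaces [L1loc], [L0] *)

Section cmeas.
Local Open Scope complex_scope.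
Context (R : realType) (d : nat).
Local Notation Rd := 'rV[R]_d.
Local Notation mu := (@leb_row R d).
Local Notation normc := (@ComplexField.Normc.normc R).
Implicit Types f g h : Rd -> R[i].

Lemma cabs_ge0 f x : 0 <= cabs f x.
Proof. exact: normc_ge0. Qed.

Lemma cabsM f g (x : Rd) : cabs (fun x => f x * g x) x = cabs f x * cabs g x.
Proof. exact: ComplexField.Normc.normcM. Qed.

Lemma cabs_real (f : Rd -> R) (x : Rd) : cabs (fun x => (f x)%:C) x = `|f x|.
Proof. exact: normc_real. Qed.

Lemma cabs_cut (K : set Rd) f (x : Rd) : cabs (Defs.cut K f) x = (\1_K x : R) * cabs f x.
Proof. by rewrite /Defs.cut (cabsM (fun x => (\1_K x)%:C)) cabs_real ger0_norm// indicE ler0n. Qed.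

Lemma cmeasurable_ae f g : cmeasurable g -> {ae mu, forall x, f x = g x} ->
  cmeasurable f.
Proof.
move=> [m1 m2] fg; split.
  by apply: (lmeasurable_ae m1); apply: filterS fg => x ->.
by apply: (lmeasurable_ae m2); apply: filterS fg => x ->.
Qed.

Lemma cmeasurable_real (f : Rd -> R) : lmeasurable f ->
  cmeasurable (fun x => (f x)%:C).
Proof. by move=> mf; split => //=; exact: lmeasurable_cst. Qed.

Lemma cmeasurableM f g : cmeasurable f -> cmeasurable g ->
  cmeasurable (fun x => f x * g x).
Proof.
move=> [f1 f2] [g1 g2]; split.
  under eq_fun do rewrite cReM; apply: lmeasurableB; exact: lmeasurableM.
under eq_fun do rewrite cImM; apply: lmeasurableD; exact: lmeasurableM.
Qed.

Lemma cmeasurable_cabs f : cmeasurable f -> lmeasurable (cabs f).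
Proof.
move=> [f1 f2].
have -> : cabs f = fun x => Num.sqrt
    (complex.Re (f x) * complex.Re (f x) + complex.Im (f x) * complex.Im (f x)).
  by apply/funext => x; rewrite /cabs normcE !expr2.
apply: (@lmeasurable_comp _ _ Num.sqrt).
  by apply: continuous_measurable_fun; exact: sqrt_continuous.
by apply: lmeasurableD; exact: lmeasurableM.
Qed.

Lemma cmeasurable_smooth f : smooth f -> cmeasurable f.
Proof.
by move=> [f1 f2]; split; apply: continuous_lmeasurable; exact: smooth_continuous.
Qed.

Lemma lintegrable_int (h : Rd -> R) (K : set Rd) : (forall x, 0 <= h x) ->
  (\int[mu]_(x in K) (h x)%:E = \int[mu]_x `|h x * \1_K x|%:E)%E.
Proof.
move=> h0; rewrite integral_mkcond; apply: eq_integral => x _.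
rewrite /patch indicE; case: ifPn => xK; last by rewrite /= mulr0 normr0.
by rewrite /= mulr1 ger0_norm.
Qed.

Lemma rL1loc_dom (f g : Rd -> R) : lmeasurable f -> rL1loc g ->
  (forall r, exists2 M, 0 <= M & forall x, cube r x -> `|f x| <= M * `|g x|) -> rL1loc f.
Proof.
move=> mf [mg ig] H; split => // r; have [M M0 fM] := H r.
have [i1 _] := lintegrableZ M (lintegrable_norm (ig r)).
apply: lintegrable_le i1 _.
  by apply: lmeasurableM => //; exact: lmeasurable_cube.
move=> x; rewrite !normrM indic_cube_norm mulrA.
have [xr|/negP xr] := boolP `[<cube r x>].
  by apply: ler_wpM2r; [rewrite indicE ler0n|apply: fM; exact/asboolP].
rewrite indicE memNset ?mulr0//; by move=> ?; apply: xr; exact/asboolP.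
Qed.

Lemma L1loc_cabs f : L1loc f <-> cmeasurable f /\ rL1loc (cabs f).
Proof.
split=> -[mf H]; split => //.
  split; first exact: cmeasurable_cabs.
  move=> r; split.
    by apply: lmeasurableM; [exact: cmeasurable_cabs|exact: lmeasurable_cube].
  rewrite -(@lintegrable_int (cabs f)); last exact: cabs_ge0.
  exact/H/cube_compact.
move=> K cK; have [r r0 Kr] := compact_sub_cube cK.
rewrite (@lintegrable_int (cabs f)); last exact: cabs_ge0.
suff [] : lintegrable (fun x => cabs f x * \1_K x) by [].
apply: lintegrable_le (H.2 r) _.
  apply: lmeasurableM; first exact: cmeasurable_cabs.
  by apply: lmeasurable_indic; exact: compact_measurable_row.
move=> x; rewrite normrM ger0_norm ?cabs_ge0// ger0_norm ?indicE ?ler0n//.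
apply: ler_wpM2l; first exact: cabs_ge0.
have := indic_sub x Kr; by rewrite !indicE.
Qed.

Lemma L1loc_dom f g : cmeasurable f -> L1loc g ->
  (forall r, exists2 M, 0 <= M & forall x, cube r x -> cabs f x <= M * cabs g x) ->
  L1loc f.
Proof.
move=> mf /L1loc_cabs[mg lg] H; apply/L1loc_cabs; split => //.
apply: rL1loc_dom lg _; first exact: cmeasurable_cabs.
move=> r; have [M M0 fM] := H r; exists M => // x /fM.
by rewrite !ger0_norm// cabs_ge0.
Qed.

Lemma L1loc_parts f : L1loc f <->
  rL1loc (fun x => complex.Re (f x)) /\ rL1loc (fun x => complex.Im (f x)).
Proof.
split.
  move=> /L1loc_cabs[[m1 m2] lf]; split.
    apply: rL1loc_dom lf _ => // r; exists 1 => // x _.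
    by rewrite mul1r (ger0_norm (cabs_ge0 _ _)) Re_le_normc.
  apply: rL1loc_dom lf _ => // r; exists 1 => // x _.
  by rewrite mul1r (ger0_norm (cabs_ge0 _ _)) Im_le_normc.
move=> [[m1 i1] [m2 i2]]; apply/L1loc_cabs; split => //; split.
  exact: cmeasurable_cabs.
move=> r.
have [i3 _] := lintegrableD (lintegrable_norm (i1 r)) (lintegrable_norm (i2 r)).
apply: lintegrable_le i3 _.
  by apply: lmeasurableM; [exact: cmeasurable_cabs|exact: lmeasurable_cube].
move=> x; rewrite !normrM indic_cube_norm -mulrDl.
rewrite ger0_norm ?cabs_ge0//; apply: ler_wpM2r; first by rewrite indicE ler0n.
exact: normc_le.
Qed.

Lemma rL1loc_complex (f : Rd -> R) : rL1loc f -> L1loc (fun x => (f x)%:C).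
Proof.
by move=> lf; apply/L1loc_parts; split => //=; apply: continuous_rL1loc; exact: cst_continuous.
Qed.

Lemma L1loc_smooth f : smooth f -> L1loc f.
Proof.
by move=> [f1 f2]; apply/L1loc_parts; split; apply: continuous_rL1loc; exact: smooth_continuous.
Qed.

Lemma cont_cube_bounded (f : Rd -> R) r : continuous f ->
  exists2 M, 0 <= M & forall x, cube r x -> `|f x| <= M.
Proof.
move=> cf; have [M [_ HM]] : bounded_set (f @` cube r).
  apply: compact_bounded; apply: continuous_compact; last exact: cube_compact.
  exact: continuous_subspaceT.
exists (Num.max (M + 1) 0); first by rewrite le_max lexx orbT.
move=> x xr; rewrite le_max; apply/orP; left.
by apply: (HM (M + 1)); [rewrite ltrDl|exists x].
Qed.

Lemma smooth_cube_bounded f r : smooth f ->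
  exists2 M, 0 <= M & forall x, cube r x -> cabs f x <= M.
Proof.
move=> [/smooth_continuous f1 /smooth_continuous f2].
have [M1 M10 H1] := cont_cube_bounded r f1.
have [M2 M20 H2] := cont_cube_bounded r f2.
exists (M1 + M2); first exact: addr_ge0.
move=> x xr; apply: le_trans (normc_le _) _; apply: lerD; [exact: H1|exact: H2].
Qed.

Lemma L1locM_bounded f g : L1loc g -> cmeasurable f ->
  (forall r, exists2 M, 0 <= M & forall x, cube r x -> cabs f x <= M) ->
  L1loc (fun x => f x * g x).
Proof.
move=> lg mf H; apply: (L1loc_dom _ lg).
  by apply: cmeasurableM => //; case: lg.
move=> r; have [M M0 HM] := H r; exists M => // x /HM fM.
by rewrite cabsM; apply: ler_wpM2r => //; exact: cabs_ge0.
Qed.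

Lemma Lp_oo_leP f (M : R) : 0 <= M ->
  (Lp_norm +oo%E f <= M%:E)%E <-> {ae mu, forall x, cabs f x <= M}.
Proof.
move=> M0; rewrite /Lp_norm unlock; case: ifPn => [_|].
  split=> [/ess_supP|] H; last apply/ess_supP.
    by apply: filterS H => x /=; rewrite lee_fin ger0_norm// cabs_ge0.
  by apply: filterS H => x /=; rewrite lee_fin ger0_norm// cabs_ge0.
rewrite -leNgt => mu0; split => [_|_]; last by rewrite lee_fin.
exists setT; split => //; apply/eqP; rewrite eq_le mu0/=; exact: measure_ge0.
Qed.

Lemma Lp_ooP f : Lp_space +oo%E f <->
  cmeasurable f /\ exists2 M, 0 <= M & {ae mu, forall x, cabs f x <= M}.
Proof.
split=> -[mf H]; split => //; last first.
  case: H => M M0 HM; apply: le_lt_trans (ltry M); exact/Lp_oo_leP.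
have : (Lp_norm +oo%E f <= (Num.max (fine (Lp_norm +oo%E f)) 0)%:E)%E.
  move: H; case: (Lp_norm +oo%E f) => [r _| //|_]; last exact: leNye.
  by rewrite lee_fin le_max lexx.
move=> /Lp_oo_leP HM; exists (Num.max (fine (Lp_norm +oo%E f)) 0).
  by rewrite le_max lexx orbT.
by apply: HM; rewrite le_max lexx orbT.
Qed.

Lemma cube_le (r s : R) : r <= s -> (cube r : set Rd) `<=` cube s.
Proof. by move=> rs x; rewrite /cube/= => /le_trans; apply. Qed.

Lemma L0P f : L0 f <-> [/\ cmeasurable f,
  exists2 M, 0 <= M & {ae mu, forall x, cabs f x <= M} &
  forall e, 0 < e -> exists2 r, 0 < r &
    {ae mu, forall x, ~ cube r x -> cabs f x <= e}].
Proof.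
have E (K : set Rd) (x : Rd) : cabs (fun x => (1 - (\1_K x)%:C) * f x) x =
    (1 - \1_K x) * cabs f x.
  have -> : (fun x => (1 - (\1_K x)%:C) * f x) = (fun x => (1 - \1_K x)%:C * f x).
    by apply/funext => y; rewrite rmorphB rmorph1.
  rewrite (cabsM (fun x => (1 - \1_K x)%:C)) cabs_real ger0_norm; first by [].
  by rewrite subr_ge0 indicE lern1; case: (_ \in _).
split=> [[/Lp_ooP[mf bf] H]|[mf bf H]].
  split => // e e0; have [K cK /ltW/Lp_oo_leP] := H _ e0.
  move=> /(_ (ltW e0)) HK; have [r r0 Kr] := compact_sub_cube cK.
  exists r => //; apply: filterS HK => x; rewrite E => + xr.
  by rewrite indicE memNset ?subr0 ?mul1r// => /Kr.
split; first exact/Lp_ooP.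
move=> e e0; have e20 : 0 < e / 2 by rewrite divr_gt0.
have [r r0 Hr] := H _ e20; exists (cube r); first exact: cube_compact.
apply: (@le_lt_trans _ _ (e / 2)%:E); last first.
  by rewrite lte_fin ltr_pdivrMr// ltr_pMr// ltr1n.
apply/(Lp_oo_leP _ (ltW e20)); apply: filterS Hr => x Hx; rewrite E.
rewrite indicE; case: (boolP (x \in cube r)) => xr; first by rewrite subrr mul0r ltW.
by rewrite subr0 mul1r; apply: Hx => /mem_set; exact/negP.
Qed.

End cmeas.

(** * Complex derivatives and regular distributions *)

Section cder.
Local Open Scope complex_scope.
Context (R : realType) (d : nat).
Local Notation Rd := 'rV[R]_d.
Local Notation mu := (@leb_row R d).
Local Notation normc := (@ComplexField.Normc.normc R).
Implicit Types (f g h phi psi : Rd -> R[i]) (s t : seq 'I_d).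

(** Words replace multi-indices because the Leibniz formula and integration by parts proceed letter
    by letter; [mseq] and [miof] translate, and the order of the letters is irrelevant for smooth f
    by [partialsC]. *)
Definition cder s f : Rd -> R[i] := fun x =>
  partials s (fun y => complex.Re (f y)) x +i* partials s (fun y => complex.Im (f y)) x.

Definition mseq (a : multiindex d) : seq 'I_d :=
  flatten [seq nseq (a i) i | i <- enum 'I_d].

Definition miof s : multiindex d := [ffun i => count_mem i s].

Lemma size_mseq a : size (mseq a) = mi_order a.
Proof.
rewrite size_flatten /shape -map_comp sumnE big_map /mi_order big_enum /=.
by apply: eq_bigr => i _; rewrite size_nseq.
Qed.

Lemma perm_mseq s : perm_eq (mseq (miof s)) s.
Proof.
apply/allP => i _ /=; apply/eqP.
rewrite count_flatten -map_comp sumnE big_map big_enum /= (bigD1 i)//=.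
rewrite count_nseq /= eqxx mul1n ffunE big1 ?addn0// => j ji.
by rewrite count_nseq /= (negbTE ji).
Qed.

Lemma mi_order_miof s : mi_order (miof s) = size s.
Proof. by rewrite -size_mseq (perm_size (perm_mseq s)). Qed.

Lemma cder_perm s t f : smooth f -> perm_eq s t -> cder s f = cder t f.
Proof.
move=> [f1 f2] st; apply/funext => x.
by rewrite /cder (perm_partials f1 st) (perm_partials f2 st).
Qed.

Lemma mi_derive_miof s f : smooth f -> mi_derive (miof s) f = cder s f.
Proof. by move=> sf; exact: cder_perm sf (perm_mseq s). Qed.

Lemma cder_smooth s f : smooth f -> smooth (cder s f).
Proof. by move=> [f1 f2]; split; exact: smooth_partials. Qed.

Lemma cder_nil f : cder [::] f = f.
Proof. by apply/funext => x; rewrite /cder /=; case: (f x). Qed.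

Lemma smooth_mul f g : smooth f -> smooth g -> smooth (fun x => f x * g x).
Proof.
move=> [f1 f2] [g1 g2]; split.
  under eq_fun do rewrite cReM; apply: smoothB; exact: smoothM.
under eq_fun do rewrite cImM; apply: smoothD; exact: smoothM.
Qed.

Lemma smooth_complex (f : Rd -> R) : smooth_real f -> smooth (fun x => (f x)%:C).
Proof. by move=> sf; split => //=; exact: smooth_cst. Qed.

Lemma partialsB s (f g : Rd -> R) : smooth_real f -> smooth_real g ->
  partials s (fun y => f y - g y) = fun x => partials s f x - partials s g x.
Proof.
move=> sf sg.
have -> : (fun y => f y - g y) = (fun y => f y + -1 * g y).
  by apply/funext => y; rewrite mulN1r.
rewrite partialsD//; last exact: smoothZ.
by apply/funext => x; rewrite partialsZ// mulN1r.
Qed.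

Lemma cder_mul s f g x : smooth f -> smooth g ->
  cder s (fun y => f y * g y) x = \sum_(p <- splits s) cder p.1 f x * cder p.2 g x.
Proof.
move=> [f1 f2] [g1 g2]; apply: complex_ext => /=.
  under eq_fun do rewrite cReM.
  rewrite partialsB; [|exact: smoothM|exact: smoothM].
  rewrite !partials_Leibniz// -sumrB (big_morph _ (@cReD R) (erefl _)).
  by apply: eq_bigr => p _; rewrite cReM.
under eq_fun do rewrite cImM.
rewrite partialsD; [|exact: smoothM|exact: smoothM].
rewrite !partials_Leibniz// -big_split (big_morph _ (@cImD R) (erefl _)).
by apply: eq_bigr => p _; rewrite cImM.
Qed.

Lemma cder_real s (f : Rd -> R) :
  cder s (fun x => (f x)%:C) = fun x => (partials s f x)%:C.
Proof.
apply/funext => x; apply: complex_ext => //=.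
have -> : (fun _ : Rd => 0) = (fun _ : Rd => 0 * 0 : R) by apply/funext => ?; rewrite mul0r.
by rewrite (partialsZ s 0 (smooth_cst 0)) mul0r.
Qed.

Lemma supp_in_mono r r' (f : Rd -> R) : r <= r' -> supp_in r f -> supp_in r' f.
Proof. by move=> rr H x xr; apply: H => /(cube_le rr). Qed.

Lemma test_functionP phi : test_function phi <-> smooth phi /\
  exists2 r, 0 < r & forall x, ~ cube r x -> phi x = 0.
Proof.
split=> [[K cK [sphi H]]|[sphi [r r0 H]]].
  split => //; have [r r0 Kr] := compact_sub_cube cK.
  by exists r => // x xr; apply: H => /Kr.
by exists (cube r); [exact: cube_compact|split].
Qed.

Lemma test_functionM f phi : smooth f -> test_function phi ->
  test_function (fun x => f x * phi x).
Proof.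
move=> sf /test_functionP[sphi [r r0 H]]; apply/test_functionP; split.
  exact: smooth_mul.
by exists r => // x xr; rewrite H// mulr0.
Qed.

Lemma test_function_lin a phi psi : test_function phi -> test_function psi ->
  test_function (fun x => a * phi x + psi x).
Proof.
move=> /test_functionP[[p1 p2] [r r0 H]] /test_functionP[[q1 q2] [r' r0' H']].
apply/test_functionP; split.
  split.
    under eq_fun do rewrite cReD cReM; apply: smoothD => //.
    apply: smoothB; exact: smoothZ.
  under eq_fun do rewrite cImD cImM; apply: smoothD => //.
  apply: smoothD; exact: smoothZ.
exists (Num.max r r'); first by rewrite lt_max r0.
move=> x xr; rewrite H ?H' ?mulr0 ?addr0//.
  by move=> H2; apply: xr; apply: cube_le H2; rewrite le_max lexx orbT.
by move=> H2; apply: xr; apply: cube_le H2; rewrite le_max lexx.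
Qed.

Lemma cder_supp s phi r : (forall x, ~ cube r x -> phi x = 0) ->
  forall x, ~ cube r x -> cder s phi x = 0.
Proof.
move=> H x xr; apply: complex_ext => /=.
  by apply: (@supp_in_partials _ _ r) xr => y yr; rewrite H.
by apply: (@supp_in_partials _ _ r) xr => y yr; rewrite H.
Qed.

Lemma test_function_cder s phi : test_function phi -> test_function (cder s phi).
Proof.
move=> /test_functionP[sphi [r r0 H]]; apply/test_functionP; split.
  exact: cder_smooth.
by exists r => //; exact: cder_supp.
Qed.

Lemma test_function_real (psi : Rd -> R) r : smooth_real psi -> supp_in r psi ->
  test_function (fun x => (psi x)%:C).
Proof.
move=> sp H; apply/test_functionP; split; first exact: smooth_complex.
exists (Num.max r 1); first by rewrite lt_max ltr01 orbT.
by move=> x xr; rewrite H// => xr'; apply: xr; apply: cube_le xr'; rewrite le_max lexx.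
Qed.

Local Notation I a b := (\int[mu]_x (a x * b x)).
Local Notation re f := (fun x => complex.Re (f x)).
Local Notation im f := (fun x => complex.Im (f x)).

Lemma test_parts phi : test_function phi -> exists2 r, 0 < r &
  [/\ smooth_real (re phi), smooth_real (im phi), supp_in r (re phi) & supp_in r (im phi)].
Proof.
move=> /test_functionP[[p1 p2] [r r0 H]]; exists r => //; split => //.
  by move=> x /H ->.
by move=> x /H ->.
Qed.

Lemma regularE f phi : L1loc f -> test_function phi ->
  regular f phi = (I (re f) (re phi) - I (im f) (im phi)) +i*
                  (I (re f) (im phi) + I (im f) (re phi)).
Proof.
move=> /L1loc_parts[l1 l2] /test_parts[r _ [p1 p2 s1 s2]].
have T (g h : Rd -> R) : rL1loc g -> smooth_real h -> supp_in r h ->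
    lintegrable (fun x => g x * h x).
  by move=> lg sh; apply: rL1loc_test => //; exact: smooth_continuous.
apply: complex_ext => /=.
  under eq_Rintegral do rewrite cReM.
  by rewrite (lintegrableB (T _ _ l1 p1 s1) (T _ _ l2 p2 s2)).2.
under eq_Rintegral do rewrite cImM.
by rewrite (lintegrableD (T _ _ l1 p2 s2) (T _ _ l2 p1 s1)).2.
Qed.

Lemma Rint0 : \int[mu]_x (0 : R) = 0.
Proof. by rewrite /Rintegral integral0. Qed.

Lemma regular_real f (psi : Rd -> R) : 
  regular f (fun x => (psi x)%:C) = I (re f) psi +i* I (im f) psi.
Proof.
apply: complex_ext => /=.
  by apply: eq_Rintegral => x _; rewrite cReM /= mulr0 subr0.
by apply: eq_Rintegral => x _; rewrite cImM /= mulr0 add0r.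
Qed.

Lemma rL1locB (f g : Rd -> R) : rL1loc f -> rL1loc g -> rL1loc (fun x => f x - g x).
Proof.
move=> [m1 i1] [m2 i2]; split; first exact: lmeasurableB.
move=> r; under eq_fun do rewrite mulrBl.
exact: (lintegrableB (i1 r) (i2 r)).1.
Qed.

Lemma rL1loc_uniq (f g : Rd -> R) : rL1loc f -> rL1loc g ->
  (forall (psi : Rd -> R) r, smooth_real psi -> supp_in r psi -> I f psi = I g psi) ->
  {ae mu, forall x, f x = g x}.
Proof.
move=> lf lg H; have := du_bois_reymond (rL1locB lf lg).
have T (h psi : Rd -> R) r : rL1loc h -> smooth_real psi -> supp_in r psi ->
    lintegrable (fun x => h x * psi x).
  by move=> lh sh; apply: rL1loc_test => //; exact: smooth_continuous.
move=> /(_ _)H2; apply: filterS (H2 _) => [x /eqP|psi r sp pp].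
  by rewrite subr_eq0 => /eqP.
under eq_Rintegral do rewrite mulrBl.
by rewrite (lintegrableB (T _ _ _ lf sp pp) (T _ _ _ lg sp pp)).2 (H _ _ sp pp) subrr.
Qed.

Lemma regular_uniq f g : L1loc f -> L1loc g -> deq (regular f) (regular g) ->
  {ae mu, forall x, f x = g x}.
Proof.
move=> /L1loc_parts[f1 f2] /L1loc_parts[g1 g2] fg.
have E (psi : Rd -> R) r : smooth_real psi -> supp_in r psi ->
    I (re f) psi = I (re g) psi /\ I (im f) psi = I (im g) psi.
  move=> sp pp; have := fg _ (test_function_real sp pp).
  by rewrite !regular_real => -[].
have H1 := rL1loc_uniq f1 g1 (fun (psi : Rd -> R) r sp pp => (E psi r sp pp).1).
have H2 := rL1loc_uniq f2 g2 (fun (psi : Rd -> R) r sp pp => (E psi r sp pp).2).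
by apply: filterS2 H1 H2 => x; exact: complex_ext.
Qed.

Lemma regular_ae f g : {ae mu, forall x, f x = g x} -> regular f = regular g.
Proof.
move=> fg; apply/funext => phi; apply: complex_ext => /=; apply: ae_Rintegral.
  by apply: filterS fg => x ->.
by apply: filterS fg => x ->.
Qed.

Lemma sign_complex n (a b : R) :
  (-1 : R[i]) ^+ n * (a +i* b) = ((-1) ^+ n * a) +i* ((-1) ^+ n * b).
Proof.
have -> : (-1 : R[i]) ^+ n = ((-1) ^+ n : R)%:C by rewrite rmorphXn rmorphN rmorph1.
by apply: complex_ext; rewrite ?cReM ?cImM /= mul0r ?subr0 ?addr0.
Qed.

Lemma regular_parts s f phi : smooth f -> test_function phi ->
  (-1) ^+ size s * regular f (cder s phi) = regular (cder s f) phi.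
Proof.
move=> sf tphi; have ts := test_function_cder s tphi.
rewrite (regularE (L1loc_smooth sf) ts).
rewrite (regularE (L1loc_smooth (cder_smooth s sf)) tphi).
have [r _ [p1 p2 s1 s2]] := test_parts tphi; have [f1 f2] := sf.
rewrite sign_complex /= mulrBr mulrDr.
rewrite (lint_parts s f1 p1 s1) (lint_parts s f2 p2 s2).
rewrite (lint_parts s f1 p2 s2) (lint_parts s f2 p1 s1).
by rewrite !mulrA -expr2 sqrr_sign !mul1r.
Qed.

Lemma dderive_regular a f : smooth f ->
  deq (dderive a (regular f)) (regular (mi_derive a f)).
Proof.
by move=> sf phi tphi; rewrite /dderive -size_mseq; exact: regular_parts.
Qed.

Lemma int_lin (g p q u : Rd -> R) (a b r : R) : rL1loc g ->
  continuous p -> continuous q -> continuous u ->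
  supp_in r p -> supp_in r q -> supp_in r u ->
  \int[mu]_x (g x * (a * p x + b * q x + u x)) = a * I g p + b * I g q + I g u.
Proof.
move=> lg cp cq cu sp sq su.
have ip := rL1loc_test lg cp sp; have iq := rL1loc_test lg cq sq.
have iu := rL1loc_test lg cu su.
have [ip' <-] := lintegrableZ a ip; have [iq' <-] := lintegrableZ b iq.
have [ipq <-] := lintegrableD ip' iq'; have [_ <-] := lintegrableD ipq iu.
by apply: eq_Rintegral => x _; rewrite !mulrDr !(mulrCA (g x)).
Qed.

Lemma distribution_regular f : L1loc f -> Defs.distribution (regular f).
Proof.
move=> lf; have [l1 l2] := (L1loc_parts f).1 lf.
split=> [a phi psi tphi tpsi|K cK].
  have tl := test_function_lin a tphi tpsi.
  rewrite (regularE lf tl) (regularE lf tphi) (regularE lf tpsi).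
  have [r _ [p1 p2 s1 s2]] := test_parts tphi.
  have [r' _ [q1 q2 t1 t2]] := test_parts tpsi.
  pose m := Num.max r r'.
  have rm : r <= m by rewrite le_max lexx.
  have rm' : r' <= m by rewrite le_max lexx orbT.
  have L (g : Rd -> R) (b c : R) p q u : rL1loc g -> smooth_real p -> smooth_real q ->
      smooth_real u -> supp_in r p -> supp_in r q -> supp_in r' u ->
      \int[mu]_x (g x * (b * p x + c * q x + u x)) = b * I g p + c * I g q + I g u.
    move=> lg sp sq su zp zq zu.
    by apply: (@int_lin _ _ _ _ _ _ m) => //; (try exact: smooth_continuous);
      [exact: supp_in_mono zp|exact: supp_in_mono zq|exact: supp_in_mono zu].
  have R1 (g : Rd -> R) : rL1loc g -> \int[mu]_x (g x * complex.Re (a * phi x + psi x)) =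
      complex.Re a * \int[mu]_x (g x * complex.Re (phi x)) +
      - complex.Im a * \int[mu]_x (g x * complex.Im (phi x)) +
      \int[mu]_x (g x * complex.Re (psi x)).
    move=> lg; rewrite -(L g _ _ _ _ _ lg p1 p2 q1 s1 s2 t1).
    by apply: eq_Rintegral => x _; rewrite cReD cReM mulNr.
  have R2 (g : Rd -> R) : rL1loc g -> \int[mu]_x (g x * complex.Im (a * phi x + psi x)) =
      complex.Re a * \int[mu]_x (g x * complex.Im (phi x)) +
      complex.Im a * \int[mu]_x (g x * complex.Re (phi x)) +
      \int[mu]_x (g x * complex.Im (psi x)).
    move=> lg; rewrite -(L g _ _ _ _ _ lg p2 p1 q2 s2 s1 t2).
    by apply: eq_Rintegral => x _; rewrite cImD cImM.
  rewrite (R1 _ l1) (R1 _ l2) (R2 _ l1) (R2 _ l2).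
  by apply: complex_ext; rewrite ?cReD ?cImD ?cReM ?cImM /=; ring.
have [r r0 Kr] := compact_sub_cube cK.
(* [regularE] splits the value into four real integrals; the real and the imaginary part of f each
   occur in two of them. *)
exists 0%N, (2 * (locnorm (re f) r + locnorm (im f) r)) => phi [sphi zphi] B HB.
have tphi : test_function phi.
  by apply/test_functionP; split => //; exists r => // x xr; apply: zphi => /Kr.
rewrite (regularE lf tphi).
have pB x : cabs phi x <= B * \1_(cube r) x.
  have [xr|xr] := pselect (cube r x).
    rewrite indicE mem_set// mulr1 -[phi]cder_nil -mi_derive_miof//.
    by apply: HB; rewrite mi_order_miof.
  rewrite indicE memNset// mulr0 /cabs zphi => [|/Kr//].
  by rewrite ComplexField.Normc.normc0.
have b1 x : `|complex.Re (phi x)| <= B * \1_(cube r) x.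
  exact: le_trans (Re_le_normc _) (pB x).
have b2 x : `|complex.Im (phi x)| <= B * \1_(cube r) x.
  exact: le_trans (Im_le_normc _) (pB x).
have [p1 p2] := sphi.
have m1 := continuous_lmeasurable (@smooth_continuous _ _ _ p1).
have m2 := continuous_lmeasurable (@smooth_continuous _ _ _ p2).
apply: le_trans (normc_le _) _ => /=.
have := (rL1loc_bound l1 m1 b1).2; have := (rL1loc_bound l1 m2 b2).2.
have := (rL1loc_bound l2 m1 b1).2; have := (rL1loc_bound l2 m2 b2).2.
move=> h1 h2 h3 h4; apply: le_trans (lerD (ler_normB _ _) (ler_normD _ _)) _.
apply: le_trans (lerD (lerD h4 h1) (lerD h3 h2)) _.
by rewrite le_eqVlt; apply/orP; left; apply/eqP; ring.
Qed.

Lemma test_on_function (K : set Rd) phi : compact K -> test_on K phi -> test_function phi.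
Proof. by move=> cK tK; exists K. Qed.

Lemma distribution_deq (u v : functional R d) : deq u v -> Defs.distribution v -> Defs.distribution u.
Proof.
move=> uv [lv bv]; split=> [a phi psi tphi tpsi|K cK].
  by rewrite !uv//; [exact: lv|exact: test_function_lin].
have [N [C H]] := bv K cK; exists N, C => phi tphi B HB.
by rewrite uv; [exact: H|exact: test_on_function tphi].
Qed.

(** By [regular_uniq] the locally integrable functions that represent the derivatives of u are the
    classical derivatives of f almost everywhere, and membership in E ignores null sets. *)
Lemma weightedP (E : set (Rd -> R[i])) (w : nat -> Rd -> R) u f :
  (forall f g, E f -> {ae mu, forall x, g x = f x} -> E g) ->
  smooth f -> deq u (regular f) ->
  weighted E w u <-> forall s n, (size s <= n)%N ->
    E (fun x => cder s f x * (w n x)%:C).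
Proof.
move=> Eae sf uf; split=> [[du H] s n sn|H].
  have [|g [lg ug Eg]] := H n (miof s); first by rewrite mi_order_miof.
  apply: Eae Eg _; have : {ae mu, forall x, cder s f x = g x}.
    apply: regular_uniq => //.
      exact: L1loc_smooth (cder_smooth s sf).
    move=> phi tphi; rewrite -ug// /dderive uf.
      by rewrite -mi_derive_miof// -dderive_regular.
    exact: test_function_cder.
  by apply: filterS => x ->.
split=> [|n a an].
  exact: distribution_deq uf (distribution_regular (L1loc_smooth sf)).
exists (cder (mseq a) f); split.
- exact: L1loc_smooth (cder_smooth _ sf).
- move=> phi tphi; rewrite -[RHS]dderive_regular// /dderive uf//.
  exact: test_function_cder.
- by apply: H; rewrite size_mseq.
Qed.

Lemma deq_dmul u f phi : smooth phi -> deq u (regular f) ->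
  deq (dmul u phi) (regular (fun x => f x * phi x)).
Proof.
move=> sphi uf psi tpsi; rewrite /dmul uf; last exact: test_functionM.
by congr cintegral; apply/funext => x; rewrite mulrA.
Qed.

End cder.

(** * Weights and solid spaces *)

Section spaces.
Local Open Scope complex_scope.
Context (R : realType) (d : nat).
Local Notation Rd := 'rV[R]_d.
Local Notation mu := (@leb_row R d).
Local Notation normc := (@ComplexField.Normc.normc R).
Implicit Types (f g h : Rd -> R[i]).

Lemma L0_dom (C : R) f g : 0 <= C -> L0 f -> cmeasurable g ->
  {ae mu, forall x, cabs g x <= C * cabs f x} -> L0 g.
Proof.
move=> C0 /L0P[mf [M M0 HM] H] mg gf; apply/L0P; split => //.
  exists (C * M); first exact: mulr_ge0.
  by apply: filterS2 gf HM => x h1 h2; apply: le_trans h1 _; exact: ler_wpM2l.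
move=> e e0; have C1 : 0 < C + 1 by rewrite ltr_wpDl.
have [r r0 Hr] := H _ (divr_gt0 e0 C1); exists r => //.
apply: filterS2 gf Hr => x h1 h2 xr; apply: le_trans h1 _.
apply: (@le_trans _ _ ((C + 1) * (e / (C + 1)))).
  apply: ler_pM => //; [exact: cabs_ge0|by rewrite lerDl|exact: h2].
by rewrite mulrC divfK// gt_eqF.
Qed.

Lemma L0_intro f : cmeasurable f ->
  (forall r, exists M, forall x, cube r x -> cabs f x <= M) ->
  (forall e, 0 < e -> exists r, forall x, ~ cube r x -> cabs f x <= e) -> L0 f.
Proof.
move=> mf bf H; have H' e : 0 < e -> exists2 r, 0 < r & forall x, ~ cube r x -> cabs f x <= e.
  move=> e0; have [r Hr] := H _ e0; exists (Num.max r 1).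
    by rewrite lt_max ltr01 orbT.
  by move=> x xr; apply: Hr => xr'; apply: xr; apply: cube_le xr'; rewrite le_max lexx.
apply/L0P; split => //; last first.
  by move=> e /H'[r r0 Hr]; exists r => //; exact: aeW.
have [r r0 Hr] := H' 1 ltr01; have [M HM] := bf r.
exists (Num.max M 1); first by rewrite le_max ler01 orbT.
apply: aeW => x; rewrite le_max; have [xr|xr] := pselect (cube r x).
  by rewrite HM.
by rewrite Hr ?orbT.
Qed.

Lemma L0_ae f g : L0 f -> {ae mu, forall x, g x = f x} -> L0 g.
Proof.
move=> Lf gf; apply: (L0_dom ler01 Lf).
  by case/L0P : Lf => mf _ _; exact: cmeasurable_ae mf gf.
by apply: filterS gf => x E; rewrite /cabs E mul1r.
Qed.

Section weight.
Variable w : nat -> Rd -> R.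
Hypothesis hw : weight_system w.

Lemma weight_ge1 n x : 1 <= w n x. Proof. by have [_ _] := hw.1 n; apply. Qed.

Lemma weight_gt0 n x : 0 < w n x.
Proof. exact: lt_le_trans ltr01 (weight_ge1 n x). Qed.

Lemma weight_ge0 n x : 0 <= w n x. Proof. by apply: ltW; exact: weight_gt0. Qed.

Lemma weight_mono n m x : (n <= m)%N -> w n x <= w m x.
Proof.
move=> /subnK <-; elim: (m - n)%N => [//|k IH].
exact: le_trans IH (hw.2 _ _).
Qed.

Lemma weight_lmeasurable n : lmeasurable (w n). Proof. by have [] := hw.1 n. Qed.

Lemma weight_bounded n r : exists2 M, 0 <= M & forall x, cube r x -> w n x <= M.
Proof.
have [_ lb _] := hw.1 n.
have /compact_near_coveringP cK := @cube_compact R d r.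
have H (x : Rd) : cube r x -> \forall x' \near x & M \near +oo, w n x' <= M.
  move=> _; have [M HM] := lb x; exists ([set y | w n y <= M], [set t | M <= t]).
    by split; [exact: HM|apply: nbhs_pinfty_ge; exact: num_real].
  by move=> [y t] /= [h1 h2]; exact: le_trans h1 h2.
have [M [_ HM]] := cK _ _ _ _ H.
exists (Num.max (M + 1) 0); first by rewrite le_max lexx orbT.
move=> x xr; apply: HM => //; by rewrite lt_max ltrDl ltr01.
Qed.

Lemma weight_cabs n x : cabs (fun x => (w n x)%:C) x = w n x.
Proof. by rewrite cabs_real ger0_norm// weight_ge0. Qed.

Lemma weight_cmeasurable n : cmeasurable (fun x => (w n x)%:C).
Proof. by apply: cmeasurable_real; exact: weight_lmeasurable. Qed.

Lemma weightV_cmeasurable n : cmeasurable (fun x => (w n x)%:C^-1).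
Proof.
have -> : (fun x => (w n x)%:C^-1) = fun x => ((w n x)^-1)%:C.
  by apply/funext => x; rewrite fmorphV.
by apply: cmeasurable_real; apply: lmeasurableV; [exact: weight_ge0|exact: weight_lmeasurable].
Qed.

Lemma cabs_divw f n x : cabs (fun x => f x / (w n x)%:C) x = cabs f x / w n x.
Proof.
rewrite (cabsM f (fun x => (w n x)%:C^-1)); congr (_ * _).
by rewrite /cabs ComplexField.Normc.normcV -/(cabs (fun x => (w n x)%:C) x) weight_cabs.
Qed.

Lemma cabs_mulw f n x : cabs (fun x => f x * (w n x)%:C) x = cabs f x * w n x.
Proof. by rewrite (cabsM f (fun x => (w n x)%:C)) weight_cabs. Qed.

End weight.

Variable T : tibf R d.
Hypothesis hE : solid T.
Local Notation E := (tibf_car T).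
Local Notation norm := (tibf_norm T).

Lemma tibf0 : E (fun _ => 0).
Proof.
have [f Ef _] := tibf_nontrivial T.
have := tibf_lin (-1) Ef Ef; congr (tibf_car T _).
by apply/funext => x; rewrite mulN1r addNr.
Qed.

Lemma tibfZ a f : E f -> E (fun x => a * f x).
Proof.
move=> Ef; have := tibf_lin a Ef tibf0; congr (tibf_car T _).
by apply/funext => x; rewrite addr0.
Qed.

Lemma tibfD f g : E f -> E g -> E (fun x => f x + g x).
Proof.
move=> Ef Eg; have := tibf_lin 1 Ef Eg; congr (tibf_car T _).
by apply/funext => x; rewrite mul1r.
Qed.

Lemma tibfB f g : E f -> E g -> E (fun x => f x - g x).
Proof.
move=> Ef Eg; have := tibf_lin (-1) Eg Ef; congr (tibf_car T _).
by apply/funext => x; rewrite mulN1r addrC.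
Qed.

Lemma tibf_sum (I : eqType) (s : seq I) (F : I -> Rd -> R[i]) :
  (forall i, i \in s -> E (F i)) -> E (fun x => \sum_(i <- s) F i x).
Proof.
elim: s => [|i s IH] H.
  by have := tibf0; congr (tibf_car T _); apply/funext => x; rewrite big_nil.
have E1 : E (F i) by apply: H; rewrite mem_head.
have E2 := IH (fun j js => H j (mem_behead (s := i :: s) js)).
have := tibfD E1 E2; congr (tibf_car T _).
by apply/funext => x; rewrite big_cons.
Qed.

Lemma tibf_norm_ge0 f : E f -> 0 <= norm f.
Proof.
move=> Ef.
have n0 : norm (fun _ => 0) = 0.
  rewrite (_ : (fun _ => 0) = (fun x => 0 * f x)); last by apply/funext => x; rewrite mul0r.
  by rewrite tibf_normZ// ComplexField.Normc.normc0 mul0r.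
have := tibf_normD Ef (tibfZ (-1) Ef).
rewrite (_ : (fun x => f x + _) = (fun _ => 0)); last first.
  by apply/funext => x; rewrite mulN1r subrr.
rewrite n0 tibf_normZ//.
have -> : normc (-1) = 1 by rewrite normcE /= sqrrN expr1n oppr0 expr0n addr0 sqrtr1.
by rewrite mul1r; lra.
Qed.

(** The form of solidity used throughout: it allows a constant, and local integrability of g follows
    from the bound instead of being assumed. *)
Lemma tibf_dom (C : R) f g : 0 <= C -> E f -> cmeasurable g ->
  {ae mu, forall x, cabs g x <= C * cabs f x} -> E g /\ norm g <= C * norm f.
Proof.
move=> C0 Ef mg gf.
(* Erasing g on the exceptional null set makes the bound hold everywhere, so that [L1loc_dom]
   applies. *)
pose g' : Rd -> R[i] := fun x => if cabs g x <= C * cabs f x then g x else 0.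
have gg' : {ae mu, forall x, g x = g' x} by apply: filterS gf => x; rewrite /g' => ->.
have g'le x : cabs g' x <= C * cabs f x.
  rewrite /cabs /g'; case: ifPn => [//|_].
  by rewrite ComplexField.Normc.normc0 mulr_ge0// normc_ge0.
have mg' : cmeasurable g'.
  by apply: cmeasurable_ae mg _; apply: filterS gg' => x ->.
have Lg' : L1loc g'.
  by apply: (L1loc_dom mg' (@tibf_L1loc _ _ T _ Ef)) => r; exists C.
have cC : normc C%:C = C by rewrite normc_real ger0_norm.
have [|Eg' ng'] := hE (tibfZ C%:C Ef) Lg' _.
  apply: aeW => x; rewrite (cabsM (fun=> C%:C)) /cabs cC; exact: g'le.
have [Eg ->] := tibf_ae Eg' gg'; split => //.
by rewrite tibf_normZ// cC in ng'.
Qed.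

Lemma mcP f : mc T f <-> [/\ L1loc f, forall K, compact K -> E (Defs.cut K f) &
  exists2 B, 0 <= B & forall K, compact K -> norm (Defs.cut K f) <= B].
Proof.
split=> -[lf Ef H]; split => //.
  have : (mc_norm T f <= (Num.max (fine (mc_norm T f)) 0)%:E)%E.
    move: H; case: (mc_norm T f) => [r _| //|_]; last exact: leNye.
    by rewrite lee_fin le_max lexx.
  set B := Num.max _ _ => HB; exists B; first by rewrite le_max lexx orbT.
  move=> K cK; rewrite -lee_fin; apply: le_trans HB.
  by apply: ereal_sup_ubound; exists K.
have [B B0 HB] := H; apply: le_lt_trans (ltry B).
by apply: ub_ereal_sup => _ [K cK <-]; rewrite lee_fin; exact: HB.
Qed.

Lemma cut_cmeasurable K f : compact K -> cmeasurable f -> cmeasurable (Defs.cut K f).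
Proof.
move=> cK mf; apply: (@cmeasurableM _ _ (fun x => (\1_K x)%:C)) => //.
by apply: cmeasurable_real; apply: lmeasurable_indic; exact: compact_measurable_row.
Qed.

End spaces.

(** * Products of the module completion with [L0] *)

Section mcL0.
Local Open Scope complex_scope.
Context (R : realType) (d : nat).
Local Notation Rd := 'rV[R]_d.
Local Notation mu := (@leb_row R d).
Variable T : tibf R d.
Hypothesis hT : solid T.
Local Notation E := (tibf_car T).
Local Notation norm := (tibf_norm T).
Implicit Types (f g h : Rd -> R[i]).

Lemma cut_in (K : set Rd) f x : K x -> Defs.cut K f x = f x.
Proof. by move=> Kx; rewrite /Defs.cut indicE mem_set// rmorph1 mul1r. Qed.

Lemma cut_out (K : set Rd) f x : ~ K x -> Defs.cut K f x = 0.
Proof. by move=> Kx; rewrite /Defs.cut indicE memNset// rmorph0 mul0r. Qed.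

Lemma cut_tibf f : E f -> forall K, compact K -> E (Defs.cut K f) /\ norm (Defs.cut K f) <= norm f.
Proof.
move=> Ef K cK; rewrite -[norm f]mul1r; apply: tibf_dom => //.
  by apply: cut_cmeasurable => //; case: (@tibf_L1loc _ _ T _ Ef).
apply: aeW => x; rewrite cabs_cut; apply: ler_wpM2r; first exact: cabs_ge0.
by rewrite indicE lern1; case: (_ \in _).
Qed.

Lemma normc_0 : ComplexField.Normc.normc (0 : R[i]) = 0.
Proof. exact: ComplexField.Normc.normc0. Qed.

(** The cuts of f h to growing cubes form a Cauchy sequence: far out h is below e / (B + 1), while
    all cuts of f have norm at most B. The limit g is identified cube by cube: the cut [D] of f h -
    g to a cube is also the cut of u n - g for all large n, so its norm is 0. *)
Lemma mc_L0 f h : mc T f -> L0 h -> E (fun x => f x * h x).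
Proof.
move=> /mcP[lf Ef [B B0 HB]] /L0P[mh [M M0 HM] H].
have mfh : cmeasurable (fun x => f x * h x) by apply: cmeasurableM => //; case: lf.
pose u j := Defs.cut (cube j%:R : set Rd) (fun x => f x * h x).
have Eu j : E (u j).
  have [] // := @tibf_dom _ _ T hT M _ (u j) M0 (Ef _ (@cube_compact R d j%:R)).
    by apply: cut_cmeasurable => //; exact: cube_compact.
  apply: filterS HM => x hx; rewrite !cabs_cut cabsM [leRHS]mulrC -mulrA.
  apply: ler_wpM2l; first by rewrite indicE ler0n.
  by apply: ler_wpM2l hx; exact: cabs_ge0.
have [e e0|g Eg ug] := @tibf_complete _ _ T u Eu.
  have B1 : 0 < B + 1 by rewrite ltr_wpDl.
  have e'0 := divr_gt0 e0 B1; have [r r0 Hr] := H _ e'0.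
  have rN := archi_boundP (ltW r0); set N := Num.bound r in rN.
  exists N => m n Nm Nn; pose k := maxn m n.
  have kE := Ef _ (@cube_compact R d k%:R).
  have [|_ le1] := @tibf_dom _ _ T hT (e / (B + 1)) _ (fun x => u m x - u n x)
      (ltW e'0) kE (@tibf_L1loc _ _ T _ (tibfB (Eu m) (Eu n))).1.
    apply: filterS Hr => x hx.
    have sub (i j : nat) : (i <= j)%N -> cube i%:R x -> cube j%:R x.
      by move=> ij; apply: cube_le; rewrite ler_nat.
    have [xN|xN] := pselect (cube N%:R x).
      rewrite {1}/cabs /u (cut_in _ (sub _ _ Nm xN)) (cut_in _ (sub _ _ Nn xN)) subrr normc_0.
      by apply: mulr_ge0; [exact: ltW|exact: cabs_ge0].
    have hxe : cabs h x <= e / (B + 1).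
      by apply: hx => xr; apply: xN; apply: cube_le xr; exact: ltW.
    have [xk|xk] := pselect (cube k%:R x).
      have -> : (fun x => u m x - u n x) = (fun x => (\1_(cube m%:R) x - \1_(cube n%:R) x)%:C * (f x * h x)).
        by apply/funext => y; rewrite /u /Defs.cut rmorphB mulrBl.
      rewrite (cabsM (fun x => (\1_(cube m%:R) x - \1_(cube n%:R) x)%:C)) cabs_real cabsM.
      rewrite [cabs (Defs.cut _ _) x]/cabs cut_in// -/(cabs f x).
      apply: (@le_trans _ _ (1 * (cabs f x * cabs h x))); last first.
        by rewrite mul1r mulrC; apply: ler_wpM2r hxe; exact: cabs_ge0.
      apply: ler_wpM2r; first by rewrite mulr_ge0 ?cabs_ge0.
      rewrite !indicE; case: (_ \in _); case: (_ \in _);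
        by rewrite ?subrr ?subr0 ?sub0r ?normrN ?normr1 ?normr0.
    rewrite {1}/cabs /u !cut_out ?subrr ?normc_0.
    - by apply: mulr_ge0; [exact: ltW|exact: cabs_ge0].
    - by move=> xn; apply: xk; exact: (sub _ _ (leq_maxr _ _) xn).
    - by move=> xn; apply: xk; exact: (sub _ _ (leq_maxl _ _) xn).
  apply: le_lt_trans le1 _; apply: (@le_lt_trans _ _ (e / (B + 1) * B)).
    by apply: ler_wpM2l; [exact: ltW|apply: HB; exact: cube_compact].
  by rewrite mulrAC ltr_pdivrMr// ltr_pM2l// ltrDl.
suff fg : {ae mu, forall x, f x * h x = g x} by have [] := tibf_ae Eg fg.
have Hk k : {ae mu, forall x, cube k%:R x -> f x * h x = g x}.
  pose D := Defs.cut (cube k%:R : set Rd) (fun x => f x * h x - g x).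
  have DE n : (k <= n)%N -> D = Defs.cut (cube k%:R) (fun x => u n x - g x).
    move=> kn; apply/funext => x; have [xk|xk] := pselect (cube k%:R x).
      rewrite /D !cut_in// /u cut_in//; apply: cube_le xk; by rewrite ler_nat.
    by rewrite /D !cut_out.
  have ED n : E (fun x => u n x - g x) by exact: tibfB.
  have Dle n : (k <= n)%N -> E D /\ norm D <= norm (fun x => u n x - g x).
    by move=> /DE ->; apply: cut_tibf (ED n) _ _; exact: cube_compact.
  have ED' := (Dle k (leqnn k)).1.
  have D0 : norm D = 0.
    apply/eqP; rewrite eq_le (tibf_norm_ge0 ED') andbT.
    have cst0 : (fun _ : nat => norm D) @ \oo --> norm D by exact: cvg_cst.
    apply: ler_cvg_to cst0 ug _; exists k => // n /= kn; exact: (Dle n kn).2.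
  apply: filterS (tibf_norm0 ED' D0) => x + xk.
  by rewrite /D cut_in// => /eqP; rewrite subr_eq0 => /eqP.
have : {ae mu, forall x k, cube (k%:R : R) x -> f x * h x = g x} by exact: ae_foralln.
apply: filterS => x /(_ (Num.bound `|x|)); apply.
by rewrite /cube /=; apply: ltW; apply: archi_boundP.
Qed.

End mcL0.

(** * The gliding hump *)

Section humptools.
Local Open Scope complex_scope.
Context (R : realType) (d : nat).
Local Notation Rd := 'rV[R]_d.
Local Notation mu := (@leb_row R d).
Implicit Types (f g h psi : Rd -> R).

(** Half-side of a cube inside the Euclidean unit ball of (wM), by d small^2 <= d small <= 1. *)
Definition small : R := d.+1%:R^-1.

Lemma small_gt0 : 0 < small. Proof. by rewrite invr_gt0 ltr0n. Qed.

Lemma small_le1 : small <= 1. Proof. by rewrite invf_le1 ?ltr0n// ler1n. Qed.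

Lemma enorm_small (z : Rd) : cube small z -> enorm z <= 1.
Proof.
rewrite /cube /= => /(row_normP _ (ltW small_gt0)) H.
rewrite /enorm -[leRHS]sqrtr1 ler_sqrt ?ler01//.
apply: (@le_trans _ _ (\sum_(i < d) small)).
  apply: ler_sum => i _; rewrite -real_normK ?num_real// expr2.
  apply: le_trans (ler_pM _ _ (H i) (le_trans (H i) small_le1)) _ => //.
  by rewrite mulr1.
rewrite sumr_const card_ord -mulr_natl ler_pdivrMr ?ltr0n// mul1r ler_nat.
exact: leqnSn.
Qed.

Lemma bump_exists : exists rho : Rd -> R, [/\ smooth_real rho, supp_in small rho,
  forall x, 0 <= rho x & 0 < \int[mu]_x rho x].
Proof.
pose a (_ : 'I_d) := - small; pose b (_ : 'I_d) := small.
have o0 : obox a b (0 : Rd).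
  by move=> i; rewrite mxE /a /b oppr_lt0 small_gt0.
have [n n0] : exists n, 0 < box_bump a b n (0 : Rd).
  have : (box_bump a b n (0 : Rd) @[n --> \oo]) --> (\1_(obox a b) (0 : Rd) : R) by exact: box_bump_cvg.
  rewrite indicE mem_set// => /cvgr_gt /(_ 0 ltr01)[n _ Hn].
  by exists n; apply: Hn => /=.
have ob x : ~ cube small x -> ~ obox a b (x : Rd).
  move=> xs xo; apply: xs; apply/row_normP; first exact/ltW/small_gt0.
  by move=> i; have /andP[h1 h2] := xo i; rewrite ler_norml !ltW.
have s0 : supp_in small (box_bump a b n).
  move=> x /ob xo; have := box_bump_norm_le a b n x.
  by rewrite indicE memNset// normr_le0 => /eqP.
have sm := box_bump_smooth a b n.
have cm := @smooth_continuous _ _ _ sm.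
have ge0 (x : Rd) : 0 <= box_bump a b n x.
  by apply: prodr_ge0 => i _; apply: mulr_ge0; exact: step_ge0.
exists (box_bump a b n); split => //.
by apply: lint_gt0 n0 => //; exact: test_lintegrable s0.
Qed.

Lemma corrE g psi r x : rL1loc g -> continuous psi -> supp_in r psi ->
  lintegrable (fun z => g (z + x) * psi z) /\
  corr g psi x = \int[mu]_z (g (z + x) * psi z).
Proof.
move=> lg cp sp.
have i1 : lintegrable (fun y => g y * psi (y - x)).
  apply: rL1loc_test lg _ (supp_in_translate sp); exact: continuous_translate.
have [i2 e2] := lint_translate x i1.
split; first by move: i2; under eq_fun do rewrite addrK.
by rewrite /corr -e2; apply: eq_Rintegral => z _; rewrite addrK.
Qed.

Lemma corr_upper g psi (P M r : R) x : rL1loc g -> continuous psi -> supp_in r psi ->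
  0 <= M -> (forall z, `|psi z| <= P * \1_(cube r) z) ->
  (forall y, cube r (y - x) -> `|g y| <= M) ->
  `|corr g psi x| <= M * P * fine (mu (cube r)).
Proof.
move=> lg cp sp M0 pP gM; have [[mi _] ->] := corrE x lg cp sp.
apply: (lintegrable_bounded mi _).2 => z; rewrite normrM -mulrA.
have [zr|zr] := pselect (cube r z).
  apply: ler_pM => //; apply: gM; by rewrite addrK.
by rewrite sp// indicE memNset// normr0 !mulr0.
Qed.

Lemma corr_lower g psi (m r : R) x : rL1loc g -> continuous psi -> supp_in r psi ->
  (forall z, 0 <= psi z) -> (forall y, cube r (y - x) -> m <= g y) ->
  m * \int[mu]_z psi z <= corr g psi x.
Proof.
move=> lg cp sp p0 gm; have [i1 ->] := corrE x lg cp sp.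
have [i2 <-] := lintegrableZ m (test_lintegrable cp sp).
apply: le_lint => // z; have [zr|zr] := pselect (cube r z).
  by apply: ler_wpM2r => //; apply: gm; rewrite addrK.
by rewrite sp// !mulr0.
Qed.

(** Borel representatives are glued piece by piece; the exceptional null sets are countably many. *)
Lemma lmeasurable_glue (N : Rd -> nat) (h : nat -> Rd -> R) :
  (forall n, measurable [set x | N x = n]) -> (forall n, lmeasurable (h n)) ->
  lmeasurable (fun x => h (N x) x).
Proof.
move=> mN mh; have /choice[k Hk] : forall n, exists k : Rd -> R,
    measurable_fun setT k /\ {ae mu, forall x, h n x = k x}.
  by move=> n; have [k mk hk] := mh n; exists k.
exists (fun x => k (N x) x); last first.
  have : {ae mu, forall x n, h n x = k n x} by apply: ae_foralln => n; exact: (Hk n).2.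
  by apply: filterS => x.
have -> : setT = \bigcup_n [set x | N x = n].
  by apply/seteqP; split => // x _; exists (N x).
apply/measurable_fun_bigcup => // n.
apply: (@eq_measurable_fun _ _ _ _ _ (k n)).
  by move=> x; rewrite inE /= => ->.
exact: measurable_funS (Hk n).1.
Qed.

(** The negative start puts the origin into the first shell, and the gaps of 2 force r n >= n - 1,
    so that every point is reached; they also leave room for a margin of 1 at both ends of a
    shell. *)
Lemma shells (r : nat -> R) : r 0%N = -1 -> (forall n, r n + 2 <= r n.+1) ->
  (forall m n, (m <= n)%N -> r m <= r n) /\
  exists2 N : Rd -> nat, (forall x, r (N x) < `|x| <= r (N x).+1) &
     forall n, measurable [set x | N x = n].
Proof.
move=> r0 rS; have mono m n : (m <= n)%N -> r m <= r n.
  move=> /subnK <-; elim: (n - m)%N => [//|k IH].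
  by apply: le_trans IH _; apply: le_trans (rS _); rewrite lerDl.
have rn n : n%:R - 1 <= r n.
  elim: n => [|n IH]; first by rewrite r0 sub0r.
  by have := rS n; rewrite -natr1; lra.
split => //.
have ex (x : Rd) : exists n, r n < `|x| <= r n.+1.
  have ex1 : exists n, `|x| <= r n.
    exists (Num.bound `|x|).+1; apply: le_trans (rn _); rewrite -natr1 addrK.
    by apply: ltW; exact: archi_boundP.
  case: (ex_minnP ex1) => -[|n] xn minn.
    by have := le_trans (normr_ge0 x) xn; rewrite r0; lra.
  exists n; rewrite xn andbT ltNge; apply/negP => /minn; by rewrite ltnn.
have [N HN] := choice ex; exists N => // n.
have -> : [set x | N x = n] = (cube (r n.+1) : set Rd) `\` cube (r n).
  apply/seteqP; split => x /=.
    move=> <-; have /andP[h1 h2] := HN x; split => //.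
    by rewrite /cube /= => h3; have := lt_le_trans h1 h3; rewrite ltxx.
  rewrite /cube /= => -[h1 /negP]; rewrite -ltNge => h2.
  have /andP[h3 h4] := HN x; apply/eqP; rewrite eqn_leq; apply/andP; split.
    rewrite leqNgt; apply/negP => /mono h5.
    by have := lt_le_trans h3 (le_trans h1 h5); rewrite ltxx.
  rewrite leqNgt; apply/negP => /mono h5.
  by have := lt_le_trans h2 (le_trans h4 h5); rewrite ltxx.
by apply: measurableD; apply: compact_measurable_row; exact: cube_compact.
Qed.

End humptools.

(** * The hump function and the gliding hump argument *)

Section hump.
Local Open Scope complex_scope.
Context (R : realType) (d : nat).
Local Notation Rd := 'rV[R]_d.
Local Notation mu := (@leb_row R d).
Variable T : tibf R d.
Hypothesis hT : solid T.
Local Notation E := (tibf_car T).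
Local Notation norm := (tibf_norm T).
Variable w : nat -> Rd -> R.
Hypothesis hw : weight_system w.
Hypothesis hM : weight_wM w.

(** Asking for all pairs s, n, and not only size s <= n, does not change the space, since the
    weights increase with n; it spares the bookkeeping of orders. *)
Definition dotB_smooth (phi : Rd -> R) : Prop := smooth_real phi /\
  forall s n, L0 (fun x => (partials s phi x * w n x)%:C).

Lemma dotB_measurable (phi : Rd -> R) s n : smooth_real phi ->
  cmeasurable (fun x => (partials s phi x * w n x)%:C).
Proof.
move=> sp; apply: cmeasurable_real; apply: lmeasurableM; last exact: weight_lmeasurable.
by apply: continuous_lmeasurable; apply: smooth_continuous; exact: smooth_partials.
Qed.

Lemma test_dotB (phi : Rd -> R) r : smooth_real phi -> supp_in r phi -> dotB_smooth phi.
Proof.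
move=> sp pp; split => // s n; apply: L0_intro.
- exact: dotB_measurable.
- move=> t; have [M M0 HM] := weight_bounded hw n t.
  have cs := @smooth_continuous _ _ _ (smooth_partials s sp).
  have [P P0 HP] := cont_cube_bounded t cs.
  exists (P * M) => x xt; rewrite cabs_real normrM (ger0_norm (weight_ge0 hw n x)).
  by apply: ler_pM => //; [exact: weight_ge0|exact: HP|exact: HM].
- move=> e e0; exists r => x xr.
  by rewrite cabs_real (supp_in_partials s pp)// mul0r normr0 ltW.
Qed.

Lemma wM_small n : exists m C, [/\ (n <= m)%N, 0 < C &
  forall x y, cube (small R d) (y - x) -> w n y <= C * w m x].
Proof.
have [m [C [nm C0 H]]] := hM n; exists m, C; split => // x y xy.
by rewrite -{1}(subrK x y) addrC; apply: H; exact: enorm_small.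
Qed.

Lemma cubeN (r : R) (x y : Rd) : cube r (y - x) -> cube r (x - y).
Proof. by rewrite /cube /= distrC. Qed.

Lemma small_norm (z : Rd) : cube (small R d) z -> `|z| <= 1.
Proof. by rewrite /cube /= => /le_trans; apply; exact: small_le1. Qed.

Section construction.
Variables (r : nat -> R) (N : Rd -> nat).
Hypothesis r_mono : forall m n, (m <= n)%N -> r m <= r n.
Hypothesis shell : forall x, r (N x) < `|x| <= r (N x).+1.
Hypothesis mshell : forall n, measurable [set x | N x = n].

Definition hump_profile (y : Rd) : R := 2 ^- N y / w (N y) y.

Lemma hump_ge0 y : 0 <= hump_profile y.
Proof. by rewrite divr_ge0 ?weight_ge0// invr_ge0 exprn_ge0. Qed.

Lemma hump_le m y : (m <= N y)%N -> hump_profile y * w m y <= 2 ^- N y.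
Proof.
move=> mN; rewrite /hump_profile mulrAC ler_pdivrMr ?weight_gt0//.
by apply: ler_wpM2l; [rewrite invr_ge0 exprn_ge0|exact: weight_mono].
Qed.

Lemma exp2V_le1 n : 2 ^- n <= 1 :> R.
Proof. by rewrite invf_le1 ?exprn_gt0// exprn_ege1// ler1n. Qed.

Lemma hump_le1 y : hump_profile y <= 1.
Proof.
rewrite ler_pdivrMr ?weight_gt0// mul1r.
exact: le_trans (exp2V_le1 _) (weight_ge1 hw _ _).
Qed.

Lemma hump_L1loc : rL1loc hump_profile.
Proof.
apply: rL1loc_bounded; last first.
  by move=> t; exists 1 => x _; rewrite ger0_norm ?hump_ge0// hump_le1.
apply: (@lmeasurable_glue _ _ N (fun n y => 2 ^- n / w n y)) => // n.
apply: lmeasurableM; first exact: lmeasurable_cst.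
by apply: lmeasurableV; [exact: weight_ge0|exact: weight_lmeasurable].
Qed.

Lemma shell_ge n y : r n < `|y| -> (n <= N y)%N.
Proof.
move=> ny; rewrite leqNgt; apply/negP => /r_mono h.
have /andP[_ h2] := shell y.
by have := lt_le_trans ny (le_trans h2 h); rewrite ltxx.
Qed.

Lemma shell_eq n y : r n < `|y| -> `|y| <= r n.+1 -> N y = n.
Proof.
move=> /shell_ge n1 y2; apply/eqP; rewrite eqn_leq n1 andbT leqNgt; apply/negP.
move=> /r_mono h; have /andP[h1 _] := shell y.
by have := lt_le_trans h1 (le_trans y2 h); rewrite ltxx.
Qed.

Variables (rho : Rd -> R).
Hypothesis srho : smooth_real rho.
Hypothesis prho : supp_in (small R d) rho.
Hypothesis rho0 : forall x, 0 <= rho x.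

(** All derivatives fall on [rho], so only the size of the profile near x counts. By (wM) the factor
    w n x is exchanged for C w m y, and on shells of index at least m the profile times w m is at
    most 2^-N y, which tends to 0 at infinity. *)
Lemma hump_dotB : dotB_smooth (corr hump_profile rho).
Proof.
have lg := hump_L1loc.
split=> [|s n]; first exact: corr_smooth srho prho.
have [m [C [nm C0 HC]]] := wM_small n.
have cs := @smooth_continuous _ _ _ (smooth_partials s srho).
have ps := supp_in_partials s prho.
have [P P0 HP] := supp_in_bounded cs ps.
pose V : R := fine (mu (cube (small R d))).
have V0 : 0 <= V by exact: fine_ge0.
have key D x : 0 <= D -> (forall y, cube (small R d) (y - x) -> hump_profile y * w m y <= D) ->
    `|partials s (corr hump_profile rho) x * w n x| <= D * (C * P * V).
  move=> D0 HD; rewrite (corr_partials s lg srho prho) normrM normrMsign.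
  rewrite (ger0_norm (weight_ge0 hw n x)).
  rewrite -ler_pdivlMr ?weight_gt0//.
  apply: le_trans (corr_upper (M := D * C / w n x) lg cs ps _ HP _) _.
  - by rewrite divr_ge0 ?weight_ge0// mulr_ge0// ltW.
  - move=> y xy; rewrite ger0_norm ?hump_ge0// ler_pdivlMr ?weight_gt0//.
    apply: le_trans (ler_wpM2l (hump_ge0 y) (HC y x (cubeN xy))) _.
    by rewrite mulrCA mulrC; apply: ler_wpM2r; [exact: ltW|exact: HD].
  - by rewrite -/V le_eqVlt; apply/orP; left; apply/eqP; ring.
have Q0 : 0 <= C * P * V by rewrite !mulr_ge0// ltW.
apply: L0_intro; first by apply: dotB_measurable; exact: corr_smooth srho prho.
- move=> t; have [M M0 HM] := weight_bounded hw m (t + 1).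
  exists (M * (C * P * V)) => x xt; rewrite cabs_real; apply: key => // y xy.
  apply: (@le_trans _ _ (1 * M)); last by rewrite mul1r.
  apply: ler_pM; [exact: hump_ge0|exact: weight_ge0|exact: hump_le1|].
  apply: HM; rewrite /cube /= -(subrK x y) addrC; apply: le_trans (ler_normD _ _) _.
  by apply: lerD => //; exact: small_norm xy.
- move=> e e0; have Q1 : 0 < C * P * V + 1 by rewrite ltr_wpDl.
  pose k := Num.bound ((C * P * V + 1) / e).
  have kQ : 2 ^- k * (C * P * V) <= e.
    have h1 : (C * P * V + 1) / e < 2 ^+ k.
      apply: lt_le_trans (archi_boundP _) _; first by rewrite divr_ge0// ltW.
      by rewrite -natrX ler_nat ltnW// ltn_expl.
    rewrite mulrC ler_pdivrMr ?exprn_gt0//.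
    move: h1; rewrite ltr_pdivrMr// => h1.
    by rewrite [leRHS]mulrC; apply: le_trans (ltW h1); rewrite lerDl.
  (* Index k makes 2^-k small enough, index m makes [hump_le] applicable, and the summand 1 pays for
     the distance between x and y. *)
  exists (r (maxn k m) + 1) => x /negP xr; rewrite cabs_real.
  apply: le_trans kQ; apply: key; first by rewrite invr_ge0 exprn_ge0.
  move=> y xy; have Ny : (maxn k m <= N y)%N.
    apply: shell_ge; move: xr; rewrite -ltNge => xr.
    have := ler_normD (x - y) y; rewrite subrK => h.
    have h2 : `|x - y| <= 1 by rewrite distrC; exact: small_norm xy.
    by move: h h2 xr; set a := `|x|; set b := `|x - y|; lra.
  apply: le_trans (hump_le (leq_trans (leq_maxr _ _) Ny)) _.
  rewrite lef_pV2 ?posrE ?exprn_gt0// ler_eXn2l ?ltr1n//.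
  exact: leq_trans (leq_maxl _ _) Ny.
Qed.

(** At distance more than 1 from the inner edge and at least 1 from the outer edge of the n-th
    shell, smoothing sees only the n-th piece of the profile. *)
Lemma hump_lower n m C x : 0 < C ->
  (forall x y, cube (small R d) (y - x) -> w n y <= C * w m x) ->
  r n + 1 < `|x| -> `|x| <= r n.+1 - 1 ->
  2 ^- n / (C * w m x) * \int[mu]_z rho z <= corr hump_profile rho x.
Proof.
move=> C0 HC x1 x2; have lg := hump_L1loc.
apply: (corr_lower lg _ prho) => //; first exact: smooth_continuous.
move=> y xy; have xy1 : `|y - x| <= 1 by exact: small_norm xy.
have -> : hump_profile y = 2 ^- n / w n y.
  rewrite /hump_profile (@shell_eq n)//.
    have := ler_normD (x - y) y; rewrite subrK distrC => h.
    by move: h xy1 x1; set a := `|x|; set b := `|y - x|; lra.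
  have := ler_normD (y - x) x; rewrite subrK => h.
  by move: h xy1 x2; set a := `|x|; set b := `|y - x|; lra.
apply: ler_wpM2l; first by rewrite invr_ge0 exprn_ge0.
by rewrite lef_pV2 ?posrE ?weight_gt0//; [exact: HC|rewrite mulr_gt0// weight_gt0].
Qed.

End construction.

Theorem gliding_hump (F : Rd -> R[i]) : L1loc F ->
  (forall phi, dotB_smooth phi -> E (fun x => F x * (phi x)%:C)) ->
  exists n, mc T (fun x => F x / (w n x)%:C).
Proof.
move=> lF HF; apply: contrapT => Hn.
pose Fw n : Rd -> R[i] := fun x => F x / (w n x)%:C.
have mFw n : cmeasurable (Fw n).
  by apply: cmeasurableM; [case: lF|exact: weightV_cmeasurable].
have Fwle n x : cabs (Fw n) x <= 1 * cabs F x.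
  rewrite cabs_divw// mul1r ler_pdivrMr ?weight_gt0//.
  by rewrite ler_peMr ?cabs_ge0// weight_ge1.
(* The hypothesis on F is applied to a cutoff equal to 1 on the cube, and w n >= 1 lets [Fw n] be
   dominated by F. *)
have EK n r : E (Defs.cut (cube r) (Fw n)).
  have sc := @cutoff_smooth R d (Num.max r 0).
  have r'0 : 0 <= Num.max r 0 by rewrite le_max lexx orbT.
  have Ec := HF _ (test_dotB sc (cutoff_supp r'0)).
  apply: (tibf_dom hT ler01 Ec _ _).1.
    by apply: cut_cmeasurable => //; exact: cube_compact.
  apply: aeW => x; rewrite cabs_cut (cabsM F (fun x => (cutoff _ x)%:C)) cabs_real.
  rewrite mul1r (ger0_norm (cutoff_ge0 _ _)).
  have [xr|xr] := pselect (cube r x); last first.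
    by rewrite indicE memNset// mul0r mulr_ge0 ?cabs_ge0// cutoff_ge0.
  rewrite indicE mem_set// mul1r cutoff1 ?mulr1; last first.
    by apply: cube_le xr; rewrite le_max lexx.
  by have := Fwle n x; rewrite mul1r.
pose H n a b : Rd -> R[i] := fun x => Defs.cut (cube b) (Fw n) x - Defs.cut (cube a) (Fw n) x.
have EH n a b : E (H n a b) by apply: tibfB; exact: EK.
(* Otherwise every cut of [Fw n] would have norm at most B plus that of the cut to cube a, and
   [Fw n] would be in E_mc. *)
have big n a B : exists b, a <= b /\ B < norm (H n a b).
  have [K [cK HK]] : exists K, compact K /\
      ~ (E (Defs.cut K (Fw n)) /\ norm (Defs.cut K (Fw n)) <= B + norm (Defs.cut (cube a) (Fw n))).
    apply: contrapT => /forallNP nK; apply: Hn; exists n; apply/mcP.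
    have nK' K : compact K -> E (Defs.cut K (Fw n)) /\
        norm (Defs.cut K (Fw n)) <= B + norm (Defs.cut (cube a) (Fw n)).
      by move=> cK; apply: contrapT => h; apply: (nK K).
    split; [|by move=> K /nK'[]|].
      by apply: (L1loc_dom (mFw n) lF) => t; exists 1 => // x _; exact: Fwle.
    have [E0 n0] := nK' set0 compact0.
    exists (B + norm (Defs.cut (cube a) (Fw n))); last by move=> K /nK'[].
    exact: le_trans (tibf_norm_ge0 E0) n0.
  have [s s0 Ks] := compact_sub_cube cK.
  exists (Num.max s a); split; first by rewrite le_max lexx orbT.
  rewrite ltNge; apply/negP => HB; apply: HK.
  have [|EK' le1] := @tibf_dom _ _ T hT 1 _ (Defs.cut K (Fw n)) ler01 (EK n (Num.max s a))
      (cut_cmeasurable cK (mFw n)).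
    apply: aeW => x; rewrite !cabs_cut mul1r; apply: ler_wpM2r; first exact: cabs_ge0.
    apply: indic_sub => y /Ks; apply: cube_le; by rewrite le_max lexx.
  split => //; rewrite mul1r in le1; apply: le_trans le1 _.
  have := tibf_normD (EH n a (Num.max s a)) (EK n a).
  rewrite (_ : (fun x => _ + _) = Defs.cut (cube (Num.max s a)) (Fw n)); last first.
    by apply/funext => x; rewrite /H subrK.
  by move/le_trans; apply; apply: lerD.
have /choice[mC HmC] n : exists mC : nat * R, 0 < mC.2 /\
    forall x y, cube (small R d) (y - x) -> w n y <= mC.2 * w mC.1 x.
  by have [m [C [_ C0 HC]]] := wM_small n; exists (m, C).
have [rho [srho prho rho0 c0]] := bump_exists R d.
set c := \int[mu]_x rho x in c0.
(* The loss in [hump_lower]: on the n-th shell away from its edges, 1 / w is at most [L n] times the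
   hump. *)
pose L n : R := 2 ^+ n * (mC n).2 / c.
have L0 n : 0 < L n.
  by apply: divr_gt0 => //; apply: mulr_gt0; [exact: exprn_gt0|exact: (HmC n).1].
have /choice[next Hnext] : forall p : nat * R, exists b, p.2 + 1 <= b /\
    p.1%:R * L p.1 < norm (H (mC p.1).1 (p.2 + 1) b).
  by move=> p; exact: big.
(* [next] makes the part of F / w between r n + 1 and r n.+1 - 1 larger than n [L n] in norm; the
   added 1 is the outer margin of the shell. *)
pose r := fix r n := if n is k.+1 then next (k, r k) + 1 else -1.
have rS n : r n + 2 <= r n.+1.
  by have := (Hnext (n, r n)).1 => /=; lra.
have [r_mono [N shell mshell]] := @shells R d r (erefl _) rS.
have := HF _ (hump_dotB r_mono shell mshell srho prho).
set phi := corr _ _ => Ephi.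
have ineq n : n%:R <= norm (fun x => F x * (phi x)%:C).
  have [_ /= h1] := Hnext (n, r n).
  rewrite -(ler_pM2r (L0 n)); apply: le_trans (ltW h1) _; rewrite mulrC.
  have H1 := @tibf_dom _ _ T hT (L n) _ (H (mC n).1 (r n + 1) (next (n, r n)))
     (ltW (L0 n)) Ephi (@tibf_L1loc _ _ T _ (EH _ _ _)).1.
  apply: (H1 _).2; apply: aeW => x.
  have xE : next (n, r n) = r n.+1 - 1 by rewrite /= addrK.
  have [x1|x1] := pselect (cube (r n + 1) x).
    rewrite /cabs /H !cut_in// ?subrr ?normc_0.
      by apply: mulr_ge0; [exact: ltW|exact: normc_ge0].
    by apply: cube_le x1; have [] := Hnext (n, r n).
  have [x2|x2] := pselect (cube (next (n, r n)) x); last first.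
    rewrite /cabs /H !cut_out// subrr normc_0.
    by apply: mulr_ge0; [exact: ltW|exact: normc_ge0].
  have -> : cabs (H (mC n).1 (r n + 1) (next (n, r n))) x = cabs (Fw (mC n).1) x.
    by rewrite /cabs /H cut_in// cut_out// subr0.
  rewrite /Fw cabs_divw// (cabsM F (fun x => (phi x)%:C)) cabs_real mulrCA.
  apply: ler_wpM2l; first exact: cabs_ge0.
  have [C0 HC] := HmC n.
  have x1' : r n + 1 < `|x| by rewrite ltNge; apply/negP.
  have x2' : `|x| <= r n.+1 - 1 by rewrite -xE.
  have low := hump_lower r_mono shell mshell srho prho rho0 C0 HC x1' x2'.
  apply: le_trans (ler_wpM2l (ltW (L0 n)) (le_trans low (ler_norm _))).
  rewrite le_eqVlt; apply/orP; left; apply/eqP; rewrite /L -/c.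
  have w0 := gt_eqF (weight_gt0 hw (mC n).1 x).
  have e0 : 2 ^+ n != 0 :> R by rewrite gt_eqF// exprn_gt0.
  field; by rewrite w0 e0 (gt_eqF C0) (gt_eqF c0).
have := ineq (Num.bound (norm (fun x => F x * (phi x)%:C))).
by rewrite leNgt; move/negP; apply; apply: archi_boundP; exact: tibf_norm_ge0.
Qed.

End hump.

(** * Multipliers are smooth functions *)

Section representation.
Local Open Scope complex_scope.
Context (R : realType) (d : nat).
Local Notation Rd := 'rV[R]_d.
Local Notation mu := (@leb_row R d).

(** The representatives of the derivatives along all words satisfy the hypotheses of
    [family_smooth], separately for real and imaginary parts. *)
Lemma weighted_smooth (E : set (Rd -> R[i])) (w : nat -> Rd -> R) v :
  weighted E w v -> exists2 f, smooth f & deq v (regular f).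
Proof.
move=> [_ H].
have /choice[G HG] : forall s : seq 'I_d, exists g : Rd -> R[i],
    L1loc g /\ deq (dderive (miof s) v) (regular g).
  move=> s; have [|g [lg vg _]] := H (size s) (miof s); first by rewrite mi_order_miof.
  by exists g.
have GE s (phi : Rd -> R[i]) : test_function phi ->
    regular (G s) phi = (-1) ^+ size s * v (cder s phi).
  move=> tphi; rewrite -(HG s).2// /dderive mi_order_miof mi_derive_miof//.
  by case/test_functionP : tphi.
have parts s i (psi : Rd -> R) r : smooth_real psi -> supp_in r psi ->
    regular (G s) (fun x => (partial i psi x)%:C) =
    - regular (G (rcons s i)) (fun x => (psi x)%:C).
  move=> sp pp; rewrite !GE; last first.
  - exact: test_function_real (@smooth_partials _ _ [:: i] _ sp) (supp_in_partials [:: i] pp).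
  - exact: test_function_real sp pp.
  rewrite size_rcons exprS mulN1r mulNr opprK; congr (_ * v _).
  by rewrite !cder_real partials_rcons.
have L s := (L1loc_parts (G s)).1 (HG s).1.
have [|f1 sf1 e1] := @family_smooth R d (fun s x => complex.Re (G s x)) (fun s => (L s).1).
  move=> s i psi r sp pp; have := congr1 (@complex.Re R) (parts s i psi r sp pp).
  by rewrite !regular_real.
have [|f2 sf2 e2] := @family_smooth R d (fun s x => complex.Im (G s x)) (fun s => (L s).2).
  move=> s i psi r sp pp; have := congr1 (@complex.Im R) (parts s i psi r sp pp).
  by rewrite !regular_real.
exists (fun x => f1 x +i* f2 x); first by split.
move=> phi tphi; rewrite -(@regular_ae _ _ (G [::])); last first.
  by apply: filterS2 e1 e2 => x h1 h2; apply: complex_ext.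
by rewrite GE//= mul1r cder_nil.
Qed.

(** Only test functions supported in one fixed cube are at hand, so [du_bois_reymond] does not apply
    directly; testing with (f - g) times a cutoff gives the integral of a nonnegative continuous
    function, positive if f and g differ at x. *)
Lemma smooth_test_eq (f g : Rd -> R) (r : R) : 0 <= r -> smooth_real f -> smooth_real g ->
  (forall psi, smooth_real psi -> supp_in (r + 2) psi ->
    \int[mu]_x (f x * psi x) = \int[mu]_x (g x * psi x)) ->
  forall x, cube r x -> f x = g x.
Proof.
move=> r0 sf sg H x xr; apply/eqP; rewrite -subr_eq0; apply/negP => /negP fgx.
have sc := @cutoff_smooth R d r.
pose h : Rd -> R := fun x => f x - g x; have sh : smooth_real h by exact: smoothB.
pose psi : Rd -> R := fun x => h x * cutoff r x.
have sp : smooth_real psi by exact: smoothM.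
have pp : supp_in (r + 2) psi by apply: supp_inM; exact: cutoff_supp.
have cp := @smooth_continuous _ _ _ sp.
have i1 := rL1loc_test (continuous_rL1loc (@smooth_continuous _ _ _ sf)) cp pp.
have i2 := rL1loc_test (continuous_rL1loc (@smooth_continuous _ _ _ sg)) cp pp.
have [i3 e3] := lintegrableB i1 i2.
rewrite (H _ sp pp) subrr in e3.
have E : (fun x => f x * psi x - g x * psi x) = (fun x => h x * psi x).
  by apply/funext => y; rewrite -mulrBl.
rewrite E in i3.
have : 0 < \int[mu]_x (h x * psi x).
  apply: (@lint_gt0 _ _ _ x) => //.
  - by apply: smooth_continuous; exact: smoothM.
  - by move=> y; rewrite /psi mulrA -expr2 mulr_ge0 ?sqr_ge0// cutoff_ge0.
  - by rewrite /psi cutoff1// mulr1 -expr2 exprn_even_gt0.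
have -> : \int[mu]_x (h x * psi x) = \int[mu]_x (f x * psi x - g x * psi x) by rewrite E.
by rewrite e3 ltxx.
Qed.

(** Local representatives are compared by [smooth_test_eq], whose cutoff costs a margin of 2: on
    cube m the function to use is the one of index m + 2. *)
Lemma glue_smooth (u : functional R d) (f : nat -> Rd -> R[i]) :
  (forall m, smooth (f m)) ->
  (forall m phi, test_function phi -> (forall x, ~ cube m%:R x -> phi x = 0) ->
    u phi = regular (f m) phi) ->
  exists2 g, smooth g & deq u (regular g).
Proof.
move=> sf uf.
have agree m k x : (m <= k)%N -> cube m%:R x -> f m.+2 x = f k.+2 x.
  move=> mk xm.
  have key (psi : Rd -> R) : smooth_real psi -> supp_in (m%:R + 2) psi ->
      regular (f m.+2) (fun x => (psi x)%:C) = regular (f k.+2) (fun x => (psi x)%:C).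
    move=> sp pp; have tp := test_function_real sp pp.
    have m2 : m.+2%:R = m%:R + 2 :> R by rewrite -addn2 natrD.
    rewrite -!uf//.
      move=> y yk; rewrite pp// => ym; apply: yk; apply: cube_le ym.
      by rewrite -m2 ler_nat.
    by move=> y yk; rewrite pp// -m2.
  have m0 : 0 <= m%:R :> R by exact: ler0n.
  apply: complex_ext.
    apply: (smooth_test_eq m0 (sf m.+2).1 (sf k.+2).1 _ xm) => psi sp pp.
    by have := congr1 (@complex.Re R) (key psi sp pp); rewrite !regular_real.
  apply: (smooth_test_eq m0 (sf m.+2).2 (sf k.+2).2 _ xm) => psi sp pp.
  by have := congr1 (@complex.Im R) (key psi sp pp); rewrite !regular_real.
pose g (x : Rd) := f (Num.bound `|x|).+2 x.
have bx (x : Rd) : `|x| < (Num.bound `|x|)%:R by exact: archi_boundP.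
have gE m x : cube m%:R x -> g x = f m.+2 x.
  move=> xm; have [h|/ltnW h] := leqP m (Num.bound `|x|).
    by rewrite /g -(agree m).
  by rewrite /g; apply: agree => //; apply: ltW; exact: bx.
have local m s (p : R[i] -> R) x : (forall m, smooth_real (fun x => p (f m x))) ->
    `|x| < m%:R -> differentiable (partials s (fun x => p (g x))) x.
  move=> sp xm; pose U := [set y : Rd | `|y| < m%:R].
  have oU : open U.
    have -> : U = (@Num.norm _ _ : Rd -> R) @^-1` [set t | t < m%:R] by [].
    by apply: open_comp; [move=> y _; exact: norm_continuous|exact: open_lt].
  have E y : U y -> partials s (fun x => p (f m.+2 x)) y = partials s (fun x => p (g x)) y.
    apply: partials_local => // z zU; rewrite (gE m)//; exact: ltW.
  apply: near_differentiable (sp m.+2 s x).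
  by apply: filterS (open_nbhs_nbhs (conj oU xm)).
exists g.
  split=> s x.
    exact: (@local _ s (@complex.Re R) x (fun m => (sf m).1) (bx x)).
  exact: (@local _ s (@complex.Im R) x (fun m => (sf m).2) (bx x)).
move=> phi tphi; have [_ [r r0 H]] := (test_functionP phi).1 tphi.
have rb : r < (Num.bound r)%:R by apply: archi_boundP; exact: ltW.
rewrite (uf (Num.bound r).+2)//; last first.
  move=> x xb; apply: H => xr; apply: xb; apply: cube_le xr.
  by apply: le_trans (ltW rb) _; rewrite ler_nat ltnW.
congr cintegral; apply/funext => x.
have [xr|/H ->] := pselect (cube r x); last by rewrite !mulr0.
by rewrite (gE (Num.bound r))//; apply: cube_le xr; exact: ltW.
Qed.

Section multiplier.
Variables (w : nat -> Rd -> R) (E : set (Rd -> R[i])).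
Hypothesis hw : weight_system w.

Lemma dotB_regular (phi : Rd -> R[i]) : smooth phi ->
  dotB w (regular phi) <-> forall s n, (size s <= n)%N -> L0 (fun x => cder s phi x * (w n x)%:C).
Proof. by move=> sphi; apply: weightedP => //; exact: L0_ae. Qed.

Lemma dotB_smooth_regular (phi : Rd -> R) : dotB_smooth w phi ->
  dotB w (regular (fun x => (phi x)%:C)).
Proof.
move=> [sphi H]; apply/(dotB_regular (smooth_complex sphi)) => s n _.
have -> : (fun x => cder s (fun x => (phi x)%:C) x * (w n x)%:C) =
    (fun x => (partials s phi x * w n x)%:C).
  by apply/funext => x; rewrite cder_real rmorphM.
exact: H.
Qed.

Lemma multiplier_smooth u : multipliers (dotB w) (weighted E w) u ->
  exists2 f, smooth f & deq u (regular f).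
Proof.
move=> [_ H].
pose chi m : Rd -> R[i] := fun x => (cutoff m%:R x)%:C.
have schi m : smooth (chi m) by apply: smooth_complex; exact: cutoff_smooth.
have /choice[f Hf] : forall m, exists f, smooth f /\ deq (dmul u (chi m)) (regular f).
  move=> m; have [|f sf uf] := @weighted_smooth E w (dmul u (chi m)).
    apply: H => //; apply: dotB_smooth_regular.
    have m0 : 0 <= m%:R :> R by exact: ler0n.
    exact (test_dotB hw (@cutoff_smooth R d m%:R) (cutoff_supp m0)).
  by exists f.
apply: (@glue_smooth u f) => [m|m phi tphi pm]; first exact: (Hf m).1.
rewrite -(Hf m).2// /dmul; congr u; apply/funext => x.
have [xm|/pm ->] := pselect (cube m%:R x); last by rewrite mulr0.
by rewrite /chi cutoff1// rmorph1 mul1r.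
Qed.

End multiplier.

End representation.

(** * The multiplier space and condition (S) *)

Section final.
Local Open Scope complex_scope.
Context (R : realType) (d : nat).
Local Notation Rd := 'rV[R]_d.
Local Notation mu := (@leb_row R d).
Variable T : tibf R d.
Hypothesis hT : solid T.
Local Notation E := (tibf_car T).
Local Notation norm := (tibf_norm T).
Variable w : nat -> Rd -> R.
Hypothesis hw : weight_system w.

Lemma tibf_ae_car f g : E f -> {ae mu, forall x, g x = f x} -> E g.
Proof. by move=> Ef gf; have [] := tibf_ae Ef gf. Qed.

Lemma weight_neq0 n x : (w n x)%:C != 0.
Proof. by rewrite fmorph_eq0 gt_eqF// weight_gt0. Qed.

Lemma mc_mul_L0 f h k : mc T (fun x => f x / (w k x)%:C) ->
  L0 (fun x => h x * (w k x)%:C) -> E (fun x => f x * h x).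
Proof.
move=> mf Lh; have := mc_L0 hT mf Lh; congr E; apply/funext => x.
by rewrite mulrA mulrAC mulfVK ?weight_neq0.
Qed.

Definition tempered (f : Rd -> R[i]) : Prop :=
  forall s, exists n, mc T (fun x => cder s f x / (w n x)%:C).

Lemma temperedP f : smooth f -> tempered f <->
  forall a, exists n, mc T (fun x => mi_derive a f x / (w n x)%:C).
Proof.
move=> sf; split=> H s; first exact: H (mseq s).
by have := H (miof s); rewrite mi_derive_miof.
Qed.

Lemma weight_SP n : weight_S w -> exists2 m, (n <= m)%N &
  exists2 C, 0 <= C & {ae mu, forall x, w n x ^+ 2 <= C * w m x}.
Proof.
move=> /(_ n)[m nm /Lp_ooP[_ [C C0 H]]]; exists m => //; exists C => //.
apply: filterS H => x; rewrite cabs_real ger0_norm; last first.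
  by apply: divr_ge0; [exact: sqr_ge0|exact: weight_ge0].
by rewrite ler_pdivrMr ?weight_gt0.
Qed.

Lemma tempered_multiplier u f : weight_S w -> smooth f -> deq u (regular f) ->
  tempered f -> multipliers (dotB w) (weighted E w) u.
Proof.
move=> hS sf uf H; split.
  exact: distribution_deq uf (distribution_regular (L1loc_smooth sf)).
move=> phi sphi /(dotB_regular w sphi) Hphi.
apply/(weightedP w tibf_ae_car (smooth_mul sf sphi) (deq_dmul sphi uf)) => s n _.
have -> : (fun x => cder s (fun x => f x * phi x) x * (w n x)%:C) =
    (fun x => \sum_(p <- splits s) cder p.1 f x * (cder p.2 phi x * (w n x)%:C)).
  apply/funext => x; rewrite cder_mul// mulr_suml.
  by apply: eq_bigr => p _; rewrite mulrA.
apply: tibf_sum => p _; have [k mk] := H p.1; apply: mc_mul_L0 mk _.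
(* One use of (S), at the larger index, since w_n w_k is at most the square of that weight. *)
have [m nkm [C C0 HC]] := weight_SP (maxn n k) hS.
have sm : smooth (cder p.2 phi) by exact: cder_smooth.
(* Membership in [dotB] is granted only for orders up to the index of the weight, so this index is
   raised to the order of p.2. *)
apply: (@L0_dom _ _ C _ _ C0 (Hphi p.2 (maxn m (size p.2)) (leq_maxr _ _))).
  by apply: cmeasurableM; [apply: cmeasurableM; [exact: cmeasurable_smooth|]|];
    exact: weight_cmeasurable.
apply: filterS HC => x HC; rewrite !cabs_mulw// mulrCA -mulrA.
apply: ler_wpM2l; first exact: cabs_ge0.
apply: (@le_trans _ _ (w (maxn n k) x ^+ 2)).
  rewrite expr2; apply: ler_pM; rewrite ?weight_ge0//; apply: weight_mono => //.
    exact: leq_maxl.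
  exact: leq_maxr.
apply: le_trans HC _; apply: ler_wpM2l => //; apply: weight_mono => //.
exact: leq_maxl.
Qed.

Hypothesis hM : weight_wM w.

Lemma multiplier_tempered u : multipliers (dotB w) (weighted E w) u ->
  exists f, [/\ smooth f, deq u (regular f) & tempered f].
Proof.
move=> Hu; have [f sf uf] := multiplier_smooth hw Hu; exists f; split => // s.
have [k] := ubnP (size s); elim: k s => // k IH s sk.
apply: (gliding_hump hT hw hM); first exact: L1loc_smooth (cder_smooth s sf).
move=> phi dphi; have sphi : smooth (fun x => (phi x)%:C).
  by case: dphi => sp _; exact: smooth_complex.
have Y := Hu.2 _ sphi (dotB_smooth_regular dphi).
have sfp := smooth_mul sf sphi.
have /(_ s (size s) (leqnn _)) Es :=
  (weightedP w tibf_ae_car sfp (deq_dmul sphi uf)).1 Y.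
have E1 : E (cder s (fun x => f x * (phi x)%:C)).
  apply: (tibf_dom hT ler01 Es _ _).1.
    exact: cmeasurable_smooth (cder_smooth _ sfp).
  apply: aeW => x; rewrite mul1r cabs_mulw// ler_peMr ?cabs_ge0//.
  exact: weight_ge1.
(* By induction these terms with fewer derivatives on f are in E; subtracting them from the full
   derivative leaves f^(s) phi. *)
have E2 : E (fun x => \sum_(p <- behead (splits s)) cder p.1 f x * (partials p.2 phi x)%:C).
  apply: tibf_sum => p /splits_tl ps; have [n mn] := IH p.1 (leq_trans ps sk).
  apply: mc_mul_L0 mn _; under eq_fun do rewrite -rmorphM; exact: dphi.2.
have := tibfB E1 E2; congr E; apply/funext => x.
rewrite cder_mul// splits_hd big_cons /= cder_nil.
under eq_bigr do rewrite cder_real.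
by rewrite addrK.
Qed.

Lemma weight_S_M : weight_S w -> weight_M T w.
Proof.
move=> hS; apply/seteqP; split => u /=.
  move=> /multiplier_tempered[f [sf uf tf]]; exists f; split => //.
  exact/temperedP.
by move=> [f [sf uf /(temperedP sf) tf]]; exact: tempered_multiplier uf tf.
Qed.

(** * The converse implication *)

Section converse.
Hypothesis hL : (Lp_space +oo%E : set (Rd -> R[i])) `<=` mc T.

(** The constant 1 is in E_mc, so the indicator of the small cube is in E. Translating its translate
    back, [tibf_bounded] bounds the norm of the original by C0 times that of the translate. *)
Lemma translates_bounded_below : exists2 nu, 0 < nu & forall x : Rd,
  exists e, [/\ E e, forall y, e y = (\1_(cube (small R d)) (y - x))%:C & nu <= norm e].
Proof.
pose Q := cube (small R d) : set Rd.
pose e0 : Rd -> R[i] := fun y => (\1_Q y)%:C.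
have E0 : E e0.
  have : Lp_space +oo%E (fun _ : Rd => 1 : R[i]).
    apply/Lp_ooP; split.
      have -> : (fun _ : Rd => 1 : R[i]) = (fun _ => (1 : R)%:C) by [].
      by apply: cmeasurable_real; exact: lmeasurable_cst.
    by exists 1 => //; apply: aeW => x; rewrite (cabs_real (fun _ => 1)) normr1.
  move=> /hL/mcP[_ /(_ _ (@cube_compact R d (small R d))) + _]; congr E.
  by apply/funext => x; rewrite /Defs.cut mulr1.
have n0 : 0 < norm e0.
  rewrite lt_neqAle (tibf_norm_ge0 E0) andbT eq_sym; apply/negP => /eqP z.
  (* The cube is not a null set, as it carries [rho] with positive integral; norm 0 would make the
     indicator vanish almost everywhere. *)
  have [rho [_ prho _]] := bump_exists R d.
  suff -> : \int[mu]_x rho x = 0 by rewrite ltxx.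
  rewrite -(@Rint0 R d); apply: ae_Rintegral.
  apply: filterS (tibf_norm0 E0 z) => x; have [xQ|xQ _] := pselect (Q x).
    by rewrite /e0 indicE mem_set// => /eqP; rewrite oner_eq0.
  exact: prho.
have [C0 C00 HC] := tibf_bounded T.
exists (norm e0 / C0); first exact: divr_gt0.
move=> x; have Ex := tibf_translate x E0.
exists (translate x e0); split => //.
rewrite ler_pdivrMr// mulrC; have := HC (- x) _ Ex; congr (tibf_norm T _ <= _).
by apply/funext => y; rewrite /translate opprK addrK.
Qed.

Lemma weight_M_S : weight_M T w -> weight_S w.
Proof.
move=> hWM n.
(* (wM) is used three times: p transports w n from x to the points of the cube around x, q makes the
   smoothing f0 of w q at least a multiple of w p, and q' bounds all derivatives of f0. *)
have [p [C1 [np C10 H1]]] := wM_small hM n.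
have [q [C2 [pq C20 H2]]] := wM_small hM p.
have [q' [C3 [_ C30 H3]]] := wM_small hM q.
have [rho [srho prho rho0 c0]] := bump_exists R d.
set c := \int[mu]_x rho x in c0.
have lq : rL1loc (w q).
  apply: rL1loc_bounded; first exact: weight_lmeasurable.
  move=> r; have [M M0 HM] := weight_bounded hw q r; exists M => x /HM.
  by rewrite ger0_norm// weight_ge0.
pose f0 := corr (w q) rho.
have sf0 : smooth_real f0 by exact: corr_smooth lq srho prho.
have f0_ge x : w p x / C2 * c <= f0 x.
  apply: corr_lower lq (@smooth_continuous _ _ _ srho) prho rho0 _ => y xy.
  by rewrite ler_pdivrMr// mulrC; apply: H2; exact: cubeN.
have f0_tempered : tempered (fun x => (f0 x)%:C).
  move=> s; exists q'; apply: hL; apply/Lp_ooP; split.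
    apply: cmeasurableM; last exact: weightV_cmeasurable.
    by apply: cmeasurable_smooth; apply: cder_smooth; exact: smooth_complex.
  have cs := @smooth_continuous _ _ _ (smooth_partials s srho).
  have ps := supp_in_partials s prho.
  have [P P0 HP] := supp_in_bounded cs ps.
  pose V : R := fine (mu (cube (small R d))).
  have V0 : 0 <= V by exact: fine_ge0.
  exists (C3 * P * V); first by rewrite !mulr_ge0// ltW.
  apply: aeW => x; rewrite cabs_divw// ler_pdivrMr ?weight_gt0//.
  rewrite cder_real cabs_real (corr_partials s lq srho prho) normrMsign.
  apply: le_trans (corr_upper (M := C3 * w q' x) lq cs ps _ HP _) _.
  - by apply: mulr_ge0; [exact: ltW|exact: weight_ge0].
  - by move=> y xy; rewrite ger0_norm ?weight_ge0//; exact: H3.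
  - by rewrite -/V le_eqVlt; apply/orP; left; apply/eqP; ring.
have sf := smooth_complex sf0.
have Mf0 : multipliers (dotB w) (weighted E w) (regular (fun x => (f0 x)%:C)).
  by rewrite hWM; exists (fun x => (f0 x)%:C); split => //; exact/temperedP.
(* The order 0 condition at weight p says that f0 phi w_p is in E for all phi; with w_p absorbed
   into F, the gliding hump gives f0 w_p / w_m, which dominates a multiple of w_p^2 / w_m. *)
pose F x : R[i] := (f0 x)%:C * (w p x)%:C.
have LF : L1loc F.
  apply: L1locM_bounded.
  - apply: rL1loc_complex; apply: rL1loc_bounded; first exact: weight_lmeasurable.
    move=> r; have [M M0 HM] := weight_bounded hw p r; exists M => x /HM.
    by rewrite ger0_norm// weight_ge0.
  - exact: cmeasurable_smooth.
  - by move=> r; exact: smooth_cube_bounded.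
have [m mF] : exists m, mc T (fun x => F x / (w m x)%:C).
  apply: (gliding_hump hT hw hM) => // phi dphi.
  have sphi : smooth (fun x => (phi x)%:C).
    by case: dphi => sp _; exact: smooth_complex.
  have Y := Mf0.2 _ sphi (dotB_smooth_regular dphi).
  have /(_ [::] p isT) :=
    (weightedP w tibf_ae_car (smooth_mul sf sphi) (deq_dmul sphi (fun _ _ => erefl))).1 Y.
  rewrite cder_nil; congr E; apply/funext => x; by rewrite /F mulrAC.
set h := (fun x => _) in mF.
have habs y : w p y ^+ 2 * c / (C2 * w m y) <= cabs h y.
  rewrite /h cabs_divw// /F (cabsM (fun x => (f0 x)%:C)) weight_cabs// cabs_real.
  have -> : w p y ^+ 2 * c / (C2 * w m y) = w p y / C2 * c * w p y / w m y.
    by field; rewrite !gt_eqF// weight_gt0.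
  apply: ler_wpM2r; first by rewrite invr_ge0 weight_ge0.
  apply: ler_wpM2r; first exact: weight_ge0.
  exact: le_trans (f0_ge y) (ler_norm _).
have [lh Eh [B B0 HB]] := (mcP _ _).1 mF.
have [m' [C4 [mm' C40 H4]]] := wM_small hM m.
have [nu nu0 Hnu] := translates_bounded_below.
(* C1^2 comes from replacing w n x by w p y, C4 from replacing w m' x by w m y, and C2 / c from the
   lower bound of f0. *)
pose K5 := C1 ^+ 2 * C4 * C2 / c.
have K50 : 0 < K5.
  by apply: divr_gt0 => //; do 2!apply: mulr_gt0 => //; exact: exprn_gt0.
have bound x : w n x ^+ 2 / w m' x <= K5 * B / nu.
  have [e [Ee eE nue]] := Hnu x; set qx := _ / _.
  have qx0 : 0 <= qx by apply: divr_ge0; [exact: sqr_ge0|exact: weight_ge0].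
  (* This compact set contains the small cube around x; it depends on x, but the bound B of the cuts
     of h does not. *)
  have cK := @cube_compact R d (`|x| + 1).
  have Eq := tibfZ qx%:C Ee.
  have [|_ le1] := @tibf_dom _ _ T hT K5 _ (fun y => qx%:C * e y) (ltW K50) (Eh _ cK)
      (@tibf_L1loc _ _ T _ Eq).1.
    apply: aeW => y; rewrite cabs_cut (cabsM (fun _ => qx%:C)) (cabs_real (fun _ => qx)).
    rewrite (ger0_norm qx0) /cabs eE -/(cabs h y) normc_real ger0_norm; last first.
      by rewrite indicE ler0n.
    have [yx|yx] := pselect (cube (small R d) (y - x)); last first.
      rewrite indicE memNset// mulr0; apply: mulr_ge0; first exact: ltW.
      by apply: mulr_ge0; [rewrite indicE ler0n|exact: cabs_ge0].
    rewrite indicE mem_set// mulr1 indicE mem_set ?mul1r; last first.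
      rewrite /cube /= -(subrK x y) addrC; apply: le_trans (ler_normD _ _) _.
      by apply: lerD => //; exact: small_norm yx.
    apply: le_trans (ler_wpM2l (ltW K50) (habs y)).
    have a1 : w n x ^+ 2 <= C1 ^+ 2 * w p y ^+ 2.
      rewrite -exprMn ler_sqr ?nnegrE ?weight_ge0//.
        by apply: H1; exact: cubeN.
      by rewrite mulr_ge0 ?weight_ge0// ltW.
    have a2 : (w m' x)^-1 <= C4 / w m y.
      rewrite ler_pdivlMr ?weight_gt0// mulrC ler_pdivrMr ?weight_gt0//.
      exact: H4.
    apply: le_trans (ler_pM _ _ a1 a2) _; first exact: sqr_ge0.
      by rewrite invr_ge0 weight_ge0.
    rewrite le_eqVlt; apply/orP; left; apply/eqP; rewrite /K5.
    by field; rewrite !gt_eqF// weight_gt0.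
  rewrite ler_pdivlMr//; apply: (@le_trans _ _ (qx * norm e)); first exact: ler_wpM2l.
  have := le_trans le1 (ler_wpM2l (ltW K50) (HB _ cK)).
  by rewrite tibf_normZ// normc_real (ger0_norm qx0).
exists (maxn n m'); first exact: leq_maxl.
apply/Lp_ooP; split.
  apply: cmeasurable_real; apply: lmeasurableM.
    by under eq_fun do rewrite expr2; apply: lmeasurableM; exact: weight_lmeasurable.
  by apply: lmeasurableV; [exact: weight_ge0|exact: weight_lmeasurable].
exists (K5 * B / nu).
  by apply: divr_ge0; [apply: mulr_ge0 => //|]; exact: ltW.
apply: aeW => x; rewrite cabs_real ger0_norm; last first.
  by apply: divr_ge0; [exact: sqr_ge0|exact: weight_ge0].
apply: le_trans (bound x); apply: ler_wpM2l; first exact: sqr_ge0.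
rewrite lef_pV2 ?posrE ?weight_gt0//; apply: weight_mono => //; exact: leq_maxr.
Qed.

End converse.

End final.

Theorem theorem5p9 (R : realType) (d : nat) (hd : (0 < d)%N)
    (E : tibf R d) (hE : solid E) (w : nat -> 'rV[R]_d -> R)
    (hw : weight_system w) (hwM : weight_wM w) :
  (weight_S w -> weight_M E w) /\
  ((Lp_space +oo%E : set ('rV[R]_d -> complex R)) `<=` mc E ->
     weight_M E w -> weight_S w).
Proof.
by split; [exact: weight_S_M|exact: weight_M_S].
Qed.
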